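(* Let $M$ be a closed surface immersed in the unit sphere $\mathbb{S}^N$ with parallel mean curvature vector and positive Gaussian curvature. Then: (1) $$\int_M\tilde S(3\tilde S-4c)=2\int_M\tilde{\mathcal B}_1\ge0;$$ (2) $$\int_M\tilde S(3\tilde S-4c)(3\tilde S-5c)=2\int_M\left[\tilde{\mathcal B}_2-\frac14\tilde S(3\tilde S-4c)^2+\frac12|\nabla\tilde S|^2\right]\ge0;$$ (3) $$\begin{aligned}&\int_M\tilde S(3\tilde S-4c)(3\tilde S-5c)(5\tilde S-9c)\\&=2\int_M\left[\tilde{\mathcal B}_3-\frac18\tilde S(3\tilde S-4c)(45\tilde S^2-144c\tilde S+116c^2)+\frac18(65\tilde S-166c)|\nabla\tilde S|^2-\frac58(\triangle\tilde S)^2\right]\\&\ge\int_M\left[\frac34(25\tilde S-42c)|\nabla\tilde S|^2-\frac54(\triangle\tilde S)^2\right].\end{aligned}$$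
   Context: $\mathbb{S}^N$ is the unit sphere in $\mathbb{R}^{N+1}$. A closed surface is a compact connected smooth $2$-manifold without boundary, here with a smooth immersion into $\mathbb{S}^N$ and the induced Riemannian metric $g$. $h$ is the second fundamental form, $\mathbf{H}=\frac12\operatorname{tr}_g h$ the mean curvature vector field, $H=|\mathbf{H}|$. ''Parallel mean curvature vector'' means $\nabla^\perp\mathbf{H}=0$ for the normal connection; then $H$ is constant. Set $c=1+H^2$, $\tilde h=h-\mathbf{H}g$, $\tilde S=|\tilde h|^2=|h|^2-2H^2$; the Gauss equation reads $2K=2c-\tilde S$. $\tilde{\mathcal B}_1=|\nabla\tilde h|^2$, $\tilde{\mathcal B}_2=|\nabla^2\tilde h|^2$, $\tilde{\mathcal B}_3=|\nabla^3\tilde h|^2$ are the squared norms of the first, second and third covariant derivatives of $\tilde h$ (equivalently of $h$, since $\nabla^\perp\mathbf H=0$), taken with the Levi-Civita connection of $g$ and the normal connection; norms are full tensor norms, i.e. sums of squares of all components in orthonormal frames. $\triangle$ is the Laplace–Beltrami operator of $g$ (trace of the Hessian), $\nabla\tilde S$ the gradient, and integrals are with respect to the area measure of $g$. *)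

(* Defs.v *)
From HB Require Import structures.
From mathcomp Require Import all_boot all_order all_algebra.
From mathcomp Require Import all_classical all_reals all_analysis.

Set Implicit Arguments.
Unset Strict Implicit.
Unset Printing Implicit Defensive.

Import Order.TTheory GRing.Theory Num.Theory.
Import numFieldNormedType.Exports.

Local Open Scope classical_set_scope.
Local Open Scope ring_scope.

Definition coord_vec (R : realType) (i : 'I_2) : R * R :=
  if i == ord0 then (1, 0) else (0, 1).

Definition pd (R : realType) (V : normedModType R) (i : 'I_2)
  (F : R * R -> V) : R * R -> V := fun x => 'D_(coord_vec R i) F x.

(* Meant for open [D]: all iterated partial derivatives exist and are
   continuous on [D], i.e. [F] is of class C^oo there. *)
Definition smooth_on (R : realType) (V : normedModType R)
  (D : set (R * R)) (F : R * R -> V) : Prop :=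
  forall (s : seq 'I_2) (x : R * R), D x ->
    {for x, continuous (foldr (@pd R V) F s)} /\
    (forall i : 'I_2, derivable (foldr (@pd R V) F s) x (coord_vec R i)).

(* A homeomorphism [fwd], with inverse [bwd], from an open subset of [M] onto
   an open subset of the plane; the values of [fwd] outside [dom] and of [bwd]
   outside [cod] are junk. *)
Record chart (R : realType) (M : topologicalType) := Chart {
  dom : set M;
  cod : set (R * R);
  fwd : M -> R * R;
  bwd : R * R -> M;
  dom_open : open dom;
  cod_open : open cod;
  fwd_cod : forall p, dom p -> cod (fwd p);
  bwd_dom : forall x, cod x -> dom (bwd x);
  fwdK : forall p, dom p -> bwd (fwd p) = p;
  bwdK : forall x, cod x -> fwd (bwd x) = x;
  fwd_continuous : forall p, dom p -> {for p, continuous fwd};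
  bwd_continuous : forall x, cod x -> {for x, continuous bwd}
}.

(* The carrier is pointed, hence nonempty.  Second countability is automatic
   for a compact locally Euclidean space.  [chart_at] selects a chart of the
   atlas around each point. *)
Record closedSurface (R : realType) := ClosedSurface {
  carrier :> ptopologicalType;
  surface_hausdorff : hausdorff_space carrier;
  surface_compact : compact [set: carrier];
  surface_connected : connected [set: carrier];
  atlas : set (chart R carrier);
  atlas_compat : forall c d, atlas c -> atlas d ->
    smooth_on (cod c `&` bwd c @^-1` dom d) (fwd d \o bwd c);
  chart_at : carrier -> chart R carrier;
  chart_at_atlas : forall p, atlas (chart_at p);
  chart_at_dom : forall p, dom (chart_at p) p
}.

Definition dot (R : realType) (n : nat) (u v : 'rV[R]_n) : R :=
  \sum_(i < n) u ord0 i * v ord0 i.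

(* The formulas of this section are meaningful at a point [x] near which [X] is
   a smooth immersion with values in the unit sphere of R^(n+1). *)
Section LocalGeometry.
Variables (R : realType) (n : nat) (X : R * R -> 'rV[R]_n.+1).

Definition jacobian (x : R * R) : 'M[R]_(2, n.+1) :=
  \matrix_(i < 2, j < n.+1) pd i X x ord0 j.

Definition metric (x : R * R) : 'M[R]_2 :=
  \matrix_(i < 2, j < 2) dot (pd i X x) (pd j X x).

Definition imetric (x : R * R) : 'M[R]_2 := invmx (metric x).

Definition area_density (x : R * R) : R := Num.sqrt (\det (metric x)).

(* [christoffel k i j] is Gamma^k_{ij}. *)
Definition christoffel (k i j : 'I_2) (x : R * R) : R :=
  2^-1 * \sum_(l < 2) imetric x k l *
    (pd i (fun y => metric y j l : R^o) x + pd j (fun y => metric y i l : R^o) x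
     - pd l (fun y => metric y i j : R^o) x).

(* [riemann l k i j] is the l-th component of R(d_i, d_j) d_k, where
   R(U, V) = [nabla_U, nabla_V] - nabla_[U, V]. *)
Definition riemann (l k i j : 'I_2) (x : R * R) : R :=
  pd i (christoffel l j k : R * R -> R^o) x
  - pd j (christoffel l i k : R * R -> R^o) x
  + \sum_(m < 2) (christoffel l i m x * christoffel m j k x
                  - christoffel l j m x * christoffel m i k x).

(* K = <R(d_0, d_1) d_1, d_0> / det g. *)
Definition gauss_curv (x : R * R) : R :=
  (\sum_(l < 2) metric x ord0 l * riemann l ord_max ord0 ord_max x)
  / \det (metric x).

Definition grad_sq (u : R * R -> R) (x : R * R) : R :=
  \sum_(i < 2) \sum_(j < 2)
    imetric x i j * (pd i (u : R * R -> R^o) x * pd j (u : R * R -> R^o) x).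

Definition laplacian (u : R * R -> R) (x : R * R) : R :=
  \sum_(i < 2) \sum_(j < 2) imetric x i j *
    (pd i (pd j (u : R * R -> R^o)) x
     - \sum_(k < 2) christoffel k i j x * pd k (u : R * R -> R^o) x).

(* Orthogonal projection of R^(n+1) onto the normal space of the surface in
   the sphere, i.e. onto the orthogonal complement of X, d_0 X and d_1 X. *)
Definition normal_proj (x : R * R) (v : 'rV[R]_n.+1) : 'rV[R]_n.+1 :=
  v - dot v (X x) *: X x
    - \sum_(i < 2) \sum_(j < 2)
        (imetric x i j * dot v (pd i X x)) *: pd j X x.

Definition normal_deriv (k : 'I_2) (xi : R * R -> 'rV[R]_n.+1) (x : R * R) :=
  normal_proj x (pd k xi x).

(* A covariant tensor field of rank r with values in the normal bundle is given
   by its components in the coordinate frame: [T [:: i_1; ...; i_r] x] is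
   T(d_(i_1), ..., d_(i_r)) at [x]; only lists of size r are meaningful. *)
Definition normal_tensor : Type := seq 'I_2 -> R * R -> 'rV[R]_n.+1.

(* (nabla T)(d_k, d_(i_1), ..., d_(i_r)) = (nabla_(d_k) T)(d_(i_1), ...),
   for the Levi-Civita and the normal connections. *)
Definition cov_deriv (T : normal_tensor) : normal_tensor := fun s x =>
  if s is k :: s' then
    normal_deriv k (T s') x
    - \sum_(a < size s') \sum_(l < 2)
        christoffel l k (nth ord0 s' a) x *: T (set_nth ord0 s' a l) x
  else 0.

(* Full tensor norm squared: all indices are contracted with g^-1. *)
Definition tensor_norm_sq (r : nat) (T : normal_tensor) (x : R * R) : R :=
  \sum_(s : r.-tuple 'I_2) \sum_(t : r.-tuple 'I_2)
    (\prod_(a < r) imetric x (tnth s a) (tnth t a)) * dot (T s x) (T t x).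

(* The normal part in the sphere of the flat derivative d_i d_j X is also that
   of the derivative of d_j X along d_i in the sphere. *)
Definition second_ff : normal_tensor := fun s x =>
  normal_deriv (nth ord0 s 0) (pd (nth ord0 s 1) X) x.

Definition mean_curv (x : R * R) : 'rV[R]_n.+1 :=
  2^-1 *: \sum_(i < 2) \sum_(j < 2) imetric x i j *: second_ff [:: i; j] x.

(* c = 1 + H^2; constant on a connected surface when H is parallel. *)
Definition cconst (x : R * R) : R := 1 + dot (mean_curv x) (mean_curv x).

(* The trace-free part h - H g of the second fundamental form. *)
Definition second_ff0 : normal_tensor := fun s x =>
  second_ff s x - metric x (nth ord0 s 0) (nth ord0 s 1) *: mean_curv x.

Definition Stilde (x : R * R) : R := tensor_norm_sq 2 second_ff0 x.

Definition Btilde (m : nat) (x : R * R) : R :=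
  tensor_norm_sq m.+2 (iter m cov_deriv second_ff0) x.

Definition Stilde_grad_sq (x : R * R) : R := grad_sq Stilde x.

Definition Stilde_laplacian (x : R * R) : R := laplacian Stilde x.

End LocalGeometry.

Notation borel M := (g_sigma_algebraType (@open M)).

Section Immersions.
Variables (R : realType) (n : nat) (M : closedSurface R).
Variable f : M -> 'rV[R]_n.+1.

Definition sphere_immersion : Prop :=
  (forall p, dot (f p) (f p) = 1) /\
  (forall c, atlas c ->
     smooth_on (cod c) (f \o bwd c) /\
     (forall x, cod c x -> row_free (jacobian (f \o bwd c) x))).

Definition parallel_mean_curvature : Prop :=
  forall c, atlas c -> forall x, cod c x -> forall k : 'I_2,
    normal_deriv (f \o bwd c) k (mean_curv (f \o bwd c)) x = 0.

(* The function on [M] defined by a coordinate expression [Q] that does not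
   depend on the choice of coordinates. *)
Definition surface_fun (Q : (R * R -> 'rV[R]_n.+1) -> R * R -> R) (p : M) : R :=
  Q (f \o bwd (chart_at p)) (fwd (chart_at p) p).

(* The area measure is the unique Borel measure which has density
   sqrt (det g) with respect to Lebesgue measure in every chart. *)
Definition is_area_measure (mu : {measure set (borel M) -> \bar R}) : Prop :=
  forall c, atlas c -> forall A : set (borel M), measurable A -> A `<=` dom c ->
    mu A = (\int[(@lebesgue_measure R \x @lebesgue_measure R)%E]_(x in
             fwd c @` A) (area_density (f \o bwd c) x)%:E)%E.

End Immersions.

(* Submission.v *)
Require Import Defs.
From HB Require Import structures.
From mathcomp Require Import all_boot all_order all_algebra.
From mathcomp Require Import ring lra.
From mathcomp Require Import all_classical all_reals all_analysis.
From mathcomp Require Import measurable_realfun.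

(** In a null frame (E, F) of the complexified tangent bundle the trace-free
    second fundamental form is a section phi_0 of the complexified normal bundle
    of spin weight 2 which is holomorphic by Codazzi, because the mean curvature
    vector is parallel.  Bochner's formula, applied to the quartic differential
    Q = <phi_0, phi_0>, gives Lap |Q|^2 >= 4 (2c - S) |Q|^2 = 8 K |Q|^2, whose
    integral vanishes on a closed surface; as K > 0, Q = 0.  Writing
    phi_(k+1) = eth phi_k, the sextic differential <phi_1, phi_1> vanishes for the
    same reason.  With Q = 0 the norms |nabla^k h| are polynomials in c, S,
    |nabla S|^2 and the |phi_k|^2, whose Laplacians close up; each of the three
    formulas then says that two functions differ by a combination of integrands
    u Lap w + <nabla u, nabla w> of Green's formula, and each inequality that a
    combination of the |phi_k|^2 and |nabla S|^2 is nonnegative.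

    The tensor calculus is purely algebraic: it takes place in a commutative ring
    with derivations, instantiated by complex-valued smooth functions on an open
    subset of the plane.  Green's formula is reduced by a smooth partition of
    unity to the divergence theorem for compactly supported fields in a chart. *)

Set Implicit Arguments.
Unset Strict Implicit.
Unset Printing Implicit Defensive.
Import Order.TTheory GRing.Theory Num.Theory.
Import numFieldNormedType.Exports.
Local Open Scope ring_scope.

(** * Immersed frames over a ring with derivations *)

(** Chart independence and the passage to null frames are one algebraic fact: two frames over the
    same ring of functions, related by an invertible matrix with variable entries, give the same
    norms, Laplacian and gradient products. The null frame is obtained from arbitrary coordinate
    fields by Gram-Schmidt over the complex numbers; its connection coefficients are absorbed by the
    weights.

    A null frame is fixed only up to a phase, so that |phi_k|^2 makes sense on the surface while
    phi_k does not. These functions are not glued from charts: on the surface each is defined by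
    solving for it a formula in S, c, the |nabla^k h|^2, Laplacians and gradient products, all known
    to be independent of the chart. Charts then supply only signs and inequalities.

    Q = 0 has to come first: the conjugate derivative of phi_1 contains Q times the conjugate of
    phi_0, and once this term is gone <phi_1, phi_0> = 0 and <phi_1, phi_1> is holomorphic. The
    sextic differential matters because its squared modulus appears in Lap |phi_2|^2. *)

Lemma sum_I2 (V : nmodType) (F : 'I_2 -> V) :
  \sum_(i < 2) F i = F ord0 + F ord_max.
Proof. by rewrite !big_ord_recl big_ord0 addr0; congr (_ + F _); apply/val_inj. Qed.

Lemma I2P (i : 'I_2) : i = ord0 \/ i = ord_max.
Proof. by case: i => [[|[|//]] h]; [left|right]; apply/val_inj. Qed.

Section Derivations.
Variable A : comPzRingType.

Definition derivation (D : A -> A) : Prop :=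
  (forall x y, D (x + y) = D x + D y) /\
  (forall x y, D (x * y) = D x * y + x * D y).

Variables (D : A -> A) (hD : derivation D).

Lemma derD x y : D (x + y) = D x + D y. Proof. exact: hD.1. Qed.
Lemma derM x y : D (x * y) = D x * y + x * D y. Proof. exact: hD.2. Qed.
Lemma der0 : D 0 = 0.
Proof. by apply: (addrI (D 0)); rewrite -derD !addr0. Qed.
Lemma derN x : D (- x) = - D x.
Proof. by apply: (addrI (D x)); rewrite -derD !subrr der0. Qed.
Lemma derB x y : D (x - y) = D x - D y. Proof. by rewrite derD derN. Qed.
Lemma der_sum I (r : seq I) (F : I -> A) :
  D (\sum_(i <- r) F i) = \sum_(i <- r) D (F i).
Proof. exact: (big_morph D derD der0). Qed.
Lemma der1 : D 1 = 0.
Proof. by apply: (addrI (D 1)); rewrite addr0 -{3}[1]mulr1 derM mulr1 mul1r. Qed.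
Lemma derMn x k : D (x *+ k) = D x *+ k.
Proof. by elim: k => [|k IH]; rewrite ?mulr0n ?der0 // !mulrS derD IH. Qed.
Lemma der_nat k : D k%:R = 0. Proof. by rewrite derMn der1 mul0rn. Qed.
Lemma der_int (k : int) : D k%:~R = 0.
Proof. by case: k => k; rewrite ?NegzE ?mulrNz ?derN der_nat ?oppr0. Qed.
Lemma derMz k x : D (k%:~R * x) = k%:~R * D x.
Proof. by rewrite derM der_int mul0r add0r. Qed.

End Derivations.

Section Vectors.
Variables (A : comPzRingType) (n : nat).
Implicit Types (a : A) (u v w : 'rV[A]_n).

Definition adot u v : A := \sum_j u ord0 j * v ord0 j.

Lemma adotC u v : adot u v = adot v u.
Proof. by apply: eq_bigr => j _; rewrite mulrC. Qed.
Lemma adotDl u v w : adot (u + v) w = adot u w + adot v w.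
Proof. by rewrite -big_split; apply: eq_bigr => j _; rewrite mxE mulrDl. Qed.
Lemma adotZl a u w : adot (a *: u) w = a * adot u w.
Proof. by rewrite mulr_sumr; apply: eq_bigr => j _; rewrite mxE mulrA. Qed.
Lemma adotDr u v w : adot w (u + v) = adot w u + adot w v.
Proof. by rewrite adotC adotDl !(adotC w). Qed.
Lemma adotZr a u w : adot w (a *: u) = a * adot w u.
Proof. by rewrite adotC adotZl adotC. Qed.
Lemma adotNl u w : adot (- u) w = - adot u w.
Proof. by rewrite -scaleN1r adotZl mulN1r. Qed.
Lemma adotNr u w : adot w (- u) = - adot w u.
Proof. by rewrite adotC adotNl adotC. Qed.
Lemma adotBl u v w : adot (u - v) w = adot u w - adot v w.
Proof. by rewrite adotDl adotNl. Qed.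
Lemma adotBr u v w : adot w (u - v) = adot w u - adot w v.
Proof. by rewrite adotDr adotNr. Qed.
Lemma adot0l w : adot 0 w = 0.
Proof. by rewrite -(scale0r w) adotZl mul0r. Qed.
Lemma adot0r w : adot w 0 = 0.
Proof. by rewrite adotC adot0l. Qed.
Lemma adot_suml I (r : seq I) (F : I -> 'rV[A]_n) w :
  adot (\sum_(i <- r) F i) w = \sum_(i <- r) adot (F i) w.
Proof. exact: (big_morph (adot^~ w) (fun u v => adotDl u v w) (adot0l w)). Qed.
Lemma adot_sumr I (r : seq I) (F : I -> 'rV[A]_n) w :
  adot w (\sum_(i <- r) F i) = \sum_(i <- r) adot w (F i).
Proof. by rewrite adotC adot_suml; apply: eq_bigr => i _; rewrite adotC. Qed.

Definition adotE := (adotDl, adotDr, adotBl, adotBr, adotNl, adotNr, adotZl,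
  adotZr, adot0l, adot0r).

Definition dv (D : A -> A) (u : 'rV[A]_n) : 'rV[A]_n := \row_j D (u ord0 j).

Variables (D : A -> A) (hD : derivation D).
Lemma dvD u v : dv D (u + v) = dv D u + dv D v.
Proof. by apply/rowP => j; rewrite !mxE derD. Qed.
Lemma dvZ a u : dv D (a *: u) = D a *: u + a *: dv D u.
Proof. by apply/rowP => j; rewrite !mxE derM. Qed.
Lemma dvN u : dv D (- u) = - dv D u.
Proof. by apply/rowP => j; rewrite !mxE derN. Qed.
Lemma dv0 : dv D 0 = 0.
Proof. by apply/rowP => j; rewrite !mxE der0. Qed.
Lemma dv_sum I (r : seq I) (F : I -> 'rV[A]_n) :
  dv D (\sum_(i <- r) F i) = \sum_(i <- r) dv D (F i).
Proof. exact: (big_morph (dv D) dvD dv0). Qed.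
Lemma der_adot u v : D (adot u v) = adot (dv D u) v + adot u (dv D v).
Proof.
rewrite /adot der_sum // -big_split; apply: eq_bigr => j _.
by rewrite derM // !mxE.
Qed.
End Vectors.

(** * Geometry of an immersion in a moving frame: projections, covariant derivatives, norms *)

Section FrameDefs.
Variables (A : comPzRingType) (n : nat) (half : A) (X : 'rV[A]_n).
Variables (D : 'I_2 -> A -> A) (gi : 'M[A]_2).
Implicit Types (v w : 'rV[A]_n).

Definition fr i := dv (D i) X.
Definition gm : 'M[A]_2 := \matrix_(i, j) adot (fr i) (fr j).
Definition tan k v := \sum_l gi k l * adot v (fr l).
Definition chr k i j := tan k (dv (D i) (fr j)).
Definition nproj v := v - adot v X *: X - \sum_i \sum_j (gi i j * adot v (fr i)) *: fr j.
Definition ncov k v := nproj (dv (D k) v).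

Definition tens := seq 'I_2 -> 'rV[A]_n.

(** The Christoffel terms of a covariant derivative, one for each index. Peeling off the first index
    and currying the tensor replaces the sum over positions, so that properties follow by induction
    on the list for an arbitrary tensor. *)
Fixpoint corr k (s : seq 'I_2) (T : tens) : 'rV[A]_n :=
  if s is i :: s' then
    \sum_l chr l k i *: T (l :: s') + corr k s' (fun s => T (i :: s))
  else 0.

Definition covd (T : tens) : tens := fun s =>
  if s is k :: s' then ncov k (T s') - corr k s' T else 0.

(** The tensor inner product, kept polarised because the recursion contracts the first index of [T]
    with a different first index of [U]. *)
Fixpoint nsq r (T U : tens) : A :=
  if r is r'.+1 then
    \sum_i \sum_j gi i j * nsq r' (fun s => T (i :: s)) (fun s => U (j :: s))
  else adot (T [::]) (U [::]).

Definition sff : tens := fun s => ncov (nth ord0 s 0) (fr (nth ord0 s 1)).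
Definition mcv := half *: \sum_i \sum_j gi i j *: sff [:: i; j].
Definition sff0 : tens := fun s =>
  sff s - gm (nth ord0 s 0) (nth ord0 s 1) *: mcv.
Definition aC := 1 + adot mcv mcv.
Definition aS := nsq 2 sff0 sff0.
Definition aB m := nsq m.+2 (iter m covd sff0) (iter m covd sff0).
Definition agrad (u w : A) := \sum_i \sum_j gi i j * (D i u * D j w).
Definition alap (w : A) :=
  \sum_i \sum_j gi i j * (D i (D j w) - \sum_k chr k i j * D k w).

(** The derivations need not commute: [fr_tors] says that their bracket is the one prescribed by a
    torsion-free connection, which covers coordinate frames and null frames alike. The inverse
    metric [gi] is part of the data, since the ring offers no division. *)
Record frame : Prop := Frame {
  fr_der : forall i, derivation (D i);
  fr_half : half * 2%:R = 1;
  fr_XX : adot X X = 1;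
  fr_gi : gi *m gm = 1%:M;
  fr_tors : forall i j x, D i (D j x) - D j (D i x)
    = \sum_k (chr k i j - chr k j i) * D k x }.

Hypothesis fh : frame.

Lemma halfI (x y : A) : x + x = y + y -> x = y.
Proof.
move=> e; rewrite -[x]mul1r -[y]mul1r -(fr_half fh) -!mulrA !mulr_natl !mulr2n.
by rewrite e.
Qed.

Lemma fr_X i : adot (fr i) X = 0.
Proof.
apply: halfI; rewrite addr0 -(der1 (fr_der fh i)) -(fr_XX fh).
by rewrite (der_adot (fr_der fh i)) (adotC X).
Qed.

Lemma gm_sym i j : gm i j = gm j i.
Proof. by rewrite !mxE adotC. Qed.

Lemma gmT : gm^T = gm.
Proof. by apply/matrixP => i j; rewrite mxE gm_sym. Qed.

Lemma fr_gi' : gm *m gi = 1%:M. Proof. exact: mulmx1C (fr_gi fh). Qed.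

Lemma giT : gi^T = gi.
Proof.
rewrite -[LHS]mulmx1 -fr_gi' mulmxA -{1}gmT -trmx_mul fr_gi' trmx1.
by rewrite mul1mx.
Qed.

Lemma gi_sym i j : gi i j = gi j i.
Proof. by rewrite -{1}giT mxE. Qed.

Lemma tan_fr k i : tan k (fr i) = (k == i)%:R.
Proof.
have /matrixP/(_ k i) := fr_gi fh; rewrite !mxE => <-.
by apply: eq_bigr => l _; rewrite mxE adotC.
Qed.

Lemma nprojE v : nproj v = v - adot v X *: X - \sum_j tan j v *: fr j.
Proof.
rewrite /nproj exchange_big; congr (_ - _); apply: eq_bigr => j _.
by rewrite scaler_suml; apply: eq_bigr => i _; rewrite gi_sym.
Qed.

Lemma tanD k v w : tan k (v + w) = tan k v + tan k w.
Proof. by rewrite -big_split; apply: eq_bigr => l _; rewrite adotDl mulrDr. Qed.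
Lemma tanZ k a v : tan k (a *: v) = a * tan k v.
Proof. by rewrite mulr_sumr; apply: eq_bigr => l _; rewrite adotZl mulrCA. Qed.
Lemma tan0 k : tan k 0 = 0.
Proof. by rewrite -(scale0r 0) tanZ mul0r. Qed.
Lemma tan_sum k I (r : seq I) (F : I -> 'rV[A]_n) :
  tan k (\sum_(i <- r) F i) = \sum_(i <- r) tan k (F i).
Proof. exact: (big_morph (tan k) (tanD k) (tan0 k)). Qed.
Lemma tan_X k : tan k X = 0.
Proof. by apply: big1 => l _; rewrite adotC fr_X mulr0. Qed.

Lemma nprojD v w : nproj (v + w) = nproj v + nproj w.
Proof.
rewrite !nprojE adotDl scalerDl.
rewrite (eq_bigr (fun j => tan j v *: fr j + tan j w *: fr j)); last first.
  by move=> j _; rewrite tanD scalerDl.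
rewrite big_split /=; move: (\sum_j _) (\sum_j _) => a b.
by rewrite !opprD (addrACA v) (addrACA (v - _)).
Qed.
Lemma nprojZ a v : nproj (a *: v) = a *: nproj v.
Proof.
rewrite !nprojE adotZl !scalerBr scalerA; congr (_ - _).
by rewrite scaler_sumr; apply: eq_bigr => j _; rewrite tanZ scalerA.
Qed.
Lemma nproj0 : nproj 0 = 0.
Proof. by rewrite -(scale0r 0) nprojZ !scale0r. Qed.
Lemma nprojN v : nproj (- v) = - nproj v.
Proof. by rewrite -scaleN1r nprojZ scaleN1r. Qed.
Lemma nproj_sum I (r : seq I) (F : I -> 'rV[A]_n) :
  nproj (\sum_(i <- r) F i) = \sum_(i <- r) nproj (F i).
Proof. exact: (big_morph nproj nprojD nproj0). Qed.

Lemma nproj_fr i : nproj (fr i) = 0.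
Proof.
rewrite nprojE fr_X scale0r subr0 (bigD1 i) //= tan_fr eqxx scale1r.
by rewrite big1 ?addr0 ?subrr // => j /negPf h; rewrite tan_fr h scale0r.
Qed.

Lemma nproj_X : nproj X = 0.
Proof.
rewrite nprojE (fr_XX fh) scale1r subrr big1 ?subr0 // => j _.
by rewrite tan_X scale0r.
Qed.

Lemma nproj_idem v : nproj (nproj v) = nproj v.
Proof.
rewrite [X in nproj X]nprojE !nprojD !nprojN nprojZ nproj_X scaler0 oppr0 addr0 nproj_sum.
by rewrite big1 ?subr0 // => j _; rewrite nprojZ nproj_fr scaler0.
Qed.

Lemma adot_nproj_X v : adot (nproj v) X = 0.
Proof.
rewrite nprojE !adotE (fr_XX fh) mulr1 subrr adot_suml big1 ?subr0 // => j _.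
by rewrite adotZl fr_X mulr0.
Qed.

Lemma tan_nproj k v : tan k (nproj v) = 0.
Proof.
rewrite nprojE tanD tanD -!scaleN1r !tanZ tan_X tan_sum mulr0 mulr0 addr0.
rewrite (bigD1 k) //= tanZ tan_fr eqxx mulr1 big1 ?addr0; last first.
  by move=> j /negPf h; rewrite tanZ tan_fr eq_sym h mulr0.
by rewrite mulN1r subrr.
Qed.

Lemma adot_tan v l : adot v (fr l) = \sum_k gm l k * tan k v.
Proof.
have E m : \sum_k gm l k * gi k m = (l == m)%:R.
  by have /matrixP/(_ l m) := fr_gi'; rewrite mxE => ->; rewrite mxE.
transitivity (\sum_m (l == m)%:R * adot v (fr m)).
  rewrite (bigD1 l) //= eqxx mul1r big1 ?addr0 // => m /negPf h.
  by rewrite eq_sym h mul0r.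
rewrite [RHS](eq_bigr (fun k => \sum_m gm l k * gi k m * adot v (fr m))).
  by rewrite exchange_big; apply: eq_bigr => m _; rewrite -mulr_suml E.
by move=> k _; rewrite mulr_sumr; apply: eq_bigr => m _; rewrite mulrA.
Qed.

Lemma adot_nproj_fr v l : adot (nproj v) (fr l) = 0.
Proof. by rewrite adot_tan big1 // => k _; rewrite tan_nproj mulr0. Qed.

Lemma adot_nproj v w : adot (nproj v) w = adot (nproj v) (nproj w).
Proof.
rewrite (nprojE w) !adotBr adotZr adot_nproj_X mulr0 subr0 adot_sumr.
rewrite big1 ?subr0 //.
by move=> j _; rewrite adotZr adot_nproj_fr mulr0.
Qed.

Lemma ncovD k v w : ncov k (v + w) = ncov k v + ncov k w.
Proof. by rewrite /ncov (dvD (fr_der fh k)) nprojD. Qed.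
Lemma ncovZ k a v : ncov k (a *: v) = D k a *: nproj v + a *: ncov k v.
Proof. by rewrite /ncov (dvZ (fr_der fh k)) nprojD !nprojZ. Qed.

End FrameDefs.

(** * Change of frame: Christoffel symbols, Hessian, Laplacian *)

Section FrameChange.
Variables (A : comPzRingType) (n : nat) (half : A) (X : 'rV[A]_n).
Variables (D D' : 'I_2 -> A -> A) (gi gi' P Q : 'M[A]_2).
Hypothesis fh : frame half X D gi.
Hypothesis hD' : forall a x, D' a x = \sum_i P a i * D i x.
Hypothesis QP : Q *m P = 1%:M.
Hypothesis gi'K : gi' *m gm X D' = 1%:M.
Implicit Types (v w : 'rV[A]_n).

Let hd := fr_der fh.

Lemma fc_der a : derivation (D' a).
Proof.
split=> x y; rewrite !hD'.
  by rewrite -big_split; apply: eq_bigr => i _; rewrite (derD (hd i)) mulrDr.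
rewrite mulr_suml mulr_sumr -big_split; apply: eq_bigr => i _ /=.
by rewrite (derM (hd i)); ring.
Qed.

Lemma fc_dv a v : dv (D' a) v = \sum_i P a i *: dv (D i) v.
Proof.
apply/rowP => j; rewrite mxE hD' summxE; apply: eq_bigr => i _.
by rewrite !mxE.
Qed.

Lemma fc_fr a : fr X D' a = \sum_i P a i *: fr X D i.
Proof. exact: fc_dv. Qed.

Lemma fc_gm : gm X D' = P *m gm X D *m P^T.
Proof.
apply/matrixP => a b; rewrite !mxE !fc_fr adot_suml.
under eq_bigr do rewrite adotZl adot_sumr mulr_sumr.
rewrite exchange_big; apply: eq_bigr => j _; rewrite !mxE mulr_suml.
by apply: eq_bigr => i _; rewrite adotZr !mxE; ring.
Qed.

Lemma fc_gi : gi = P^T *m gi' *m P.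
Proof.
have H : P^T *m gi' *m P *m gm X D = 1%:M.
  have E : P *m gm X D = gm X D' *m Q^T.
    by rewrite fc_gm -mulmxA -trmx_mul QP trmx1 mulmx1.
  by rewrite -mulmxA E mulmxA -(mulmxA P^T) gi'K mulmx1 -trmx_mul QP trmx1.
by rewrite -[LHS]mul1mx -H -mulmxA (fr_gi' fh) mulmx1.
Qed.

Lemma fc_giE i j : gi i j = \sum_a \sum_b P a i * P b j * gi' a b.
Proof.
rewrite fc_gi mxE exchange_big; apply: eq_bigr => b _.
rewrite mxE mulr_suml; apply: eq_bigr => a _; rewrite !mxE; ring.
Qed.

Let gi'_sym a b : gi' a b = gi' b a.
Proof.
have gT : (gm X D')^T = gm X D' by apply/matrixP => i j; rewrite !mxE adotC.
have g' : gm X D' *m gi' = 1%:M by exact: mulmx1C gi'K.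
suff E : gi'^T = gi' by rewrite -{1}E mxE.
rewrite -[LHS]mulmx1 -g' mulmxA -{1}gT -trmx_mul g' trmx1.
by rewrite mul1mx.
Qed.

Lemma fc_tan j v : tan X D gi j v = \sum_b P b j * tan X D' gi' b v.
Proof.
rewrite [RHS](eq_bigr (fun b => \sum_c \sum_l
   P b j * P c l * gi' b c * adot v (fr X D l))); last first.
  move=> b _; rewrite mulr_sumr; apply: eq_bigr => c _.
  rewrite fc_fr adot_sumr !mulr_sumr; apply: eq_bigr => l _.
  by rewrite adotZr; ring.
rewrite [LHS](eq_bigr (fun l => \sum_b \sum_c
   P b j * P c l * gi' b c * adot v (fr X D l))); last first.
  by move=> l _; rewrite fc_giE mulr_suml; apply: eq_bigr => b _; rewrite mulr_suml.
by rewrite exchange_big; apply: eq_bigr => b _; rewrite exchange_big.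
Qed.

Lemma fc_nproj v : nproj X D' gi' v = nproj X D gi v.
Proof.
rewrite (nprojE fh) /nproj; congr (_ - _).
rewrite exchange_big.
transitivity (\sum_b tan X D' gi' b v *: fr X D' b).
  apply: eq_bigr => b _; rewrite scaler_suml; apply: eq_bigr => c _.
  by rewrite gi'_sym.
rewrite [LHS](eq_bigr (fun b => \sum_j (P b j * tan X D' gi' b v) *: fr X D j)).
  rewrite exchange_big; apply: eq_bigr => j _.
  by rewrite -scaler_suml -fc_tan.
move=> b _; rewrite fc_fr scaler_sumr; apply: eq_bigr => j _.
by rewrite scalerA mulrC.
Qed.

Lemma fc_ncov a v : ncov X D' gi' a v = \sum_i P a i *: ncov X D gi i v.
Proof.
rewrite /ncov fc_nproj fc_dv (nproj_sum fh); apply: eq_bigr => i _.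
by rewrite (nprojZ fh).
Qed.

(** The transformation law of the Christoffel symbols: both sides are the [j]-th component in the
    old frame of the derivative of the new frame vector [a] in the new direction [k]. *)
Lemma fc_chr k a j : D' k (P a j) + \sum_l P a l * \sum_i P k i * chr X D gi j i l
  = \sum_b chr X D' gi' b k a * P b j.
Proof.
transitivity (tan X D gi j (dv (D' k) (fr X D' a))); last first.
  by rewrite fc_tan; apply: eq_bigr => b _; rewrite mulrC.
rewrite fc_fr (dv_sum (fc_der k)) tan_sum.
under [RHS]eq_bigr do rewrite (dvZ (fc_der k)) tanD !tanZ.
rewrite big_split /=; congr (_ + _).
  rewrite (bigD1 j) //= (tan_fr fh) eqxx mulr1 big1 ?addr0 // => l /negPf h.
  by rewrite (tan_fr fh) eq_sym h mulr0.
apply: eq_bigr => l _; congr (_ * _).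
by rewrite fc_dv tan_sum; apply: eq_bigr => i _; rewrite tanZ.
Qed.

Lemma fc_frame : frame half X D' gi'.
Proof.
split=> //; [exact: fc_der|exact: fr_half fh|exact: fr_XX fh|].
move=> a b x.
(* The second derivative splits into a first-order part with the new Christoffel symbols and a
   tensorial Hessian. The Hessian is symmetric by the old torsion identity, in the form [F], so the
   bracket sees only the first part. *)
have E k c : D' k (D' c x) = \sum_j (\sum_d chr X D' gi' d k c * P d j) * D j x
   + \sum_i \sum_j P c j * P k i * (D i (D j x) - \sum_l chr X D gi l i j * D l x).
  rewrite (hD' c) (der_sum (fc_der k)).
  under eq_bigr do rewrite (derM (fc_der k)).
  have h0 := fc_chr k c ord0; have h1 := fc_chr k c ord_max.
  by rewrite !sum_I2 in h0 h1 *; rewrite -h0 -h1 !hD' !sum_I2; ring.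
have F i j : D i (D j x) - \sum_l chr X D gi l i j * D l x
   = D j (D i x) - \sum_l chr X D gi l j i * D l x.
  have /eqP := fr_tors fh i j x; rewrite subr_eq => /eqP ->.
  by rewrite !sum_I2; ring.
rewrite !E [in X in _ - (_ + X)]exchange_big /=.
have -> : \sum_j \sum_i P a j * P b i * (D i (D j x) - \sum_l chr X D gi l i j * D l x)
  = \sum_i \sum_j P b j * P a i * (D i (D j x) - \sum_l chr X D gi l i j * D l x).
  apply: eq_bigr => i _; apply: eq_bigr => j _; rewrite F; ring.
by rewrite opprD addrACA subrr addr0 !sum_I2 !hD' !sum_I2; ring.
Qed.

Lemma fc_agrad (u w : A) : agrad D' gi' u w = agrad D gi u w.
Proof. by rewrite /agrad !sum_I2 !hD' !fc_giE !sum_I2; ring. Qed.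

Lemma fc_hess c k x : D' k (D' c x) - \sum_d chr X D' gi' d k c * D' d x =
  \sum_i \sum_j P c j * P k i * (D i (D j x) - \sum_l chr X D gi l i j * D l x).
Proof.
rewrite (hD' c) (der_sum (fc_der k)).
under eq_bigr do rewrite (derM (fc_der k)).
have h0 := fc_chr k c ord0; have h1 := fc_chr k c ord_max.
have -> : \sum_d chr X D' gi' d k c * D' d x =
  \sum_j (\sum_d chr X D' gi' d k c * P d j) * D j x.
  rewrite !sum_I2 !hD' !sum_I2; ring.
by rewrite !sum_I2 in h0 h1 *; rewrite -h0 -h1 !hD' !sum_I2; ring.
Qed.

Lemma fc_alap (w : A) : alap X D' gi' w = alap X D gi w.
Proof.
rewrite /alap.
under [LHS]eq_bigr do under eq_bigr do rewrite fc_hess.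
rewrite [RHS](eq_bigr (fun i => \sum_j (\sum_a \sum_b P a i * P b j * gi' a b) *
  (D i (D j w) - \sum_k chr X D gi k i j * D k w))); last first.
  by move=> i _; apply: eq_bigr => j _; rewrite fc_giE.
by rewrite !sum_I2; ring.
Qed.

Fixpoint tr (s : seq 'I_2) (T : tens A n) : 'rV[A]_n :=
  if s is a :: s' then \sum_i P a i *: tr s' (fun s => T (i :: s)) else T [::].

Lemma eq_tr s (T U : tens A n) : (forall s', size s' = size s -> T s' = U s') -> tr s T = tr s U.
Proof.
elim: s T U => [|a s IH] T U h /=; first exact: h.
by apply: eq_bigr => i _; rewrite (IH _ (fun s => U (i :: s))) // => s' /= e; apply: h; rewrite /= e.
Qed.

Lemma trD s (T U : tens A n) : tr s (fun s => T s + U s) = tr s T + tr s U.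
Proof.
elim: s T U => [|a s IH] T U //=.
rewrite -big_split; apply: eq_bigr => i _.
by rewrite (IH (fun s => T (i :: s))) scalerDr.
Qed.

Lemma trZ s c (T : tens A n) : tr s (fun s => c *: T s) = c *: tr s T.
Proof.
elim: s T => [|a s IH] T //=.
rewrite scaler_sumr; apply: eq_bigr => i _.
by rewrite (IH (fun s => T (i :: s))) !scalerA mulrC.
Qed.

Lemma tr0 s : tr s (fun=> 0) = 0.
Proof. by elim: s => [|a s IH] //=; apply: big1 => i _; rewrite IH scaler0. Qed.

Lemma tr_sum s (I : Type) (r : seq I) (T : I -> tens A n) :
  tr s (fun s => \sum_(i <- r) T i s) = \sum_(i <- r) tr s (T i).
Proof.
elim: r => [|i r IH].
  by rewrite big_nil -[RHS](tr0 s); apply: eq_tr => s' _; rewrite big_nil.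
rewrite big_cons -IH -trD; apply: eq_tr => s' _; by rewrite big_cons.
Qed.

Lemma eq_corr k s (T U : tens A n) : (forall s', size s' = size s -> T s' = U s') ->
  corr X D gi k s T = corr X D gi k s U.
Proof.
elim: s T U => [|a s IH] T U h //=; congr (_ + _).
  by apply: eq_bigr => i _; rewrite h.
by apply: IH => s' e; apply: h; rewrite /= e.
Qed.

End FrameChange.

Section CorrLinear.
Variables (A : comPzRingType) (n : nat) (X : 'rV[A]_n).
Variables (D : 'I_2 -> A -> A) (gi : 'M[A]_2).
Implicit Types (T U : tens A n).

Lemma corrD k s T U : corr X D gi k s (fun s => T s + U s)
  = corr X D gi k s T + corr X D gi k s U.
Proof.
elim: s T U => [|i s IH] T U /=; first by rewrite addr0.
rewrite (IH (fun s => T (i :: s))) addrACA; congr (_ + _).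
by rewrite -big_split; apply: eq_bigr => l _; rewrite scalerDr.
Qed.
Lemma corrZ k s c T : corr X D gi k s (fun s => c *: T s) = c *: corr X D gi k s T.
Proof.
elim: s T => [|i s IH] T /=; first by rewrite scaler0.
rewrite (IH (fun s => T (i :: s))) scalerDr; congr (_ + _).
by rewrite scaler_sumr; apply: eq_bigr => l _; rewrite !scalerA mulrC.
Qed.

Lemma eq_nsq r T U T1 U1 : (forall s, size s = r -> T s = T1 s) ->
  (forall s, size s = r -> U s = U1 s) -> nsq gi r T U = nsq gi r T1 U1.
Proof.
elim: r T U T1 U1 => [|r IH] T U T1 U1 hT hU /=; first by rewrite hT ?hU.
apply: eq_bigr => i _; apply: eq_bigr => j _; congr (_ * _).
by apply: IH => s e; [apply: hT|apply: hU]; rewrite /= e.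
Qed.
Lemma nsqDl r T T1 U :
  nsq gi r (fun s => T s + T1 s) U = nsq gi r T U + nsq gi r T1 U.
Proof.
elim: r T T1 U => [|r IH] T T1 U /=; first by rewrite adotDl.
rewrite -big_split; apply: eq_bigr => i _; rewrite -big_split.
by apply: eq_bigr => j _; rewrite IH mulrDr.
Qed.
Lemma nsqZl r a T U : nsq gi r (fun s => a *: T s) U = a * nsq gi r T U.
Proof.
elim: r T U => [|r IH] T U /=; first by rewrite adotZl.
rewrite mulr_sumr; apply: eq_bigr => i _; rewrite mulr_sumr.
by apply: eq_bigr => j _; rewrite IH mulrCA.
Qed.
Lemma nsqDr r T U U1 :
  nsq gi r T (fun s => U s + U1 s) = nsq gi r T U + nsq gi r T U1.
Proof.
elim: r T U U1 => [|r IH] T U U1 /=; first by rewrite adotDr.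
rewrite -big_split; apply: eq_bigr => i _; rewrite -big_split.
by apply: eq_bigr => j _; rewrite IH mulrDr.
Qed.
Lemma nsqZr r a T U : nsq gi r T (fun s => a *: U s) = a * nsq gi r T U.
Proof.
elim: r T U => [|r IH] T U /=; first by rewrite adotZr.
rewrite mulr_sumr; apply: eq_bigr => i _; rewrite mulr_sumr.
by apply: eq_bigr => j _; rewrite IH mulrCA.
Qed.

End CorrLinear.

(** * Frame independence of the tensor norms *)

Section FrameChangeTensors.
Variables (A : comPzRingType) (n : nat) (half : A) (X : 'rV[A]_n).
Variables (D D' : 'I_2 -> A -> A) (gi gi' P Q : 'M[A]_2).
Hypothesis fh : frame half X D gi.
Hypothesis hD' : forall a x, D' a x = \sum_i P a i * D i x.
Hypothesis QP : Q *m P = 1%:M.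
Hypothesis gi'K : gi' *m gm X D' = 1%:M.
Implicit Types (v w : 'rV[A]_n) (T : tens A n).
Let fh' : frame half X D' gi' := fc_frame fh hD' QP gi'K.
Local Notation tr := (tr P).
Local Notation N := (nproj X D gi).

Definition normal T := forall s, N (T s) = T s.


Lemma normal_tr s T : normal T -> N (tr s T) = tr s T.
Proof.
elim: s T => [|a s IH] T h /=; first exact: h.
rewrite (nproj_sum fh); apply: eq_bigr => i _; rewrite (nprojZ fh) IH //.
Qed.

(** Derivatives of the entries of [P] cancel against the inhomogeneous term in the law of the
    Christoffel symbols. Normality makes the Leibniz rule usable: the rule leaves the normal
    projection of a component, which has to be the component itself. *)
Lemma covd_tr_aux k s T : normal T ->
  ncov X D' gi' k (tr s T) - corr X D' gi' k s (tr^~ T) =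
  \sum_i P k i *: tr s (fun s => ncov X D gi i (T s) - corr X D gi i s T).
Proof.
elim: s T => [|a s IH] T hT.
  rewrite /= subr0 (fc_ncov fh hD' QP gi'K).
  by apply: eq_bigr => i _; rewrite subr0.
have hTj j : normal (fun s => T (j :: s)) by move=> s'; apply: hT.
rewrite [RHS](eq_bigr (fun i => P k i *: \sum_l P a l *: (tr s (fun s =>
   ncov X D gi i (T (l :: s)) - corr X D gi i s (fun s => T (l :: s)))
   - \sum_j chr X D gi j i l *: tr s (fun s => T (j :: s))))); last first.
  move=> i _; congr (_ *: _); apply: eq_bigr => l _; congr (_ *: _).
  rewrite -scaleN1r; under [in X in _ + X]eq_bigr do rewrite -trZ.
  rewrite -tr_sum -trZ -trD; apply: eq_tr => s' _.
  by rewrite scaleN1r /= opprD addrA addrAC.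
rewrite /= (sum_I2 (fun i => P a i *: tr s _)).
have -> : corr X D' gi' k s (fun s0 => \sum_i P a i *: tr s0 (fun s1 => T (i :: s1)))
  = P a ord0 *: corr X D' gi' k s (tr^~ (fun s1 => T (ord0 :: s1)))
    + P a ord_max *: corr X D' gi' k s (tr^~ (fun s1 => T (ord_max :: s1))).
  by rewrite -!corrZ -corrD; apply: eq_corr => s' _; rewrite sum_I2.
rewrite (ncovD fh') !(ncovZ fh') !(fc_nproj fh hD' QP gi'K) !normal_tr //.
have I0 := IH _ (hTj ord0); have I1 := IH _ (hTj ord_max).
have c0 := fc_chr fh hD' QP gi'K k a ord0.
have c1 := fc_chr fh hD' QP gi'K k a ord_max.
move/eqP: I0; rewrite subr_eq => /eqP ->; move/eqP: I1; rewrite subr_eq => /eqP ->.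
rewrite !sum_I2 in c0 c1 *; rewrite (canRL (addrK _) c0) (canRL (addrK _) c1).
repeat match goal with |- context [tr s ?f] => generalize (tr s f) => ? end.
repeat match goal with |- context [corr X D' gi' k s ?f] =>
  generalize (corr X D' gi' k s f) => ? end.
apply/rowP => j; rewrite !mxE; ring. 
Qed.

Definition tr_tens T : tens A n := tr^~ T.

Lemma covd_tr s T : normal T -> size s != 0 ->
  covd X D' gi' (tr_tens T) s = tr s (covd X D gi T).
Proof. by case: s => //= k s hT _; rewrite -covd_tr_aux. Qed.

Lemma normal_corr k s T : normal T -> N (corr X D gi k s T) = corr X D gi k s T.
Proof.
elim: s T => [|i s IH] T h /=; first by rewrite (nproj0 fh).
rewrite (nprojD fh) IH => [|s']; last exact: h.
congr (_ + _); rewrite (nproj_sum fh); apply: eq_bigr => l _.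
by rewrite (nprojZ fh) h.
Qed.

Lemma normal_covd T : normal T -> normal (covd X D gi T).
Proof.
move=> h [|k s] /=; first by rewrite (nproj0 fh).
rewrite (nprojD fh) (nprojN fh) normal_corr //.
by rewrite /ncov (nproj_idem fh).
Qed.

(** Differentiating [P] in the expansion of the new frame vector only produces tangent vectors,
    which the normal projection kills. *)
Lemma sff_tr s : size s = 2%N -> sff X D' gi' s = tr s (sff X D gi).
Proof.
case: s => [|a [|b [|]]] //= _.
rewrite /sff /= (fc_ncov fh hD' QP gi'K); apply: eq_bigr => i _; congr (_ *: _).
rewrite (fc_fr X hD') /ncov (dv_sum (fr_der fh i)) (nproj_sum fh).
apply: eq_bigr => j _; rewrite (dvZ (fr_der fh i)) (nprojD fh) !(nprojZ fh).
by rewrite (nproj_fr fh) scaler0 add0r.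
Qed.

Lemma fc_mcv : mcv half X D' gi' = mcv half X D gi.
Proof.
rewrite /mcv; congr (_ *: _); rewrite !sum_I2 !sff_tr //= !sum_I2.
rewrite !(fc_giE fh hD' QP gi'K) !sum_I2.
repeat match goal with |- context [sff X D gi ?f] =>
  generalize (sff X D gi f) => ? end.
by apply/rowP => j; rewrite !mxE; ring.
Qed.

Lemma sff0_tr s : size s = 2%N ->
  sff0 half X D' gi' s = tr s (sff0 half X D gi).
Proof.
case: s => [|a [|b [|]]] //= _.
rewrite /sff0 sff_tr // fc_mcv /=.
rewrite (fc_gm X hD') !mxE !sum_I2 !mxE !sum_I2 -/(gm X D).
repeat match goal with |- context [sff X D gi ?f] =>
  generalize (sff X D gi f) => ? end.
move: (mcv _ _ _ _) => H.
by apply/rowP => j; rewrite !mxE; ring.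
Qed.

Lemma normal_sff0 : normal (sff0 half X D gi).
Proof.
have hs s : N (sff X D gi s) = sff X D gi s by exact: (nproj_idem fh).
have hH : N (mcv half X D gi) = mcv half X D gi.
  rewrite /mcv (nprojZ fh) !sum_I2 !(nprojD fh) !(nprojZ fh) !hs //.
by move=> s; rewrite /sff0 (nprojD fh) (nprojN fh) (nprojZ fh) hs hH.
Qed.

Lemma iter_covd_tr m s : size s = m.+2 ->
  iter m (covd X D' gi') (sff0 half X D' gi') s =
  tr s (iter m (covd X D gi) (sff0 half X D gi)).
Proof.
elim: m s => [|m IH] s hs; first exact: sff0_tr.
have hn : normal (iter m (covd X D gi) (sff0 half X D gi)).
  by elim: (m) => [|k]; [exact: normal_sff0|exact: normal_covd].
rewrite !iterS -covd_tr ?hs //.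
case: s hs => //= k s [hs]; congr (_ - _); first by rewrite IH.
by apply: eq_corr => s' e; rewrite IH ?e.
Qed.

(** In each slot the two factors of [P] recombine with the new inverse metric into the old one, by
    [fc_giE]. *)
Lemma nsq_tr r T T1 U U1 :
  (forall s, size s = r -> T1 s = tr s T) ->
  (forall s, size s = r -> U1 s = tr s U) ->
  nsq gi' r T1 U1 = nsq gi r T U.
Proof.
elim: r T T1 U U1 => [|r IH] T T1 U U1 hT hU; first by rewrite /= hT ?hU.
have E a b : nsq gi' r (fun s => T1 (a :: s)) (fun s => U1 (b :: s)) =
   \sum_i \sum_j P a i * P b j * nsq gi r (fun s => T (i :: s)) (fun s => U (j :: s)).
  rewrite (@eq_nsq _ _ _ _ _ _
    (fun s => P a ord0 *: tr s (fun s => T (ord0 :: s))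
            + P a ord_max *: tr s (fun s => T (ord_max :: s)))
    (fun s => P b ord0 *: tr s (fun s => U (ord0 :: s))
            + P b ord_max *: tr s (fun s => U (ord_max :: s)))).
  - rewrite nsqDl !nsqDr !nsqZl !nsqZr !sum_I2.
    have H i j : nsq gi' r (fun s => tr s (fun s => T (i :: s)))
        (fun s => tr s (fun s => U (j :: s)))
      = nsq gi r (fun s => T (i :: s)) (fun s => U (j :: s)) by exact: IH.
    by rewrite !H; ring.
  - by move=> s e; rewrite hT /= ?e // sum_I2.
  - by move=> s e; rewrite hU /= ?e // sum_I2.
rewrite /=; under eq_bigr do under eq_bigr do rewrite E.
rewrite [RHS](eq_bigr (fun i => \sum_j (\sum_a \sum_b P a i * P b j * gi' a b)
  * nsq gi r (fun s => T (i :: s)) (fun s => U (j :: s)))).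
  by rewrite !sum_I2; ring.
by move=> i _; apply: eq_bigr => j _; rewrite -(fc_giE fh hD' QP gi'K).
Qed.

Lemma fc_aB m : aB half X D' gi' m = aB half X D gi m.
Proof. by apply: nsq_tr => s; exact: iter_covd_tr. Qed.

Lemma fc_aS : aS half X D' gi' = aS half X D gi.
Proof. by apply: nsq_tr => s; exact: sff0_tr. Qed.

Lemma fc_aC : aC half X D' gi' = aC half X D gi.
Proof. by rewrite /aC fc_mcv. Qed.

End FrameChangeTensors.

(** * Null frames *)

Section NullDefs.
Variables (A : comPzRingType) (n : nat) (half : A) (X : 'rV[A]_n).
Variables (E F : A -> A).
Local Notation e := (dv E X).
Local Notation f := (dv F X).

(** The Levi-Civita connection coefficient of the null line of [e] in its own direction; with [E]
    and [F] exchanged it is that of the line of [f]. *)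
Definition nconn := adot (dv E e) f.
Fact nperp_key : unit. Proof. by []. Qed.
Definition nperp : 'rV[A]_n -> 'rV[A]_n := locked_with nperp_key
  (fun v => v - adot v X *: X - adot v f *: e - adot v e *: f).
Lemma nperp_def v : nperp v = v - adot v X *: X - adot v f *: e - adot v e *: f.
Proof. by rewrite /nperp unlock. Qed.
(** The spin-weighted derivative on normal vectors. When [e] is multiplied by a unit t and [f] by
    its inverse, an object of weight w picks up t^w, and the subtracted term makes the derivative
    pick up exactly t^(w+1). Weights refer to the derivation named first, so the conjugate operator
    takes the opposite weight. *)
Definition eth (w : int) : 'rV[A]_n -> 'rV[A]_n := locked_with nperp_key
  (fun v => nperp (dv E v) - (w%:~R * nconn) *: v).
Lemma eth_def w v : eth w v = nperp (dv E v) - (w%:~R * nconn) *: v.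
Proof. by rewrite /eth unlock. Qed.
Definition seth (w : int) x := E x - w%:~R * nconn * x.
(** This is h(e, e), which equals its trace-free part because [e] is null. The next one is h(e, f),
    the mean curvature vector, since <e, f> = 1 while [e] and [f] are null. *)
Definition nff := nperp (dv E e).
Definition nmc := nperp (dv F e).
Definition nml v := [/\ adot v X = 0, adot v e = 0 & adot v f = 0].
End NullDefs.

Record nullframe (A : comPzRingType) (n : nat) (half : A) (X : 'rV[A]_n)
  (E F : A -> A) : Prop := NullFrame {
  nf_E : derivation E;
  nf_F : derivation F;
  nf_half : half * 2%:R = 1;
  nf_XX : adot X X = 1;
  nf_ee : adot (dv E X) (dv E X) = 0;
  nf_ff : adot (dv F X) (dv F X) = 0;
  nf_ef : adot (dv E X) (dv F X) = 1;
  nf_tors : forall x, E (F x) - F (E x) = nconn X F E * E x - nconn X E F * F x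
}.

Lemma nullframe_swap (A : comPzRingType) (n : nat) (half : A) (X : 'rV[A]_n)
  (E F : A -> A) : nullframe half X E F -> nullframe half X F E.
Proof.
case=> hE hF h2 XX ee ff ef t; split=> //; first by rewrite adotC.
by move=> x; rewrite -opprB t opprB.
Qed.

Section Null1.
Variables (A : comPzRingType) (n : nat) (half : A) (X : 'rV[A]_n).
Variables (E F : A -> A).
Hypothesis nf : nullframe half X E F.
Local Notation e := (dv E X).
Local Notation f := (dv F X).
Local Notation N := (nperp X E F).
Local Notation nml := (nml X E F).
Local Notation lam := (nconn X E F).
Local Notation mu := (nconn X F E).
Let hE := nf_E nf.
Let hF := nf_F nf.

Lemma nf_halfI (x : A) : x + x = 0 -> x = 0.
Proof.
by move=> h; rewrite -[x]mul1r -(nf_half nf) -mulrA mulr_natl mulr2n h mulr0.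
Qed.

Lemma nf_Xe : adot X e = 0.
Proof.
apply: nf_halfI; rewrite -(der1 hE) -(nf_XX nf) (der_adot hE).
by rewrite (adotC X).
Qed.

End Null1.

Section Null2.
Variables (A : comPzRingType) (n : nat) (half : A) (X : 'rV[A]_n).
Variables (E F : A -> A).
Hypothesis nf : nullframe half X E F.
Local Notation e := (dv E X).
Local Notation f := (dv F X).
Local Notation N := (nperp X E F).
Local Notation nml := (nml X E F).
Local Notation lam := (nconn X E F).
Local Notation mu := (nconn X F E).
Let hE := nf_E nf.
Let hF := nf_F nf.
Let XX := nf_XX nf.
Let ee := nf_ee nf.
Let ff := nf_ff nf.
Let ef := nf_ef nf.
Let Xe : adot X e = 0 := nf_Xe nf.
Let Xf : adot X f = 0 := nf_Xe (nullframe_swap nf).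
Let eX : adot e X = 0. Proof. by rewrite adotC. Qed.
Let fX : adot f X = 0. Proof. by rewrite adotC. Qed.
Let fe : adot f e = 1. Proof. by rewrite adotC. Qed.
Let base := (XX, ee, ff, ef, Xe, Xf, eX, fX, fe).

Lemma nperp_swap v : nperp X F E v = N v.
Proof. by rewrite !nperp_def addrAC. Qed.

Lemma nperpD v w : N (v + w) = N v + N w.
Proof.
rewrite !nperp_def !adotDl; apply/rowP => j; rewrite !mxE; ring.
Qed.
Lemma nperpZ a v : N (a *: v) = a *: N v.
Proof. by rewrite !nperp_def !adotZl; apply/rowP => j; rewrite !mxE; ring. Qed.
Lemma nperpN v : N (- v) = - N v.
Proof. by rewrite -scaleN1r nperpZ scaleN1r. Qed.
Lemma nperp_X : N X = 0.
Proof. by rewrite nperp_def !base !scale0r scale1r !subr0 subrr. Qed.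
Lemma nperp_e : N e = 0.
Proof. by rewrite nperp_def !base !scale0r scale1r !subr0 subrr. Qed.
Lemma nperp_f : N f = 0.
Proof. by rewrite nperp_def !base !scale0r scale1r !subr0 subrr. Qed.
Lemma nml_nperp v : nml (N v).
Proof.
by rewrite nperp_def; split; rewrite !adotBl !adotZl !base; ring.
Qed.
Lemma nperp_id v : nml v -> N v = v.
Proof. by case=> h1 h2 h3; rewrite nperp_def h1 h2 h3 !scale0r !subr0. Qed.

Lemma nperp_split v :
  v = N v + adot v X *: X + adot v f *: e + adot v e *: f.
Proof. by rewrite nperp_def; apply/rowP => j; rewrite !mxE; ring. Qed.

Lemma adot_nperp v w : nml v -> adot v (N w) = adot v w.
Proof.
case=> h1 h2 h3; rewrite nperp_def !adotBr !adotZr h1 h2 h3; ring.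
Qed.

Lemma nml_nff : nml (nff X E F). Proof. exact: nml_nperp. Qed.
Lemma nml_nmc : nml (nmc X E F). Proof. exact: nml_nperp. Qed.

Lemma nmlD v w : nml v -> nml w -> nml (v + w).
Proof.
by case=> a1 a2 a3 [b1 b2 b3]; split; rewrite adotDl ?a1 ?a2 ?a3 ?b1 ?b2 ?b3 addr0.
Qed.
Lemma nmlZ a v : nml v -> nml (a *: v).
Proof. by case=> h1 h2 h3; split; rewrite adotZl ?h1 ?h2 ?h3 mulr0. Qed.
Lemma nmlN v : nml v -> nml (- v).
Proof. by rewrite -scaleN1r; apply: nmlZ. Qed.
Lemma nml_eth w v : nml v -> nml (eth X E F w v).
Proof. by move=> h; rewrite eth_def; apply: nmlD; [exact: nml_nperp|apply/nmlN/nmlZ]. Qed.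

Let dX (D : A -> A) (hD : derivation D) (v w : 'rV[A]_n) : adot v w = 0 ->
  adot (dv D v) w = - adot v (dv D w).
Proof.
move=> h; apply/eqP; rewrite -subr_eq0 opprK -(der_adot hD) h.
by rewrite (der0 hD).
Qed.

Let dEe_e : adot (dv E e) e = 0.
Proof. by apply: (nf_halfI nf); rewrite {2}adotC -(der_adot hE) ee (der0 hE). Qed.
Let dFe_e : adot (dv F e) e = 0.
Proof. by apply: (nf_halfI nf); rewrite {2}adotC -(der_adot hF) ee (der0 hF). Qed.
Let dFe_f : adot (dv F e) f = - mu.
Proof.
apply/eqP; rewrite -subr_eq0 opprK [mu]adotC -(der_adot hF) ef.
by rewrite (der1 hF).
Qed.

Lemma dEe : dv E e = lam *: e + nff X E F.
Proof.
rewrite [LHS]nperp_split dEe_e (dX hE eX) ee oppr0 !scale0r !addr0.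
by rewrite addrC.
Qed.

Lemma dFe : dv F e = - mu *: e - X + nmc X E F.
Proof.
rewrite [LHS]nperp_split dFe_e dFe_f (dX hF eX) ef scale0r addr0 scaleN1r.
by rewrite -addrA addrC (addrC (- X)).
Qed.

Lemma dv_tors (v : 'rV[A]_n) :
  dv E (dv F v) - dv F (dv E v) = mu *: dv E v - lam *: dv F v.
Proof. by apply/rowP => j; rewrite !mxE (nf_tors nf). Qed.
End Null2.

Section Null3.
Variables (A : comPzRingType) (n : nat) (half : A) (X : 'rV[A]_n).
Variables (E F : A -> A).
Hypothesis nf : nullframe half X E F.
Let nf' := nullframe_swap nf.
Local Notation e := (dv E X).
Local Notation f := (dv F X).
Local Notation N := (nperp X E F).
Local Notation nml := (nml X E F).
Local Notation lam := (nconn X E F).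
Local Notation mu := (nconn X F E).
Local Notation phi := (nff X E F).
Local Notation phib := (nff X F E).
Local Notation eta := (nmc X E F).
Local Notation seth := (seth X E F).
Local Notation sethb w x := (Submission.seth X F E (- (w : int)) x).
Local Notation eth := (eth X E F).
Local Notation ethb w x := (Submission.eth X F E (- (w : int)) x).
Let hE := nf_E nf.
Let hF := nf_F nf.

Lemma nml_swap v : Submission.nml X F E v <-> nml v.
Proof. by split; case. Qed.

(** Symmetry of the second fundamental form: the bracket of [E] and [F] applied to [X] is
    tangent. *)
Lemma nmc_swap : nmc X F E = eta.
Proof.
have := congr1 N (dv_tors nf X).
rewrite (nperpD X E F) !(nperpN X E F) (nperpD X E F) !(nperpN X E F) !(nperpZ X E F).
rewrite (nperp_e nf) (nperp_f nf) !scaler0 subr0 => /eqP.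
by rewrite subr_eq0 => /eqP; rewrite /nmc nperp_swap.
Qed.

Lemma dEf : dv E f = - lam *: f - X + eta.
Proof. by rewrite (dFe nf') nmc_swap. Qed.

Lemma dFf : dv F f = mu *: f + phib.
Proof. exact: (dEe nf'). Qed.

(** Weingarten's formula, obtained by differentiating the orthogonality of [v] to [X], [e] and
    [f]. *)
Lemma dE_nml v : nml v ->
  dv E v = N (dv E v) - adot v eta *: e - adot v phi *: f.
Proof.
move=> h; have [h1 h2 h3] := h; rewrite [LHS](nperp_split X E F).
have dX w : adot v w = 0 -> adot (dv E v) w = - adot v (dv E w).
  by move=> k; apply/eqP; rewrite -subr_eq0 opprK -(der_adot hE) k (der0 hE).
rewrite !dX // (dEe nf) dEf !adotDr !adotZr !adotNr h1 h2 h3 !mulr0 oppr0.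
by rewrite scale0r addr0 !add0r !scaleNr.
Qed.

End Null3.

(** * Gauss, Codazzi and Ricci equations in a null frame *)

Section Null4.
Variables (A : comPzRingType) (n : nat) (half : A) (X : 'rV[A]_n).
Variables (E F : A -> A).
Hypothesis nf : nullframe half X E F.
Let nf' := nullframe_swap nf.
Local Notation e := (dv E X).
Local Notation f := (dv F X).
Local Notation N := (nperp X E F).
Local Notation nml := (nml X E F).
Local Notation lam := (nconn X E F).
Local Notation mu := (nconn X F E).
Local Notation phi := (nff X E F).
Local Notation phib := (nff X F E).
Local Notation eta := (nmc X E F).
Local Notation seth := (seth X E F).
Local Notation sethb w x := (Submission.seth X F E (- (w : int)) x).
Local Notation eth := (eth X E F).
Local Notation ethb w x := (Submission.eth X F E (- (w : int)) x).
Let hE := nf_E nf.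
Let hF := nf_F nf.

(** The curvature of the connection on the null line, written with its two coefficients; this is the
    Gauss curvature. *)
Definition ncurv := - (E mu + F lam + 2%:R * lam * mu).
Local Notation K := ncurv.

Lemma dF_nml v : nml v ->
  dv F v = N (dv F v) - adot v phib *: e - adot v eta *: f.
Proof.
move=> h; rewrite [LHS](dE_nml nf' ((nml_swap X E F v).2 h)).
by rewrite (nmc_swap nf) nperp_swap addrAC.
Qed.

(** Gauss's equation: the component along [e] of the commutator of both derivatives applied to [e],
    extracted by pairing with [f]. *)
Lemma ncurvE : K = 1 + adot eta eta - adot phi phib.
Proof.
have := congr1 (fun v => adot v f) (dv_tors nf e).
have [h1 h2 h3] := nml_nmc nf; have [k1 k2 k3] := nml_nff nf.
have dX (D : A -> A) (v w : 'rV[A]_n) : derivation D -> adot v w = 0 ->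
    adot (dv D v) w = - adot v (dv D w).
  by move=> hD k; apply/eqP; rewrite -subr_eq0 opprK -(der_adot hD) k (der0 hD).
rewrite /= !adotBl !adotZl (dEe nf) (dFe nf) !(dvD hE) !(dvD hF) (dvN hE).
rewrite !(dvZ hE) !(dvZ hF) !adotE (dX _ _ _ hE h3) (dX _ _ _ hF k3).
rewrite (dEe nf) (dFe nf) (dEf nf) (dFf nf) !adotE.
rewrite !(h1, h3, k1, k3, nf_ef nf, nf_Xe nf', derN hE).
rewrite /ncurv => H; apply/eqP; rewrite -subr_eq0; apply/eqP.
move/eqP: H; rewrite -subr_eq0 => /eqP H.
rewrite -[RHS]H; ring.
Qed.

(** The normal component of the same commutator. For a parallel mean curvature vector the right side
    vanishes, which is the holomorphy of [phi]. *)
Lemma codazzi : ethb 2%:Z phi = N (dv E eta).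
Proof.
have := congr1 N (dv_tors nf e).
rewrite (dEe nf) (dFe nf) !(dvD hE) !(dvD hF) (dvN hE) !(dvZ hE) !(dvZ hF).
rewrite (dEe nf) (dFe nf).
rewrite !(nperpD X E F, nperpN X E F, nperpZ X E F, nperp_e nf, nperp_X nf).
rewrite !(nperp_id (nml_nff nf)) !(nperp_id (nml_nmc nf)).
rewrite !eth_def !(nperp_swap X E F) => /eqP H.
apply/eqP; rewrite -subr_eq0 -oppr_eq0; move: H; rewrite -subr_eq0.
congr (_ == _); apply/rowP => j; move: (N (dv F phi)) (N (dv E eta)) => u v.
by move: phi eta => a b; rewrite !mxE; ring.
Qed.

(** The weight sees the curvature [K] of the null line; the other two terms are the curvature of the
    normal bundle, as in Ricci's equation. They arise because the projection between the two
    derivatives removes tangent vectors whose own derivative has a normal part. The parts along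
    [eta] are symmetric and cancel. *)
Lemma eth_comm w v : nml v ->
  eth (w - 1) (ethb w v) - ethb (w + 1) (eth w v) =
  - (w%:~R * K) *: v + adot v phib *: phi - adot v phi *: phib.
Proof.
move=> h.
have nE := dE_nml nf h; have nF := dF_nml h.
have hT := congr1 N (dv_tors nf v).
have H1 : N (dv E (N (dv F v))) = N (dv E (dv F v))
   + adot v phib *: phi + adot v eta *: eta.
  rewrite [in X in _ = N X + _ + _]nF !(dvD hE, dvN hE, dvZ hE).
  rewrite !(nperpD X E F, nperpN X E F, nperpZ X E F, nperp_e nf, nperp_f nf).
  rewrite -/phi -(nperp_swap X E F (dv E f)) -/(nmc X F E) (nmc_swap nf).
  move: (N _) => u; move: phi eta => a b.
  by apply/rowP => j; rewrite !mxE; ring.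
have H2 : N (dv F (N (dv E v))) = N (dv F (dv E v))
   + adot v phi *: phib + adot v eta *: eta.
  rewrite [in X in _ = N X + _ + _]nE !(dvD hF, dvN hF, dvZ hF).
  rewrite !(nperpD X E F, nperpN X E F, nperpZ X E F, nperp_e nf, nperp_f nf).
  rewrite -/eta -(nperp_swap X E F (dv F f)) -/(nff X F E).
  move: (N _) => u; move: phi eta phib => a b c.
  by apply/rowP => j; rewrite !mxE; ring.
rewrite !eth_def !(nperp_swap X E F) !(dvD hE, dvD hF, dvN hE, dvN hF, dvZ hE, dvZ hF).
rewrite !(nperpD X E F, nperpN X E F, nperpZ X E F) (nperp_id h) H1 H2.
move: hT; rewrite !(nperpD X E F, nperpN X E F, nperpZ X E F).
move/eqP; rewrite subr_eq => /eqP ->.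
rewrite !(derMz hE) !(derMz hF).
move: (N _) (N _) (N _) => u1 u2 u3; move: phi eta phib => a b c.
by apply/rowP => j; rewrite !mxE /ncurv; ring.
Qed.

Lemma seth_comm w x :
  seth (w - 1) (sethb w x) - sethb (w + 1) (seth w x) = - (w%:~R * K) * x.
Proof.
rewrite /Submission.seth (derD hE) (derB hF) (derN hE) -!mulrA !(derMz hE) !(derMz hF).
rewrite (derM hE) (derM hF).
have /eqP := nf_tors nf x; rewrite subr_eq => /eqP ->.
by rewrite /ncurv; ring.
Qed.

Lemma seth_dot w1 w2 w u v : nml u -> nml v -> w = w1 + w2 ->
  seth w (adot u v) = adot (eth w1 u) v + adot u (eth w2 v).
Proof.
move=> hu hv ->; rewrite /Submission.seth (der_adot hE) !eth_def !adotBl !adotBr.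
rewrite !adotZl !adotZr (adot_nperp _ hu) (adotC (N _) v) (adot_nperp _ hv).
rewrite (adotC v); ring.
Qed.

Lemma eth_scale w1 w2 w x v : nml v -> w = w1 + w2 ->
  eth w (x *: v) = seth w1 x *: v + x *: eth w2 v.
Proof.
move=> hv ->; rewrite !eth_def (dvZ hE) (nperpD X E F) !(nperpZ X E F).
rewrite (nperp_id hv) /Submission.seth; move: (N _) => u.
by apply/rowP => j; rewrite !mxE; ring.
Qed.

Lemma sethM w1 w2 w x y : w = w1 + w2 ->
  seth w (x * y) = seth w1 x * y + x * seth w2 y.
Proof. by move=> ->; rewrite /Submission.seth (derM hE); ring. Qed.

Lemma eth0 w : eth w 0 = 0.
Proof.
by rewrite !eth_def (dv0 _ hE) nperp_def !adot0l !scale0r scaler0 !subr0.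
Qed.
Lemma seth0 w : seth w 0 = 0.
Proof. by rewrite /Submission.seth (der0 hE) mulr0 subr0. Qed.
Lemma ethD w u v : eth w (u + v) = eth w u + eth w v.
Proof.
rewrite !eth_def (dvD hE) (nperpD X E F); move: (N _) (N _) => a b.
by apply/rowP => j; rewrite !mxE; ring.
Qed.
Lemma sethD w x y : seth w (x + y) = seth w x + seth w y.
Proof. by rewrite /Submission.seth (derD hE); ring. Qed.
Lemma seth_0 x : seth 0 x = E x.
Proof. by rewrite /Submission.seth !mul0r subr0. Qed.

End Null4.

(** * Iterated derivatives of the second fundamental form and the quartic and sextic
    differentials *)

Section Iterates.
Variables (A : comPzRingType) (n : nat) (X : 'rV[A]_n) (E F : A -> A).
(** [nff] has weight 2 and every derivative adds one. The squares [nquart] and [nsext] use the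
    complex bilinear product, so they are differentials of weights 4 and 6, not norms. *)
Definition nph1 := eth X E F 2 (nff X E F).
Definition nph2 := eth X E F 3 nph1.
Definition nph3 := eth X E F 4 nph2.
Definition nquart := adot (nff X E F) (nff X E F).
Definition nsext := adot nph1 nph1.
Definition nparallel : Prop :=
  nperp X E F (dv E (nmc X E F)) = 0 /\ nperp X E F (dv F (nmc X E F)) = 0.
End Iterates.

Section Null5.
Variables (A : comPzRingType) (n : nat) (half : A) (X : 'rV[A]_n).
Variables (E F : A -> A).
Hypothesis nf : nullframe half X E F.
Local Notation nml := (nml X E F).
Local Notation phi := (nff X E F).
Local Notation phib := (nff X F E).
Local Notation phi1 := (nph1 X E F).
Local Notation phi1b := (nph1 X F E).
Local Notation phi2 := (nph2 X E F).
Local Notation phi2b := (nph2 X F E).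
Local Notation phi3 := (nph3 X E F).
Local Notation phi3b := (nph3 X F E).
Local Notation K := (ncurv X E F).
Local Notation ethE := (eth X E F).
Local Notation ethF := (eth X F E).
Local Notation sethE := (seth X E F).
Local Notation sethF := (seth X F E).

Lemma ncurv_swap : ncurv X F E = K.
Proof. by rewrite /ncurv; ring. Qed.

(** The commutator with each weight a variable tied by an equation, so that it applies directly to
    numerals. *)
Lemma ethF_ethE w k w1 k1 v : nml v -> k = - w -> w1 = w - 1 -> k1 = - w - 1 ->
  ethF k1 (ethE w v) = ethE w1 (ethF k v)
    + (w%:~R * K) *: v - adot v phib *: phi + adot v phi *: phib.
Proof.
move=> hv -> -> ->; rewrite -opprD.
have /eqP := eth_comm nf w hv; rewrite subr_eq => /eqP ->.
move: (ethF (- (w + 1)) _) phi phib => u x y.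
by apply/rowP => j; rewrite !mxE; ring.
Qed.

Lemma sethF_sethE w k w1 k1 x : k = - w -> w1 = w - 1 -> k1 = - w - 1 ->
  sethF k1 (sethE w x) = sethE w1 (sethF k x) + w%:~R * K * x.
Proof.
move=> -> -> ->; rewrite -opprD.
by have /eqP := seth_comm nf w x; rewrite subr_eq => /eqP ->; ring.
Qed.

(* Bochner formula for a holomorphic differential [x] of weight [w]. *)
Lemma bochner w k x y : k = - w -> sethF k x = 0 -> sethE k y = 0 ->
  sethE (- 1) (sethF 0 (x * y)) = sethE w x * sethF w y + w%:~R * K * (x * y).
Proof.
move=> kE hx hy.
have -> : sethF 0 (x * y) = x * sethF w y.
  by rewrite (sethM (nullframe_swap nf) (w1 := k) (w2 := w)) ?hx ?mul0r ?add0r // kE addNr.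
rewrite (sethM nf (w1 := w) (w2 := k - 1)); last by rewrite kE addrA subrr.
have := sethF_sethE (w := k) (k := w) (w1 := k - 1) (k1 := - k - 1) y.
rewrite hy (seth0 (nullframe_swap nf)) kE opprK => /(_ erefl erefl erefl) /eqP.
by rewrite eq_sym addr_eq0 => /eqP ->; rewrite mulrNz; ring.
Qed.

(** |phi|^2, half of the squared norm of the trace-free second fundamental form. *)
Definition nrho := adot phi phib.
Local Notation p := nrho.
Local Notation a := (2%:R * K - p).

Lemma nml_phi : nml phi. Proof. exact: (nml_nff nf). Qed.
Lemma nml_phi1 : nml phi1. Proof. exact/(nml_eth nf)/nml_phi. Qed.
Lemma nml_phi2 : nml phi2. Proof. exact/(nml_eth nf)/nml_phi1. Qed.
Lemma nml_phi3 : nml phi3. Proof. exact/(nml_eth nf)/nml_phi2. Qed.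

Hypothesis par : nparallel X E F.

Lemma ethF_phi : ethF (- 2) phi = 0.
Proof. by rewrite (codazzi nf) par.1. Qed.

(** With [phi] holomorphic only curvature terms survive. The term in [nquart] leaves the direction
    of [phi]; it has to be removed before the iterated derivatives obey closed formulas. *)
Lemma ethF_phi1 : ethF (- 3) phi1 = a *: phi + nquart X E F *: phib.
Proof.
rewrite /nph1 (ethF_ethE (k := - 2) (w1 := 1) nml_phi) // ethF_phi (eth0 nf).
rewrite /nquart -/p; move: phi phib => u v.
by apply/rowP => j; rewrite !mxE; ring.
Qed.

End Null5.

Lemma nparallel_swap (A : comPzRingType) n half (X : 'rV[A]_n) E F :
  nullframe half X E F -> nparallel X E F -> nparallel X F E.
Proof.
by move=> nf [h1 h2]; split; rewrite (nmc_swap nf) (nperp_swap X E F).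
Qed.

Section Null6.
Variables (A : comPzRingType) (n : nat) (half : A) (X : 'rV[A]_n).
Variables (E F : A -> A).
Hypothesis nf : nullframe half X E F.
Let nf' := nullframe_swap nf.
Hypothesis par : nparallel X E F.
Let par' := nparallel_swap nf par.
Local Notation nml := (nml X E F).
Local Notation phi := (nff X E F).
Local Notation phib := (nff X F E).
Local Notation phi1 := (nph1 X E F).
Local Notation phi1b := (nph1 X F E).
Local Notation phi2 := (nph2 X E F).
Local Notation phi2b := (nph2 X F E).
Local Notation phi3 := (nph3 X E F).
Local Notation phi3b := (nph3 X F E).
Local Notation K := (ncurv X E F).
Local Notation ethE := (eth X E F).
Local Notation ethF := (eth X F E).
Local Notation sethE := (seth X E F).
Local Notation sethF := (seth X F E).
Local Notation p := (nrho X E F).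
Local Notation a := (2%:R * K - p).
Let hE := nf_E nf.
Let hF := nf_F nf.

Lemma nrho_swap : nrho X F E = p.
Proof. by rewrite /nrho adotC. Qed.

Lemma ethE_phib : ethE (- 2) phib = 0.
Proof. exact: (ethF_phi nf' par'). Qed.

Lemma ethE_phi1b : ethE (- 3) phi1b = a *: phib + nquart X F E *: phi.
Proof. by rewrite (ethF_phi1 nf' par') ncurv_swap nrho_swap. Qed.

Let n1 := nml_phi nf.
Let n2 := nml_phi1 nf.
Let n3 := nml_phi2 nf.
Let n4 := nml_phi3 nf.
Let m1 : nml phib := (nml_swap X E F _).1 (nml_phi nf').
Let m2 : nml phi1b := (nml_swap X E F _).1 (nml_phi1 nf').
Let m3 : nml phi2b := (nml_swap X E F _).1 (nml_phi2 nf').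
Let m4 : nml phi3b := (nml_swap X E F _).1 (nml_phi3 nf').
Let swp v (h : nml v) : Submission.nml X F E v := (nml_swap X E F v).2 h.

Lemma sethE_dot w1 w2 w u v : nml u -> nml v -> w = w1 + w2 ->
  sethE w (adot u v) = adot (ethE w1 u) v + adot u (ethE w2 v).
Proof. exact: (seth_dot nf). Qed.
Lemma sethF_dot w1 w2 w u v : nml u -> nml v -> w = w1 + w2 ->
  sethF w (adot u v) = adot (ethF w1 u) v + adot u (ethF w2 v).
Proof. by move=> hu hv; apply: (seth_dot nf'); apply: swp. Qed.

Lemma F_nrho : F p = adot phi phi1b.
Proof.
rewrite -(seth_0 X F E) (sethF_dot (w1 := - 2) (w2 := 2) n1 m1) // (ethF_phi nf par).
by rewrite adot0l add0r.
Qed.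
Lemma E_nrho : E p = adot phi1 phib.
Proof.
rewrite -(seth_0 X E F) (sethE_dot (w1 := 2) (w2 := - 2) n1 m1) // ethE_phib.
by rewrite adot0r addr0.
Qed.

Lemma lap_nrho : sethE (- 1) (sethF 0 p) =
  adot phi1 phi1b + a * p + nquart X E F * nquart X F E.
Proof.
rewrite seth_0 F_nrho (sethE_dot (w1 := 2) (w2 := - 3) n1 m2) // ethE_phi1b.
by rewrite adotDr !adotZr -/p /nquart; ring.
Qed.

Lemma bochner_quart : sethE (- 1) (sethF 0 (nquart X E F * nquart X F E)) =
  sethE 4 (nquart X E F) * sethF 4 (nquart X F E)
  + 4%:R * K * (nquart X E F * nquart X F E).
Proof.
apply: (bochner nf (w := 4) (k := - 4)) => //; rewrite /nquart.
  by rewrite (sethF_dot (w1 := - 2) (w2 := - 2) n1 n1) // (ethF_phi nf par) adot0l adot0r addr0.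
by rewrite (sethE_dot (w1 := - 2) (w2 := - 2) m1 m1) // ethE_phib adot0l adot0r addr0.
Qed.

(** By Gauss, [K + p] equals 1 + H^2, whose derivative vanishes for a parallel mean curvature
    vector. *)
Lemma E_ncurv : E K = - E p.
Proof.
rewrite (ncurvE nf) -/p (derB hE) (derD hE) (der1 hE) add0r.
have [h1 h2 h3] := nml_nmc nf.
have -> : E (adot (nmc X E F) (nmc X E F)) = 0; last by rewrite sub0r.
have h := nml_nmc nf.
rewrite -(seth_0 X E F) (sethE_dot (w1 := 0) (w2 := 0) h h) //.
by rewrite !eth_def mul0r scale0r subr0 par.1 adot0l adot0r addr0.
Qed.

End Null6.

(** * Consequences of the vanishing of the quartic differential *)

Section Null7.
Variables (A : comPzRingType) (n : nat) (half : A) (X : 'rV[A]_n).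
Variables (E F : A -> A).
Hypothesis nf : nullframe half X E F.
Let nf' := nullframe_swap nf.
Hypothesis par : nparallel X E F.
Let par' := nparallel_swap nf par.
Local Notation nml := (nml X E F).
Local Notation phi := (nff X E F).
Local Notation phib := (nff X F E).
Local Notation phi1 := (nph1 X E F).
Local Notation phi1b := (nph1 X F E).
Local Notation phi2 := (nph2 X E F).
Local Notation phi2b := (nph2 X F E).
Local Notation phi3 := (nph3 X E F).
Local Notation phi3b := (nph3 X F E).
Local Notation K := (ncurv X E F).
Local Notation ethE := (eth X E F).
Local Notation ethF := (eth X F E).
Local Notation sethE := (seth X E F).
Local Notation sethF := (seth X F E).
Local Notation p := (nrho X E F).
Local Notation a := (2%:R * K - p).
Local Notation b := (5%:R * K - p).
Let hE := nf_E nf.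
Let hF := nf_F nf.
Let n1 := nml_phi nf.
Let n2 := nml_phi1 nf.
Let n3 := nml_phi2 nf.
Let n4 := nml_phi3 nf.
Let m1 : nml phib := (nml_swap X E F _).1 (nml_phi nf').
Let m2 : nml phi1b := (nml_swap X E F _).1 (nml_phi1 nf').
Let m3 : nml phi2b := (nml_swap X E F _).1 (nml_phi2 nf').
Let m4 : nml phi3b := (nml_swap X E F _).1 (nml_phi3 nf').
Hypothesis quart0 : nquart X E F = 0.

Lemma E_natK (k : nat) : E (k%:R * K - p) = - k.+1%:R * E p.
Proof.
by rewrite (derB hE) (derM hE) (der_nat hE) (E_ncurv nf par); ring.
Qed.

Lemma phi1_phi : adot phi1 phi = 0.
Proof.
apply: (nf_halfI nf).
have := sethE_dot nf (w1 := 2) (w2 := 2) n1 n1 erefl.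
rewrite -/(nquart X E F) quart0 (seth0 nf) -/phi1 => h.
by rewrite [RHS]h (adotC phi).
Qed.

Lemma phi2_phi : adot phi2 phi = - nsext X E F.
Proof.
have := sethE_dot nf (w1 := 3) (w2 := 2) n2 n1 erefl.
by rewrite phi1_phi (seth0 nf) -/phi2 -/phi1 => /esym/eqP; rewrite addr_eq0 => /eqP.
Qed.

Lemma phi2_phib : adot phi2 phib = sethE 1 (E p).
Proof.
rewrite (E_nrho nf par) (sethE_dot nf (w1 := 3) (w2 := - 2) n2 m1) //.
by rewrite (ethE_phib nf par) adot0r addr0.
Qed.

(** Holomorphy of the sextic differential: once the quartic one vanishes, the conjugate derivative
    of [phi1] is a multiple of [phi], and [phi1] is orthogonal to [phi]. *)
Lemma sethF_sext : sethF (- 6) (nsext X E F) = 0.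
Proof.
rewrite /nsext (sethF_dot nf (w1 := - 3) (w2 := - 3) n2 n2) //.
rewrite (ethF_phi1 nf par) quart0 scale0r addr0 adotZl adotZr phi1_phi.
by rewrite adotC phi1_phi; ring.
Qed.

(** The conjugate derivative of [phi2], as [ethF_phi2] shows. The 5 in [b] is 2 from [a] plus the
    weight 3 of [phi1]; the 4 is 3 from differentiating [a] plus 1 from the normal curvature. *)
Definition nchi := b *: phi1 - (4%:R * E p) *: phi.

Lemma ethF_phi2 : ethF (- 4) phi2 = nchi.
Proof.
rewrite {1}/nph2 (ethF_ethE nf (k := - 3) (w1 := 2) (w := 3)) //.
rewrite (ethF_phi1 nf par) quart0 scale0r addr0.
rewrite (eth_scale nf (w1 := 0) (w2 := 2) _ n1) // seth_0 E_natK phi1_phi.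
rewrite -(E_nrho nf par) -/phi1 /nchi; move: phi1 phi phib => x y z.
by apply/rowP => j; rewrite !mxE; ring.
Qed.

Lemma nml_nchi : nml nchi.
Proof. by apply: nmlD; [apply: nmlZ|apply/nmlN/nmlZ]. Qed.

Lemma ethE_nchi : ethE 3 nchi =
  b *: phi2 - (10%:R * E p) *: phi1 - (4%:R * sethE 1 (E p)) *: phi.
Proof.
rewrite /nchi (ethD nf) -scaleNr.
rewrite (eth_scale nf (w1 := 0) (w2 := 3) _ n2) //.
rewrite (eth_scale nf (w1 := 1) (w2 := 2) _ n1) // seth_0 E_natK -/phi2 -/phi1.
have -> : sethE 1 (- (4%:R * E p)) = - (4%:R * sethE 1 (E p)).
  by rewrite /seth (derN hE) (derM hE) (der_nat hE); ring.
move: phi2 phi1 phi => x y z.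
by apply/rowP => j; rewrite !mxE; ring.
Qed.

(** The term along [phib] comes from the normal curvature through [phi2_phi]; this is how the sextic
    differential gets into the Laplacian of |phi2|^2. The 5 is 4 from the derivative of [nchi] plus
    1 from the normal curvature. *)
Lemma ethF_phi3 : ethF (- 5) phi3 = (b + 4%:R * K) *: phi2
  - (10%:R * E p) *: phi1 - (5%:R * sethE 1 (E p)) *: phi - nsext X E F *: phib.
Proof.
rewrite {1}/nph3 (ethF_ethE nf (k := - 4) (w1 := 3) (w := 4)) //.
rewrite ethF_phi2 ethE_nchi phi2_phib phi2_phi.
move: phi2 phi1 phi phib => x y z t.
by apply/rowP => j; rewrite !mxE; ring.
Qed.

Lemma F_v : F (adot phi1 phi1b) = a * F p + adot phi1 phi2b.
Proof.
rewrite -(seth_0 X F E) (sethF_dot nf (w1 := - 3) (w2 := 3) n2 m2) //.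
rewrite (ethF_phi1 nf par) quart0 scale0r addr0 adotZl (F_nrho nf par).
by [].
Qed.

Lemma lap_rho : sethE (- 1) (F p) = adot phi1 phi1b + a * p.
Proof. by have := lap_nrho nf par; rewrite quart0 mul0r addr0 seth_0. Qed.
End Null7.

Section Null8.
Variables (A : comPzRingType) (n : nat) (half : A) (X : 'rV[A]_n).
Variables (E F : A -> A).
Hypothesis nf : nullframe half X E F.
Let nf' := nullframe_swap nf.
Hypothesis par : nparallel X E F.
Let par' := nparallel_swap nf par.
Local Notation nml := (nml X E F).
Local Notation phi := (nff X E F).
Local Notation phib := (nff X F E).
Local Notation phi1 := (nph1 X E F).
Local Notation phi1b := (nph1 X F E).
Local Notation phi2 := (nph2 X E F).
Local Notation phi2b := (nph2 X F E).
Local Notation phi3 := (nph3 X E F).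
Local Notation phi3b := (nph3 X F E).
Local Notation K := (ncurv X E F).
Local Notation ethE := (eth X E F).
Local Notation ethF := (eth X F E).
Local Notation sethE := (seth X E F).
Local Notation sethF := (seth X F E).
Local Notation p := (nrho X E F).
Local Notation a := (2%:R * K - p).
Local Notation b := (5%:R * K - p).
Local Notation v := (adot phi1 phi1b).
Local Notation y := (adot phi2 phi2b).
Local Notation z := (adot phi3 phi3b).
Local Notation chi := (nchi X E F).
Local Notation chib := (nchi X F E).
Let hE := nf_E nf.
Let hF := nf_F nf.
Let n1 := nml_phi nf.
Let n2 := nml_phi1 nf.
Let n3 := nml_phi2 nf.
Let n4 := nml_phi3 nf.
Let m1 : nml phib := (nml_swap X E F _).1 (nml_phi nf').
Let m2 : nml phi1b := (nml_swap X E F _).1 (nml_phi1 nf').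
Let m3 : nml phi2b := (nml_swap X E F _).1 (nml_phi2 nf').
Let m4 : nml phi3b := (nml_swap X E F _).1 (nml_phi3 nf').
Hypothesis quart0 : nquart X E F = 0.
Hypothesis quart0' : nquart X F E = 0.
Let pS := nrho_swap X E F.
Let KS := ncurv_swap X E F.
Let c1 : nml chi := nml_nchi nf.
Let c2 : nml chib := (nml_swap X E F _).1 (nml_nchi nf').

Lemma nchi_swapE : chib = b *: phi1b - (4%:R * F p) *: phib.
Proof. by rewrite /nchi pS KS. Qed.

Lemma ethE_phi2b : ethE (- 4) phi2b = chib.
Proof. exact: (ethF_phi2 nf' par' quart0'). Qed.

(** The coefficient of |phi1|^2 is a + b, and 7 is 3 from [E a] plus 4 from [chib]. *)
Lemma lap_v : sethE (- 1) (F v) =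
  y + (2%:R * a + 3%:R * K) * v + a ^+ 2 * p - 7%:R * (E p * F p).
Proof.
rewrite (F_v nf par quart0) (sethD nf).
rewrite (sethM nf (w1 := 0) (w2 := - 1)) // seth_0 (E_natK nf par).
rewrite (lap_rho nf par quart0) (sethE_dot nf (w1 := 3) (w2 := - 4) n2 m3) //.
rewrite ethE_phi2b nchi_swapE (adotBr _ _ phi1) !adotZr -/phi2 -(E_nrho nf par).
by ring.
Qed.

Lemma phi1_phi2b : adot phi1 phi2b = F v - a * F p.
Proof. by rewrite (F_v nf par quart0) addrC addKr. Qed.

Lemma phi2_phi1b : adot phi2 phi1b = E v - a * E p.
Proof.
have := F_v nf' par' quart0'; rewrite pS KS (adotC phi1b phi2) (adotC phi1b) => ->.
by rewrite addrC addKr.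
Qed.

Lemma phi_phi2b : adot phi phi2b = sethF 1 (F p).
Proof. by rewrite adotC (phi2_phib nf' par') pS. Qed.

Lemma chi_chib : adot chi chib =
  b ^+ 2 * v - 8%:R * b * (E p * F p) + 16%:R * p * (E p * F p).
Proof.
rewrite nchi_swapE /nchi !adotBl !adotBr !adotZl !adotZr.
by rewrite -(E_nrho nf par) -(F_nrho nf par) -/p; ring.
Qed.

(** The 9 is 4 from the derivative of [chi] plus 5 from the conjugate derivative of [phi3]. The
    product of sextic differentials is the term whose vanishing is established separately. *)
Lemma lap_y : sethE (- 1) (F y) =
  z + adot chi chib + (2%:R * b + 4%:R * K) * y
  - 10%:R * (E p * (F v - a * F p) + F p * (E v - a * E p))
  - 9%:R * (sethE 1 (E p) * sethF 1 (F p)) + nsext X E F * nsext X F E.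
Proof.
rewrite -(seth_0 X F E y) (sethF_dot nf (w1 := - 4) (w2 := 4) n3 m3) //.
rewrite (ethF_phi2 nf par quart0) -/phi3b (sethD nf).
rewrite (sethE_dot nf (w1 := 3) (w2 := - 4) c1 m3) // ethE_phi2b.
rewrite (sethE_dot nf (w1 := 4) (w2 := - 5) n3 m4) // -/phi3.
rewrite (ethE_nchi nf par) (ethF_phi3 nf' par' quart0') pS KS.
rewrite !(adotBr, adotZr, adotBl, adotZl) phi1_phi2b phi2_phi1b phi_phi2b.
by rewrite (phi2_phi nf quart0) (phi2_phib nf par); ring.
Qed.

(** Bochner's formula for the gradient of [p]: since [E p] has weight 1, commuting the derivatives
    costs one [K], the Ricci term. *)
Lemma lap_grad : sethE (- 1) (F (E p * F p)) =
  sethE 1 (E p) * sethF 1 (F p) + (v + a * p) ^+ 2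
  + (E (v + a * p) * F p + E p * F (v + a * p)) + K * (E p * F p).
Proof.
have L : sethF (- 1) (E p) = v + a * p.
  by rewrite -pS (lap_rho nf' par' quart0') pS KS (adotC phi1b).
rewrite -(seth_0 X F E) (sethM nf' (w1 := - 1) (w2 := 1)) // L (sethD nf).
rewrite (sethM nf (w1 := 0) (w2 := - 1)) // seth_0 (lap_rho nf par quart0).
rewrite (sethM nf (w1 := 1) (w2 := - 2)) //.
rewrite (sethF_sethE nf' (w := 1) (k := - 1) (w1 := 0)) // KS.
by rewrite (lap_rho nf par quart0) seth_0; ring.
Qed.

Lemma bochner_sext : sethE (- 1) (sethF 0 (nsext X E F * nsext X F E)) =
  sethE 6 (nsext X E F) * sethF 6 (nsext X F E)
  + 6%:R * K * (nsext X E F * nsext X F E).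
Proof.
apply: (bochner nf (w := 6) (k := - 6)) => //; first exact: (sethF_sext nf par quart0).
exact: (sethF_sext nf' par' quart0').
Qed.
End Null8.

(** * Tensor norms computed in a null frame *)

Definition pairD (A : comPzRingType) (E F : A -> A) (i : 'I_2) : A -> A :=
  if i == ord0 then E else F.
(** The Gram matrix of a null frame, which is its own inverse. *)
Definition swapmx (A : comPzRingType) : 'M[A]_2 := \matrix_(i, j) (i != j)%:R.

Section NullNorms.
Variables (A : comPzRingType) (n : nat) (half : A) (X : 'rV[A]_n).
Variables (E F : A -> A).
Hypothesis nf : nullframe half X E F.
Let nf' := nullframe_swap nf.
Local Notation D := (pairD E F).
Local Notation gi := (swapmx A).
Local Notation phi := (nff X E F).
Local Notation phib := (nff X F E).
Local Notation lam := (nconn X E F).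
Local Notation mu := (nconn X F E).
Local Notation tens := (tens A n).

Lemma tan0E v : tan X D gi ord0 v = adot v (dv F X).
Proof. by rewrite /tan sum_I2 !mxE /= mul0r add0r mul1r. Qed.
Lemma tan1E v : tan X D gi ord_max v = adot v (dv E X).
Proof. by rewrite /tan sum_I2 !mxE /= mul0r addr0 mul1r. Qed.

Lemma nprojE_null v : nproj X D gi v = nperp X E F v.
Proof.
rewrite nperp_def /nproj !sum_I2 !mxE /= !mul0r !scale0r add0r addr0 !mul1r.
by rewrite opprD addrA [LHS]addrAC.
Qed.

Lemma chr00 l : chr X D gi l ord0 ord0 = if l == ord0 then lam else 0.
Proof.
rewrite /chr; have [->|->] := I2P l; rewrite ?tan0E ?tan1E //=.
rewrite (dEe nf) adotDl adotZl (nf_ee nf).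
by have [_ -> _] := nml_nff nf; rewrite mulr0 addr0.
Qed.
Lemma chr01 l : chr X D gi l ord0 ord_max = if l == ord0 then 0 else - lam.
Proof.
rewrite /chr; have [->|->] := I2P l; rewrite ?tan0E ?tan1E /= (dEf nf);
  have [h1 h2 h3] := nml_nmc nf; rewrite !adotDl !adotNl !adotZl.
  by rewrite h3 (nf_ff nf) (nf_Xe nf') mulr0 oppr0 !addr0.
by rewrite h2 (adotC (dv F X)) (nf_ef nf) (nf_Xe nf) mulr1 oppr0 !addr0.
Qed.
Lemma chr10 l : chr X D gi l ord_max ord0 = if l == ord0 then - mu else 0.
Proof.
rewrite /chr; have [->|->] := I2P l; rewrite ?tan0E ?tan1E /= (dFe nf);
  have [h1 h2 h3] := nml_nmc nf; rewrite !adotDl !adotNl !adotZl.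
  by rewrite h3 (nf_ef nf) (nf_Xe nf') mulr1 oppr0 !addr0.
by rewrite h2 (nf_ee nf) (nf_Xe nf) mulr0 oppr0 !addr0.
Qed.
Lemma chr11 l : chr X D gi l ord_max ord_max = if l == ord0 then 0 else mu.
Proof.
rewrite /chr; have [->|->] := I2P l; rewrite ?tan0E ?tan1E //=.
rewrite (dFf nf) adotDl adotZl (nf_ff nf).
by have [_ -> _] := nml_nff nf'; rewrite mulr0 addr0.
Qed.
Definition chrE := (chr00, chr01, chr10, chr11).

Lemma null_gm : gm X D = gi.
Proof.
apply/matrixP => i j; rewrite !mxE /fr.
have [->|->] := I2P i; have [->|->] := I2P j; rewrite /= ?(nf_ee nf) ?(nf_ff nf) ?(nf_ef nf) //.
by rewrite adotC (nf_ef nf).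
Qed.

Lemma null_frame : frame half X D gi.
Proof.
split.
- by move=> i; rewrite /pairD; case: ifP => _; [exact: (nf_E nf)|exact: (nf_F nf)].
- exact: (nf_half nf).
- exact: (nf_XX nf).
- rewrite null_gm; apply/matrixP => i j; rewrite !mxE sum_I2 !mxE.
  have [->|->] := I2P i; have [->|->] := I2P j; rewrite /=; ring.
- move=> i j x; have [->|->] := I2P i; have [->|->] := I2P j;
    rewrite sum_I2 !chrE /pairD /= ?(nf_tors nf) ?(nf_tors nf'); ring.
Qed.

Lemma alapE w : alap X D gi w = 2%:R * seth X E F (- 1) (F w).
Proof.
rewrite /alap !sum_I2 !chrE !mxE /pairD /=.
have /eqP := nf_tors nf w; rewrite subr_eq => /eqP.
by rewrite /seth => ->; ring.
Qed.

Lemma agradE u w : agrad D gi u w = E u * F w + F u * E w.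
Proof. by rewrite /agrad !sum_I2 !mxE /pairD /=; ring. Qed.

(** The weight of a component: an argument [e] counts 1, an argument [f] counts -1. *)
Fixpoint wt (s : seq 'I_2) : int :=
  if s is i :: s' then (if i == ord0 then 1 else - 1) + wt s' else 0.

(** The connection preserves both null lines, so all correction terms collapse to the weight times
    one coefficient; [covd0] and [covd1] then identify covariant differentiation with [eth]. *)
Lemma corr0 s (T : tens) : corr X D gi ord0 s T = ((wt s)%:~R * lam) *: T s.
Proof.
elim: s T => [|i s IH] T /=; first by rewrite mul0r scale0r.
rewrite IH sum_I2; have [->|->] := I2P i; rewrite !chrE /= scale0r ?addr0 ?add0r.
  by rewrite -scalerDl rmorphD /= mulrDl mul1r.
by rewrite -scalerDl rmorphD /= mulrDl mulN1r.
Qed.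
Lemma corr1 s (T : tens) : corr X D gi ord_max s T = (- (wt s)%:~R * mu) *: T s.
Proof.
elim: s T => [|i s IH] T /=; first by rewrite oppr0 mul0r scale0r.
rewrite IH sum_I2; have [->|->] := I2P i; rewrite !chrE /= scale0r ?addr0 ?add0r.
  by rewrite -scalerDl rmorphD /= opprD mulrDl mulN1r.
by rewrite -scalerDl rmorphD /= opprD opprK mulrDl mul1r.
Qed.

Lemma covd0 s (T : tens) : covd X D gi T (ord0 :: s) = eth X E F (wt s) (T s).
Proof. by rewrite /= corr0 eth_def /ncov nprojE_null. Qed.
Lemma covd1 s (T : tens) :
  covd X D gi T (ord_max :: s) = eth X F E (- wt s) (T s).
Proof.
by rewrite /= corr1 eth_def /ncov nprojE_null (nperp_swap X E F) rmorphN.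
Qed.

Lemma null_mcv : mcv half X D gi = nmc X E F.
Proof.
rewrite /mcv !sum_I2 !mxE /= !scale0r !scale1r add0r addr0.
rewrite /sff /ncov /= !nprojE_null /fr /= -/(nmc X E F).
rewrite -(nperp_swap X E F (dv E (dv F X))) -/(nmc X F E) (nmc_swap nf).
by rewrite -mulr2n -scaler_nat scalerA (nf_half nf) scale1r.
Qed.

Lemma null_aC : aC half X D gi = 1 + adot (nmc X E F) (nmc X E F).
Proof. by rewrite /aC null_mcv. Qed.

Local Notation h := (sff0 half X D gi).
Lemma h00 : h [:: ord0; ord0] = phi.
Proof.
rewrite /sff0 null_gm null_mcv !mxE /= scale0r subr0 /sff /ncov /=.
by rewrite nprojE_null.
Qed.
Lemma h01 : h [:: ord0; ord_max] = 0.
Proof.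
rewrite /sff0 null_gm null_mcv !mxE /= scale1r /sff /ncov /=.
rewrite nprojE_null -(nperp_swap X E F) /fr /= -/(nmc X F E) (nmc_swap nf).
by rewrite subrr.
Qed.
Lemma h10 : h [:: ord_max; ord0] = 0.
Proof.
rewrite /sff0 null_gm null_mcv !mxE /= scale1r /sff /ncov /=.
by rewrite nprojE_null /fr /= -/(nmc X E F) subrr.
Qed.
Lemma h11 : h [:: ord_max; ord_max] = phib.
Proof.
rewrite /sff0 null_gm null_mcv !mxE /= scale0r subr0 /sff /ncov /=.
by rewrite nprojE_null (nperp_swap X F E).
Qed.
Definition hE := (h00, h01, h10, h11).

Lemma nsq_null r (T U : tens) : nsq gi r.+1 T U =
  nsq gi r (fun s => T (ord0 :: s)) (fun s => U (ord_max :: s)) +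
  nsq gi r (fun s => T (ord_max :: s)) (fun s => U (ord0 :: s)).
Proof. by rewrite /= !sum_I2 !mxE /= !mul0r !mul1r add0r addr0. Qed.

Lemma null_aS : aS half X D gi = 2%:R * nrho X E F.
Proof.
by rewrite /aS !nsq_null /= !hE !adot0l (adotC phib) -/(nrho X E F); ring.
Qed.

Hypothesis par : nparallel X E F.
Let par' := nparallel_swap nf par.
Local Notation eE := (eth0 nf).
Local Notation eF := (eth0 nf').

Lemma nsq0 (T U : tens) : nsq gi 0 T U = adot (T [::]) (U [::]).
Proof. by []. Qed.

Local Notation T1 := (covd X D gi h).
Local Notation T2 := (covd X D gi T1).
Local Notation T3 := (covd X D gi T2).
Local Notation i0 := (ord0 : 'I_2).
Local Notation i1 := (ord_max : 'I_2).

(** Meant for the first covariant derivative of the trace-free form: its last two indices must agree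
    by trace-freeness, and the first agrees with them by holomorphy of [phi]. The metric pairs a
    component with the one of opposite indices, in both orders, whence the factor 2. *)
Lemma nsq3_sparse (T : tens) : (forall i, T [:: i; i0; i1] = 0) ->
  (forall i, T [:: i; i1; i0] = 0) -> T [:: i1; i0; i0] = 0 ->
  T [:: i0; i1; i1] = 0 ->
  nsq gi 3 T T = 2%:R * adot (T [:: i0; i0; i0]) (T [:: i1; i1; i1]).
Proof.
move=> h1 h2 h3 h4; rewrite !nsq_null !nsq0; cbv beta.
rewrite !h1 !h2 h3 h4 !adot0l (adotC (T [:: i1; i1; i1])); ring.
Qed.

Lemma nsq4_sparse (T : tens) : (forall i j, T [:: j; i; i0; i1] = 0) ->
  (forall i j, T [:: j; i; i1; i0] = 0) -> (forall j, T [:: j; i1; i0; i0] = 0) ->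
  (forall j, T [:: j; i0; i1; i1] = 0) ->
  nsq gi 4 T T = 2%:R * (adot (T [:: i0; i0; i0; i0]) (T [:: i1; i1; i1; i1])
    + adot (T [:: i1; i0; i0; i0]) (T [:: i0; i1; i1; i1])).
Proof.
move=> h1 h2 h3 h4; rewrite !nsq_null !nsq0; cbv beta.
rewrite !h1 !h2 !h3 !h4 !adot0l (adotC (T [:: i1; i1; i1; i1])).
by rewrite (adotC (T [:: i0; i1; i1; i1])); ring.
Qed.

Lemma nsq5_sparse (T : tens) : (forall i j k, T [:: k; j; i; i0; i1] = 0) ->
  (forall i j k, T [:: k; j; i; i1; i0] = 0) ->
  (forall j k, T [:: k; j; i1; i0; i0] = 0) ->
  (forall j k, T [:: k; j; i0; i1; i1] = 0) ->
  nsq gi 5 T T = 2%:R * (adot (T [:: i0; i0; i0; i0; i0]) (T [:: i1; i1; i1; i1; i1])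
    + adot (T [:: i1; i0; i0; i0; i0]) (T [:: i0; i1; i1; i1; i1])
    + adot (T [:: i0; i1; i0; i0; i0]) (T [:: i1; i0; i1; i1; i1])
    + adot (T [:: i1; i1; i0; i0; i0]) (T [:: i0; i0; i1; i1; i1])).
Proof.
move=> h1 h2 h3 h4; rewrite !nsq_null !nsq0; cbv beta.
rewrite !h1 !h2 !h3 !h4 !adot0l (adotC (T [:: i1; i1; i1; i1; i1])).
rewrite (adotC (T [:: i0; i1; i1; i1; i1])) (adotC (T [:: i1; i0; i1; i1; i1])).
by rewrite (adotC (T [:: i0; i0; i1; i1; i1])); ring.
Qed.

Lemma covd_zero (T : tens) i s : T s = 0 -> covd X D gi T (i :: s) = 0.
Proof.
by move=> e; have [->|->] := I2P i; rewrite ?covd0 ?covd1 e ?eE ?eF.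
Qed.

Lemma T1_000 : T1 [:: i0; i0; i0] = nph1 X E F.
Proof. by rewrite covd0 h00. Qed.
Lemma T1_111 : T1 [:: i1; i1; i1] = nph1 X F E.
Proof. by rewrite covd1 h11. Qed.
Lemma T1_100 : T1 [:: i1; i0; i0] = 0.
Proof. by rewrite covd1 h00; exact: (ethF_phi nf par). Qed.
Lemma T1_011 : T1 [:: i0; i1; i1] = 0.
Proof. by rewrite covd0 h11; exact: (ethE_phib nf par). Qed.
Lemma T1_01 i : T1 [:: i; i0; i1] = 0.
Proof. exact: covd_zero h01. Qed.
Lemma T1_10 i : T1 [:: i; i1; i0] = 0.
Proof. exact: covd_zero h10. Qed.

Lemma null_aB1 : aB half X D gi 1 = 2%:R * adot (nph1 X E F) (nph1 X F E).
Proof.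
rewrite -T1_000 -T1_111; apply: nsq3_sparse.
- exact: T1_01.
- exact: T1_10.
- exact: T1_100.
- exact: T1_011.
Qed.

Hypothesis quart0 : nquart X E F = 0.
Hypothesis quart0' : nquart X F E = 0.
Local Notation K := (ncurv X E F).
Local Notation p := (nrho X E F).
Local Notation a := (2%:R * K - p).

Lemma T2_0000 : T2 [:: i0; i0; i0; i0] = nph2 X E F.
Proof. by rewrite covd0 T1_000. Qed.
Lemma T2_1111 : T2 [:: i1; i1; i1; i1] = nph2 X F E.
Proof. by rewrite covd1 T1_111. Qed.
Lemma T2_1000 : T2 [:: i1; i0; i0; i0] = a *: phi.
Proof.
rewrite covd1 T1_000; apply: etrans (ethF_phi1 nf par) _.
by rewrite quart0 scale0r addr0.
Qed.
Lemma T2_0111 : T2 [:: i0; i1; i1; i1] = a *: phib.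
Proof.
rewrite covd0 T1_111; apply: etrans (ethE_phi1b nf par) _.
by rewrite quart0' scale0r addr0.
Qed.

Lemma null_aB2 : aB half X D gi 2 =
  2%:R * (adot (nph2 X E F) (nph2 X F E) + a ^+ 2 * p).
Proof.
apply: etrans (nsq4_sparse (T := T2) _ _ _ _) _.
- by move=> i j; exact: covd_zero (T1_01 i).
- by move=> i j; exact: covd_zero (T1_10 i).
- by move=> j; exact: covd_zero T1_100.
- by move=> j; exact: covd_zero T1_011.
rewrite T2_0000 T2_1111 T2_1000 T2_0111 adotZl adotZr -/p; ring.
Qed.

Let n1 := nml_phi nf.
Let m1 := nml_phi nf'.

(** Besides [phi3] and [nchi] there remain the derivatives of [a *: phi] in both directions, -3 (E
    p) phi + a phi1 and -3 (F p) phi. Each of them contributes 9 to the 18. *)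
Lemma null_aB3 : aB half X D gi 3 =
  2%:R * (adot (nph3 X E F) (nph3 X F E) + adot (nchi X E F) (nchi X F E)
   + (a ^+ 2 * adot (nph1 X E F) (nph1 X F E) - 6%:R * a * (E p * F p)
      + 18%:R * p * (E p * F p))).
Proof.
have pS := nrho_swap X E F; have KS := ncurv_swap X E F.
apply: etrans (nsq5_sparse (T := T3) _ _ _ _) _.
- by move=> i j k; exact/covd_zero/covd_zero/T1_01.
- by move=> i j k; exact/covd_zero/covd_zero/T1_10.
- by move=> j k; exact/covd_zero/covd_zero/T1_100.
- by move=> j k; exact/covd_zero/covd_zero/T1_011.
rewrite !(covd0 _ T2) !(covd1 _ T2) T2_0000 T2_1111 T2_1000 T2_0111.
have -> : eth X F E (- wt [:: i0; i0; i0; i0]) (nph2 X E F) = nchi X E F.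
  exact: (ethF_phi2 nf par quart0).
have -> : eth X E F (wt [:: i1; i1; i1; i1]) (nph2 X F E) = nchi X F E.
  exact: (ethF_phi2 nf' par' quart0').
have -> : eth X E F (wt [:: i1; i0; i0; i0]) (a *: phi)
    = - (3%:R * E p) *: phi + a *: nph1 X E F.
  apply: etrans (eth_scale nf (w1 := 0) (w2 := 2) a n1 _) _ => //.
  by rewrite seth_0 (E_natK nf par); congr (_ *: _ + _); ring.
have -> : eth X F E (- wt [:: i0; i1; i1; i1]) (a *: phib)
    = - (3%:R * F p) *: phib + a *: nph1 X F E.
  apply: etrans (eth_scale nf' (w1 := 0) (w2 := 2) a m1 _) _ => //.
  rewrite seth_0 -pS -KS (E_natK nf' par'); congr (_ *: _ + _); ring.
have -> : eth X F E (- wt [:: i1; i0; i0; i0]) (a *: phi) = - (3%:R * F p) *: phi.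
  apply: etrans (eth_scale nf' (w1 := 0) (w2 := - 2) a _ _) _ => //.
    exact: (nml_swap X E F _).2 n1.
  rewrite (ethF_phi nf par) scaler0 addr0 seth_0 -pS -KS (E_natK nf' par').
  by congr (_ *: _); ring.
have -> : eth X E F (wt [:: i0; i1; i1; i1]) (a *: phib) = - (3%:R * E p) *: phib.
  apply: etrans (eth_scale nf (w1 := 0) (w2 := - 2) a _ _) _ => //.
    exact: (nml_swap X E F _).1 m1.
  rewrite (ethE_phib nf par) scaler0 addr0 seth_0 (E_natK nf par).
  by congr (_ *: _); ring.
have -> : eth X E F (wt [:: i0; i0; i0; i0]) (nph2 X E F) = nph3 X E F by [].
have -> : eth X F E (- wt [:: i1; i1; i1; i1]) (nph2 X F E) = nph3 X F E by [].
rewrite !(adotDl, adotDr, adotZl, adotZr) -(E_nrho nf par) -(F_nrho nf par) -/p.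
by ring.
Qed.
End NullNorms.

Section TanSwap.
Variables (A : comPzRingType) (n : nat) (X : 'rV[A]_n) (D : 'I_2 -> A -> A).
Lemma tan_swap0 v : tan X D (swapmx A) ord0 v = adot v (fr X D ord_max).
Proof. by rewrite /tan sum_I2 !mxE /= mul0r add0r mul1r. Qed.
Lemma tan_swap1 v : tan X D (swapmx A) ord_max v = adot v (fr X D ord0).
Proof. by rewrite /tan sum_I2 !mxE /= mul0r addr0 mul1r. Qed.
End TanSwap.

(** Differentiating the constant products of the frame vectors reduces the tangential components of
    all derivatives to the two coefficients [nconn]. *)
Lemma frame_null (A : comPzRingType) n (half : A) (X : 'rV[A]_n) D :
  frame half X D (swapmx A) -> nullframe half X (D ord0) (D ord_max).
Proof.
move=> fh; have h2 := fr_half fh; have hd := fr_der fh.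
have gE : gm X D = swapmx A.
  have I1 : swapmx A *m swapmx A = 1%:M.
    apply/matrixP => i j; rewrite !mxE sum_I2 !mxE.
    by have [->|->] := I2P i; have [->|->] := I2P j; rewrite /=; ring.
  by rewrite -[LHS]mul1mx -I1 -mulmxA (fr_gi fh) mulmx1.
have g i j : adot (dv (D i) X) (dv (D j) X) = (i != j)%:R.
  by have /matrixP/(_ i j) := gE; rewrite !mxE.
have hI (x : A) : x + x = 0 -> x = 0.
  by move=> h; rewrite -[x]mul1r -h2 -mulrA mulr_natl mulr2n h mulr0.
have D0 i j : adot (dv (D i) (dv (D j) X)) (dv (D j) X) = 0.
  apply: hI; rewrite {2}adotC -(der_adot (hd i)) g eqxx; exact: (der0 (hd i)).
have D1 i j k : adot (dv (D i) (dv (D j) X)) (dv (D k) X) =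
    - adot (dv (D i) (dv (D k) X)) (dv (D j) X).
  apply/eqP; rewrite -subr_eq0 opprK [X in _ + X]adotC -(der_adot (hd i)) g.
  by case: (j != k); rewrite ?(der0 (hd i)) ?(der1 (hd i)).
split; rewrite ?g //; try exact: hd; try exact: (fr_XX fh).
move=> x; have := fr_tors fh ord0 ord_max x.
rewrite sum_I2 /chr !tan_swap0 !tan_swap1 /fr => ->.
by rewrite !D0 (D1 ord_max ord0) (D1 ord0 ord_max) /nconn; ring.
Qed.

(** * The Gauss equation for the intrinsic curvature of a coordinate frame *)

Section Gauss.
Variables (A : comPzRingType) (n : nat) (half : A) (X : 'rV[A]_n).
Variables (D : 'I_2 -> A -> A) (gi : 'M[A]_2).
Hypothesis fh : frame half X D gi.
Hypothesis Dcomm : forall x, D ord0 (D ord_max x) = D ord_max (D ord0 x).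
Local Notation fr := (fr X D).
Local Notation gm := (gm X D).
Local Notation chr := (chr X D gi).
Local Notation N := (nproj X D gi).
Local Notation sff := (sff X D gi).
Local Notation H := (mcv half X D gi).
Let hd := fr_der fh.

Definition riem l k i j : A :=
  D i (chr l j k) - D j (chr l i k) + \sum_m (chr l i m * chr m j k - chr l j m * chr m i k).

Lemma adot_fr_X i j : adot (dv (D i) (fr j)) X = - gm j i.
Proof.
rewrite mxE; apply/eqP; rewrite -subr_eq0 opprK -(der_adot (hd i)) (fr_X fh).
by rewrite (der0 (hd i)).
Qed.

Lemma dv_fr i j : dv (D i) (fr j) =
  sff [:: i; j] - gm j i *: X + \sum_k chr k i j *: fr k.
Proof.
rewrite /Submission.sff /ncov /= (nprojE fh) adot_fr_X scaleNr opprK.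
have E (V : zmodType) (a b c : V) : a = a + b - c - b + c.
  by rewrite (addrAC _ (- c)) addrK subrK.
exact: E.
Qed.

Lemma sff_fr s l : adot (sff s) (fr l) = 0.
Proof. exact: (adot_nproj_fr fh). Qed.
Lemma sff_X s : adot (sff s) X = 0.
Proof. exact: (adot_nproj_X fh). Qed.

(** Both orders of differentiating [fr ord_max] are paired with [fr ord0]. Inside, [nu] is the
    second fundamental form in Euclidean space, with the component along [X] included; that
    component produces the determinant of the metric, which is the curvature of the unit sphere. *)
Lemma gauss_sff : \sum_l gm ord0 l * riem l ord_max ord0 ord_max =
  adot (sff [:: ord0; ord0]) (sff [:: ord_max; ord_max])
  - adot (sff [:: ord0; ord_max]) (sff [:: ord0; ord_max])
  + (gm ord0 ord0 * gm ord_max ord_max - gm ord0 ord_max ^+ 2).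
Proof.
have s10 : sff [:: ord_max; ord0] = sff [:: ord0; ord_max].
  rewrite /Submission.sff /ncov /=; congr (N _).
  by apply/rowP => m; rewrite !mxE.
pose nu i j := sff [:: i; j] - gm j i *: X.
have nufr i j l : adot (nu i j) (fr l) = 0.
  rewrite /nu; have := sff_fr [:: i; j] l; move: (sff _) => a ha.
  by rewrite adotBl adotZl ha adotC (fr_X fh) mulr0 subr0.
have nunu i j k l : adot (nu i j) (nu k l) =
    adot (sff [:: i; j]) (sff [:: k; l]) + gm j i * gm l k.
  rewrite /nu; have := sff_X [:: i; j]; have := sff_X [:: k; l].
  move: (sff [:: k; l]) (sff [:: i; j]) => a b ha hb.
  rewrite adotBl !adotBr !adotZl !adotZr hb (adotC X a) ha (fr_XX fh); ring.
have nud k i j l : adot (dv (D k) (nu i j)) (fr l) = - adot (nu i j) (nu k l).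
  apply/eqP; rewrite -subr_eq0 opprK.
  have -> : adot (nu i j) (nu k l) = adot (nu i j) (dv (D k) (fr l)).
    rewrite (dv_fr k l) -/(nu k l) adotDr adot_sumr big1 ?addr0 // => m _.
    by rewrite adotZr nufr mulr0.
  by rewrite -(der_adot (hd k)) nufr (der0 (hd k)).
have dfr i j l : adot (dv (D i) (fr j)) (fr l) = \sum_m gm l m * chr m i j.
  by rewrite (adot_tan fh).
have dd k i j l : adot (dv (D k) (dv (D i) (fr j))) (fr l) =
   - adot (nu i j) (nu k l) + \sum_m gm l m * (D k (chr m i j) + \sum_p chr m k p * chr p i j).
  rewrite (dv_fr i j) -/(nu i j) (dvD (hd k)) adotDl nud; congr (_ + _).
  rewrite (dv_sum (hd k)) adot_suml !sum_I2 !(dvZ (hd k)) !adotDl !adotZl !dfr !sum_I2.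
  rewrite [adot (fr ord0) _]adotC [adot (fr ord_max) _]adotC.
  have gE p : adot (fr l) (fr p) = gm l p by rewrite mxE.
  by rewrite !gE; ring.
have e : dv (D ord0) (dv (D ord_max) (fr ord_max)) = dv (D ord_max) (dv (D ord0) (fr ord_max)).
  by apply/rowP => m; rewrite !mxE Dcomm.
have := congr1 (fun v => adot v (fr ord0)) e; rewrite /= !dd.
rewrite /riem !sum_I2 !nunu s10 (gm_sym X D ord_max ord0).
rewrite (adotC (sff [:: ord_max; ord_max])).
move=> E; apply/eqP; rewrite -subr_eq0; apply/eqP.
move/eqP: E; rewrite -subr_eq0 => /eqP <-; ring.
Qed.

(** For a trace-free form in dimension two the norm is a determinant: det g times S is -2 (<t00,
    t11> - <t01, t01>), by squaring the trace relation. The mean curvature part of the form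
    contributes det g times H^2. *)
Lemma gauss_frame : 2%:R * (\sum_l gm ord0 l * riem l ord_max ord0 ord_max) =
  (gm ord0 ord0 * gm ord_max ord_max - gm ord0 ord_max ^+ 2) *
  (2%:R * aC half X D gi - aS half X D gi).
Proof.
rewrite gauss_sff.
pose d := gm ord0 ord0 * gm ord_max ord_max - gm ord0 ord_max ^+ 2.
pose e := gi ord0 ord0 * gi ord_max ord_max - gi ord0 ord_max ^+ 2.
have gg i j : \sum_k gi i k * gm k j = (i == j)%:R.
  by have /matrixP/(_ i j) := fr_gi fh; rewrite !mxE.
have gs := gm_sym X D ord_max ord0; have gis := gi_sym fh ord_max ord0.
have g00 : \sum_k gi ord0 k * gm k ord0 = 1 by rewrite gg.
have g01 : \sum_k gi ord0 k * gm k ord_max = 0 by rewrite gg.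
have g10 : \sum_k gi ord_max k * gm k ord0 = 0 by rewrite gg.
have g11 : \sum_k gi ord_max k * gm k ord_max = 1 by rewrite gg.
rewrite !sum_I2 ?gs ?gis in g00 g01 g10 g11.
have t00 : d * gi ord0 ord0 = gm ord_max ord_max.
  rewrite -[RHS]mul1r -g00 /d; move/eqP: g01; rewrite addr_eq0 => /eqP h.
  transitivity (gm ord_max ord_max * (gi ord0 ord0 * gm ord0 ord0)
     - gm ord0 ord_max * (gi ord0 ord0 * gm ord0 ord_max)); first ring.
  by rewrite h; ring.
have t11 : d * gi ord_max ord_max = gm ord0 ord0.
  rewrite -[RHS]mul1r -g11 /d; move/eqP: g10; rewrite addrC addr_eq0 => /eqP h.
  transitivity (gm ord0 ord0 * (gi ord_max ord_max * gm ord_max ord_max)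
     - gm ord0 ord_max * (gi ord_max ord_max * gm ord0 ord_max)); first ring.
  by rewrite h; ring.
have t01 : d * gi ord0 ord_max = - gm ord0 ord_max.
  rewrite -[RHS]mul1r -g00 /d; move/eqP: g01; rewrite addrC addr_eq0 => /eqP h.
  transitivity (gm ord0 ord0 * (gi ord0 ord_max * gm ord_max ord_max)
     - gm ord0 ord_max * (gi ord0 ord_max * gm ord0 ord_max)); first ring.
  by rewrite h; ring.
have de : d * e = 1.
  rewrite -g11; rewrite /e mulrBr expr2 !mulrA t00 t01; ring.
pose t i j := sff0 half X D gi [:: i; j].
have tE i j : sff [:: i; j] = t i j + gm i j *: H by rewrite /t /sff0 /= subrK.
have ts : t ord_max ord0 = t ord0 ord_max.
  rewrite /t /sff0 /= gs; congr (_ - _); rewrite /Submission.sff /ncov /=; congr (N _).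
  by apply/rowP => m; rewrite !mxE.
have trg : \sum_i \sum_j gi i j * gm i j = 2%:R.
  by rewrite !sum_I2 ?gs ?gis g00 g11 mulr2n.
have tr0 : \sum_i \sum_j gi i j *: t i j = 0.
  have -> : \sum_i \sum_j gi i j *: t i j =
    \sum_i \sum_j gi i j *: sff [:: i; j] - (\sum_i \sum_j gi i j * gm i j) *: H.
    rewrite !sum_I2 !tE.
    move: (t _ _) (t _ _) (t _ _) (t _ _) H => a0 a1 a2 a3 h.
    by apply/rowP => m; rewrite !mxE; ring.
  rewrite trg /mcv scalerA [2%:R * half]mulrC (fr_half fh) scale1r.
  exact: subrr.
have tr1 : gm ord_max ord_max *: t ord0 ord0 - (2%:R * gm ord0 ord_max) *: t ord0 ord_max
    + gm ord0 ord0 *: t ord_max ord_max = 0.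
  have := congr1 ( *:%R d) tr0; rewrite scaler0 !sum_I2 ts gis => <-.
  rewrite -t00 -t11 -[gm ord0 ord_max]opprK -t01.
  move: (t _ _) (t _ _) (t _ _) => a0 a1 a2.
  by apply/rowP => m; rewrite !mxE; ring.
have thS : d * aS half X D gi = - 2%:R *
   (adot (t ord0 ord0) (t ord_max ord_max) - adot (t ord0 ord_max) (t ord0 ord_max)).
  have EE (u v w : 'rV[A]_n) (x y z : A) :
    adot (x *: u - (2%:R * y) *: v + z *: w) (x *: u - (2%:R * y) *: v + z *: w) =
    x ^+ 2 * adot u u + 4%:R * y ^+ 2 * adot v v + z ^+ 2 * adot w w
    + 2%:R * x * z * adot u w - 4%:R * x * y * adot u v - 4%:R * y * z * adot v w.
    rewrite !(adotDl, adotDr, adotNl, adotNr, adotZl, adotZr).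
    by rewrite (adotC w u) (adotC v u) (adotC w v); ring.
  have E := EE (t ord0 ord0) (t ord0 ord_max) (t ord_max ord_max)
    (gm ord_max ord_max) (gm ord0 ord_max) (gm ord0 ord0).
  (* The left side was the square of the vanishing trace, so [E] now says that its expansion is
     zero; this zero is added to the right side at the end. *)
  rewrite tr1 adot0l in E.
  have dI x y : d * x = d * y -> x = y.
    by move=> h; rewrite -[x]mul1r -[y]mul1r -de [d * e]mulrC -!mulrA h.
  apply: dI; rewrite /aS /= !sum_I2 -!/(t _ _) ts gis.
  rewrite (adotC (t ord0 ord_max) (t ord0 ord0)).
  rewrite (adotC (t ord_max ord_max) (t ord0 ord0)).
  rewrite (adotC (t ord_max ord_max) (t ord0 ord_max)).
  move: E; move: (adot (t ord0 ord0) (t ord0 ord0)) (adot (t ord0 ord0) (t ord0 ord_max))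
    (adot (t ord0 ord0) (t ord_max ord_max)) (adot (t ord0 ord_max) (t ord0 ord_max))
    (adot (t ord0 ord_max) (t ord_max ord_max)) (adot (t ord_max ord_max) (t ord_max ord_max)).
  move=> u1 u2 u3 u4 u5 u6 E.
  transitivity ((d * gi ord0 ord0) ^+ 2 * u1 + (d * gi ord_max ord_max) ^+ 2 * u6
    + 2%:R * (d * gi ord0 ord_max) ^+ 2 * u4 + 2%:R * (d * gi ord0 ord_max) ^+ 2 * u3
    + 2%:R * (d * gi ord0 ord0) * (d * gi ord_max ord_max) * u4
    + 4%:R * (d * gi ord0 ord0) * (d * gi ord0 ord_max) * u2
    + 4%:R * (d * gi ord_max ord_max) * (d * gi ord0 ord_max) * u5); first ring.
  by rewrite t00 t11 t01 /d -[RHS]addr0 [X in _ = _ + X]E; ring.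
have thD : adot (sff [:: ord0; ord0]) (sff [:: ord_max; ord_max])
    - adot (sff [:: ord0; ord_max]) (sff [:: ord0; ord_max]) =
   adot (t ord0 ord0) (t ord_max ord_max) - adot (t ord0 ord_max) (t ord0 ord_max)
   + d * adot H H.
  have E := congr1 (fun v => adot v H) tr1; rewrite /= adot0l in E.
  rewrite !tE; move: E; move: (t ord0 ord0) (t ord0 ord_max) (t ord_max ord_max) H => u v w h E.
  rewrite !(adotDl, adotDr, adotNl, adotNr, adotZl, adotZr) in E *.
  rewrite (adotC h w) (adotC h v) /d.
  by rewrite -[RHS]addr0 -[X in _ = _ + X]E; ring.
rewrite thD mulrBr thS /aC -/d; ring.
Qed.

End Gauss.

(** * Consequences of a parallel mean curvature vector *)

Section Parallel.
Variables (A : comPzRingType) (n : nat) (half : A) (X : 'rV[A]_n).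
Variables (D : 'I_2 -> A -> A) (gi : 'M[A]_2).
Hypothesis fh : frame half X D gi.
Local Notation H := (mcv half X D gi).
Hypothesis par : forall k, ncov X D gi k H = 0.

Lemma normal_mcv : nproj X D gi H = H.
Proof.
have hs s : nproj X D gi (sff X D gi s) = sff X D gi s by exact: (nproj_idem fh).
by rewrite /mcv (nprojZ fh) !sum_I2 !(nprojD fh) !(nprojZ fh) !hs.
Qed.

Lemma der_aC k : D k (aC half X D gi) = 0.
Proof.
have hd := fr_der fh k.
rewrite /aC (derD hd) (der1 hd) add0r (der_adot hd).
have E : adot H (dv (D k) H) = 0.
  rewrite -{1}normal_mcv (adot_nproj fh) -/(ncov X D gi k H) par.
  by rewrite adot0r.
by rewrite adotC E addr0.
Qed.

Variables (E F : A -> A) (P : 'M[A]_2).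
Hypothesis nf : nullframe half X E F.
Hypothesis hEF : forall a x, pairD E F a x = \sum_i P a i * D i x.
Variable Q : 'M[A]_2.
Hypothesis QP : Q *m P = 1%:M.

Lemma frame_nparallel : nparallel X E F.
Proof.
have fh' := null_frame nf.
have giK : swapmx A *m gm X (pairD E F) = 1%:M by exact: (fr_gi fh').
have mE : nmc X E F = H by rewrite -(null_mcv nf) (fc_mcv fh hEF QP giK).
have Z a : ncov X (pairD E F) (swapmx A) a H = 0.
  by rewrite (fc_ncov fh hEF QP giK) big1 // => i _; rewrite par scaler0.
by split; rewrite mE -(nprojE_null X E F); [exact: (Z ord0)|exact: (Z ord_max)].
Qed.
End Parallel.

(** * A conjugation that exchanges the two null directions *)

Section Conjugation.
Variables (A : comPzRingType) (n : nat) (X : 'rV[A]_n) (E F : A -> A).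
Variable k : A -> A.
Hypothesis kD : forall x y, k (x + y) = k x + k y.
Hypothesis kM : forall x y, k (x * y) = k x * k y.
Hypothesis k1 : k 1 = 1.
Hypothesis kE : forall x, k (E x) = F (k x).
Hypothesis kX : forall j, k (X ord0 j) = X ord0 j.

Definition kv (v : 'rV[A]_n) : 'rV[A]_n := \row_j k (v ord0 j).

Let k0 : k 0 = 0.
Proof. by apply: (addrI (k 0)); rewrite -kD !addr0. Qed.
Let kN x : k (- x) = - k x.
Proof. by apply: (addrI (k x)); rewrite -kD !subrr k0. Qed.
Let kMn x m : k (x *+ m) = k x *+ m.
Proof. by elim: m => [|m IH]; rewrite ?mulr0n ?k0 // !mulrS kD IH. Qed.
Let kint (m : int) : k m%:~R = m%:~R.
Proof. by case: m => m; rewrite ?NegzE ?mulrNz ?kN ?kMn k1. Qed.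

Lemma kvD u v : kv (u + v) = kv u + kv v.
Proof. by apply/rowP => j; rewrite !mxE kD. Qed.
Lemma kvN u : kv (- u) = - kv u.
Proof. by apply/rowP => j; rewrite !mxE kN. Qed.
Lemma kvZ a u : kv (a *: u) = k a *: kv u.
Proof. by apply/rowP => j; rewrite !mxE kM. Qed.
Lemma k_adot u v : k (adot u v) = adot (kv u) (kv v).
Proof.
rewrite /adot (big_morph k kD k0); apply: eq_bigr => j _.
by rewrite kM !mxE.
Qed.
Lemma kv_dv v : kv (dv E v) = dv F (kv v).
Proof. by apply/rowP => j; rewrite !mxE kE. Qed.
Lemma kvX : kv X = X.
Proof. by apply/rowP => j; rewrite mxE kX. Qed.
Lemma kv_e : kv (dv E X) = dv F X. Proof. by rewrite kv_dv kvX. Qed.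

Hypothesis kK : forall x, k (k x) = x.

Lemma kv_f : kv (dv F X) = dv E X.
Proof.
apply/rowP => j; rewrite !mxE -[X in F X]kX -kE kK.
by [].
Qed.

Lemma kv_nperp v : kv (nperp X E F v) = nperp X F E (kv v).
Proof.
rewrite !nperp_def !(kvD, kvN) !kvZ !k_adot kvX kv_e kv_f.
by [].
Qed.
Lemma k_nconn : k (nconn X E F) = nconn X F E.
Proof. by rewrite /nconn k_adot kv_dv kv_e kv_f. Qed.
Lemma kv_eth w v : kv (eth X E F w v) = eth X F E w (kv v).
Proof.
by rewrite !eth_def kvD kvN kvZ kM kint k_nconn kv_nperp kv_dv.
Qed.
Lemma kv_nff : kv (nff X E F) = nff X F E.
Proof. by rewrite /nff kv_nperp kv_dv kv_e. Qed.
Lemma kv_nph1 : kv (nph1 X E F) = nph1 X F E.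
Proof. by rewrite /nph1 kv_eth kv_nff. Qed.
Lemma kv_nph2 : kv (nph2 X E F) = nph2 X F E.
Proof. by rewrite /nph2 kv_eth kv_nph1. Qed.
Lemma kv_nph3 : kv (nph3 X E F) = nph3 X F E.
Proof. by rewrite /nph3 kv_eth kv_nph2. Qed.
Lemma k_quart : k (nquart X E F) = nquart X F E.
Proof. by rewrite /nquart k_adot kv_nff. Qed.
Lemma k_sext : k (nsext X E F) = nsext X F E.
Proof. by rewrite /nsext k_adot kv_nph1. Qed.
Lemma k_seth w x : k (seth X E F w x) = seth X F E w (k x).
Proof. by rewrite /seth kD kN !kM kint kE k_nconn. Qed.

End Conjugation.

(** * Laplacians of the invariants, written with the frame-independent operators *)

Section NullSummary.
Variables (A : comPzRingType) (n : nat) (half : A) (X : 'rV[A]_n).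
Variables (E F : A -> A).
Hypothesis nf : nullframe half X E F.
Hypothesis par : nparallel X E F.
Local Notation D := (pairD E F).
Local Notation gi := (swapmx A).
Local Notation S := (aS half X D gi).
Local Notation C := (aC half X D gi).
Local Notation B m := (aB half X D gi m).
Local Notation lap := (alap X D gi).
Local Notation grad := (agrad D gi).
Local Notation q := (nquart X E F * nquart X F E).
Local Notation s6 := (nsext X E F * nsext X F E).
Local Notation K := (ncurv X E F).
Local Notation p := (nrho X E F).

Lemma nul_S : S = 2%:R * p. Proof. exact: null_aS. Qed.
Lemma nul_C : C = K + p.
Proof. by rewrite (null_aC nf) (ncurvE nf) -/p; ring. Qed.
Let hE := nf_E nf.
Let hF := nf_F nf.
Let M2 (D' : A -> A) (x : A) : derivation D' -> D' (2%:R * x) = 2%:R * D' x.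
Proof. by move=> h; rewrite (derM h) (der_nat h) mul0r add0r. Qed.

(** Stated before Q = 0 is available: the last term makes |Q|^2 expressible by frame-independent
    quantities. *)
Lemma lap_S : lap S = 2%:R * B 1 + (4%:R * C - 3%:R * S) * S + 4%:R * q.
Proof.
have := lap_nrho nf par; rewrite !seth_0 => L.
rewrite (null_aB1 nf par) (alapE nf) nul_S nul_C (M2 _ hF).
rewrite /seth (M2 _ hE) in L *.
have -> : 2%:R * (2%:R * E (F p) - (-1)%:~R * nconn X E F * (2%:R * F p)) =
   4%:R * (E (F p) - (-1)%:~R * nconn X E F * F p) by ring.
by rewrite L; ring.
Qed.

Lemma lap_q : lap q = 2%:R * (seth X E F 4 (nquart X E F) * seth X F E 4 (nquart X F E))
  + 4%:R * (2%:R * C - S) * q.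
Proof.
have := bochner_quart nf par; rewrite !seth_0 => L.
by rewrite (alapE nf) L nul_S nul_C; ring.
Qed.

Hypothesis quart0 : nquart X E F = 0.
Hypothesis quart0' : nquart X F E = 0.
Local Notation v := (adot (nph1 X E F) (nph1 X F E)).
Local Notation y := (adot (nph2 X E F) (nph2 X F E)).
Local Notation z := (adot (nph3 X E F) (nph3 X F E)).

Lemma B2_y : 2%:R * B 2 = 4%:R * y + (2%:R * K - p) ^+ 2 * 4%:R * p.
Proof. by rewrite (null_aB2 nf par quart0 quart0'); ring. Qed.

Lemma B1_v : B 1 = 2%:R * v. Proof. exact: null_aB1. Qed.

Lemma lap_B1 : lap (B 1) = 2%:R * B 2
  + (14%:R * C - 9%:R * S) * B 1 - 7%:R * (2%:R * grad p p).
Proof.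
have L := lap_v nf par quart0 quart0'.
rewrite (alapE nf) (agradE) B1_v (M2 _ hF) B2_y nul_S nul_C.
rewrite /seth (M2 _ hE) in L *.
have -> : 2%:R * (2%:R * E (F v) - (-1)%:~R * nconn X E F * (2%:R * F v)) =
   4%:R * (E (F v) - (-1)%:~R * nconn X E F * F v) by ring.
by rewrite L; ring.
Qed.

Local Notation a := (2%:R * K - p).
Local Notation b := (5%:R * K - p).
Local Notation w2 := (seth X E F 1 (E p) * seth X F E 1 (F p)).

Lemma grad_pp : grad p p = 2%:R * (E p * F p).
Proof. by rewrite agradE; ring. Qed.

Lemma lap_gg : lap (grad p p) = 4%:R * w2 + 4%:R * (v + a * p) ^+ 2
  + 4%:R * grad p (v + a * p) + 2%:R * K * grad p p.
Proof.
have L := lap_grad nf par quart0 quart0'.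
rewrite grad_pp (alapE nf) agradE (M2 _ hF).
rewrite /seth (M2 _ hE) in L *.
have -> : 2%:R * (2%:R * E (F (E p * F p)) - (-1)%:~R * nconn X E F * (2%:R * F (E p * F p))) =
   4%:R * (E (F (E p * F p)) - (-1)%:~R * nconn X E F * F (E p * F p)) by ring.
by rewrite L; ring.
Qed.

Lemma lap_p : lap p = 2%:R * (v + a * p).
Proof. by rewrite (alapE nf) (lap_rho nf par quart0). Qed.

Lemma B3_z : B 3 = 2%:R * z + 2%:R * b ^+ 2 * v + 2%:R * a ^+ 2 * v
  - 6%:R * a * grad p p - 8%:R * b * grad p p + 34%:R * p * grad p p.
Proof.
rewrite (null_aB3 nf par quart0 quart0') (chi_chib nf par) grad_pp; ring.
Qed.

Lemma lap_yy : lap y = 2%:R * z + 2%:R * (b ^+ 2 * v - 4%:R * b * grad p p + 8%:R * p * grad p p)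
  + 2%:R * (2%:R * b + 4%:R * K) * y - 20%:R * grad p v + 20%:R * a * grad p p
  - 18%:R * w2 + 2%:R * s6.
Proof.
rewrite (alapE nf) (lap_y nf par quart0 quart0') (chi_chib nf par) !agradE; ring.
Qed.

Lemma lap_s6 : lap s6 = 2%:R * (seth X E F 6 (nsext X E F) * seth X F E 6 (nsext X F E))
  + 6%:R * (2%:R * C - S) * s6.
Proof.
have := bochner_sext nf par quart0 quart0'; rewrite !seth_0 => L.
by rewrite (alapE nf) L nul_S nul_C; ring.
Qed.

End NullSummary.

Local Open Scope classical_set_scope.
Local Open Scope ring_scope.

(** * Smooth functions on the plane *)

Lemma is_diff_intro (R : realType) (V W : normedModType R) (f : V -> W)
  (df : {linear V -> W}) (x : V) : continuous df ->
  (forall e : R, 0 < e ->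
    \forall h \near (0 : V), `|f (h + x) - f x - df h| <= e * `|h|) ->
  is_diff x f df.
Proof.
move=> dfc H.
have E : f \o shift x = cst (f x) + df +o_ 0 id.
  apply/eqaddoP => _/posnumP[e]; apply: filterS (H e%:num _) => // h.
  suff -> : (f \o shift x - (cst (f x) + df)) h = f (h + x) - f x - df h by [].
  by rewrite /= opprD addrA.
have dE := diff_unique dfc E.
apply: DiffDef; last by rewrite dE.
by apply/diff_locallyP; rewrite dE.
Qed.

Section Calculus.
Variable R : realType.
Local Notation P := (R * R)%type.
Local Notation cv := (coord_vec R).
Local Notation pds i F := (@pd R R^o i (F : P -> R^o)).
Implicit Types (D : set P) (F G : P -> R^o) (x y : P) (v : P) (i j : 'I_2).

Lemma is_derive_line F x v s : derivable F (s *: v + x) v ->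
  is_derive s 1 (fun t : R => F (t *: v + x)) ('D_v F (s *: v + x)).
Proof.
move=> h.
have E : (fun h0 : R => h0^-1 *: (((fun t => F (t *: v + x)) \o shift s) (h0 *: 1) -
     F (s *: v + x))) =
  (fun h0 : R => h0^-1 *: ((F \o shift (s *: v + x)) (h0 *: v) - F (s *: v + x))).
  apply/funext => t /=; congr (_ *: (F _ - _)).
  by rewrite scalerDl addrA; congr (_ *: _ + _ + _); rewrite /GRing.scale /= mulr1.
by split; rewrite /derivable /derive E.
Qed.

Lemma mvt_line F x v (h : R) :
  (forall t : R, `|t| <= `|h| -> derivable F (t *: v + x) v) ->
  exists2 c, `|c| <= `|h| & F (h *: v + x) - F x = 'D_v F (c *: v + x) * h.
Proof.
move=> hd; pose f (t : R) : R := F (t *: v + x).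
have df (t : R) : `|t| <= `|h| -> is_derive t (1 : R) f ('D_v F (t *: v + x)).
  by move=> /hd; exact: is_derive_line.
have fc (t : R) : `|t| <= `|h| -> {for t, continuous f}.
  move=> /df [d _]; apply: differentiable_continuous.
  by apply/derivable1_diffP.
have f0 : f 0 = F x by rewrite /f scale0r add0r.
have [h0|h0] := leP 0 h.
  have [| |c ch E] := @MVT_segment R f (fun t => 'D_v F (t *: v + x)) 0 h h0.
  - move=> t; rewrite in_itv /= => /andP[t0 th]; apply: df.
    by rewrite !ger0_norm // ?ltW.
  - apply: continuous_in_subspaceT => t; rewrite inE /= in_itv /= => /andP[t0 th].
    by apply: fc; rewrite !ger0_norm.
  exists c; last by rewrite -f0 -/(f h) E subr0.
  by move: ch; rewrite in_itv /= => /andP[c0 ch]; rewrite !ger0_norm.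
have [| |c ch E] := @MVT_segment R f (fun t => 'D_v F (t *: v + x)) h 0 (ltW h0).
- move=> t; rewrite in_itv /= => /andP[t0 th]; apply: df.
  by rewrite !ler0_norm ?lerN2 // ltW.
- apply: continuous_in_subspaceT => t; rewrite inE /= in_itv /= => /andP[t0 th].
  by apply: fc; rewrite !ler0_norm ?lerN2 // ltW.
exists c.
  by move: ch; rewrite in_itv /= => /andP[c0 ch]; rewrite !ler0_norm ?lerN2 // ltW.
by rewrite -f0 -/(f h) -opprB E sub0r mulrN opprK.
Qed.

(** The recursion passes to the partial derivatives, so that closure properties are proved by
    induction on [k] for all functions at once. *)
Fixpoint Ck (k : nat) D F : Prop :=
  (forall x, D x -> {for x, continuous F}) /\
  (if k is k'.+1 then
     forall i, (forall x, D x -> derivable F x (cv i)) /\ Ck k' D (pds i F)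
   else True).

Definition Csm D F := forall k, Ck k D F.

Lemma Ck_cont k D F x : Ck k D F -> D x -> {for x, continuous F}.
Proof. by case: k => [|k] [h _]; apply: h. Qed.

Lemma Ck_derivable k D F x i : Ck k.+1 D F -> D x -> derivable F x (cv i).
Proof. by move=> [_ /(_ i) [h _]]; apply: h. Qed.

Lemma Ck_pd k D F i : Ck k.+1 D F -> Ck k D (pds i F).
Proof. by move=> [_ /(_ i) []]. Qed.

Lemma CkW k D F : Ck k.+1 D F -> Ck k D F.
Proof.
elim: k F => [|k IH] F [hc hd]; split=> // i.
have [h1 h2] := hd i; split=> //; exact: IH.
Qed.

Lemma Ck_sub k D D' F : D' `<=` D -> Ck k D F -> Ck k D' F.
Proof.
move=> s; elim: k F => [|k IH] F [hc hd]; split=> //; try by move=> x /s; apply: hc.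
by move=> i; have [h1 h2] := hd i; split; [move=> x /s; apply: h1|exact: IH].
Qed.

Lemma near_open D F G x : open D -> D x -> (forall y, D y -> F y = G y) ->
  \near x, F x = G x.
Proof.
move=> oD Dx h; have : nbhs x D by exact: open_nbhs_nbhs.
by apply: filterS => y; exact: h.
Qed.

Lemma pd_congr D F G x i : open D -> D x -> (forall y, D y -> F y = G y) ->
  pds i F x = pds i G x.
Proof. by move=> oD Dx h; apply: near_eq_derive; exact: near_open h. Qed.

Lemma Ck_congr k D F G : open D -> (forall x, D x -> F x = G x) ->
  Ck k D F -> Ck k D G.
Proof.
move=> oD; elim: k F G => [|k IH] F G h [hc hd].
  split=> // x Dx; apply: cvg_trans (cvg_trans (hc x Dx) _).
    by apply: near_eq_cvg; exact: near_open h.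
  by rewrite h.
split=> [x Dx|i].
  apply: cvg_trans (cvg_trans (hc x Dx) _).
    by apply: near_eq_cvg; exact: near_open h.
  by rewrite h.
have [h1 h2] := hd i; split=> [x Dx|].
  by apply: near_eq_derivable (h1 x Dx); exact: near_open h.
by apply: IH h2 => x Dx; exact: pd_congr h.
Qed.

Lemma Ck_cst k D (a : R) : Ck k D (cst a).
Proof.
elim: k a => [|k IH] a; split=> //; try by move=> x _; exact: cvg_cst.
move=> i; split=> [x _|]; first exact: derivable_cst.
have -> : pds i (cst a) = cst 0 by apply/funext => x; exact: derive_cst.
exact: IH.
Qed.

Lemma pdD F G x i : derivable F x (cv i) -> derivable G x (cv i) ->
  pds i (fun y => F y + G y) x = pds i F x + pds i G x.
Proof. exact: deriveD. Qed.

Lemma pdN F x i : derivable F x (cv i) ->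
  pds i (fun y => - F y) x = - pds i F x.
Proof. exact: deriveN. Qed.

Lemma pdM F G x i : derivable F x (cv i) -> derivable G x (cv i) ->
  pds i (fun y => F y * G y) x = pds i F x * G x + F x * pds i G x.
Proof.
move=> dF dG; rewrite /pd (deriveM dF dG) addrC; congr (_ + _).
exact: mulrC.
Qed.

Lemma pdV F x i : F x != 0 -> derivable F x (cv i) ->
  pds i (fun y => (F y)^-1) x = - (F x ^- 2) * pds i F x.
Proof. exact: deriveV. Qed.

Lemma CkD k D F G : open D -> Ck k D F -> Ck k D G ->
  Ck k D (fun x => F x + G x).
Proof.
move=> oD; elim: k F G => [|k IH] F G hF hG; split=> //;
  try by move=> x Dx; apply: cvgD; [exact: Ck_cont hF _|exact: Ck_cont hG _].
move=> i; split=> [x Dx|].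
  by apply: derivableD; apply: Ck_derivable Dx; eassumption.
apply: Ck_congr (IH _ _ (Ck_pd i hF) (Ck_pd i hG)) => // x Dx.
by rewrite pdD //; apply: Ck_derivable Dx; eassumption.
Qed.

Lemma CkN k D F : open D -> Ck k D F -> Ck k D (fun x => - F x).
Proof.
move=> oD; elim: k F => [|k IH] F hF; split=> //;
  try by move=> x Dx; apply: cvgN; exact: Ck_cont hF _.
move=> i; split=> [x Dx|].
  by apply: derivableN; apply: Ck_derivable Dx; eassumption.
apply: Ck_congr (IH _ (Ck_pd i hF)) => // x Dx.
by rewrite pdN //; apply: Ck_derivable Dx; eassumption.
Qed.

Lemma CkM k D F G : open D -> Ck k D F -> Ck k D G ->
  Ck k D (fun x => F x * G x).
Proof.
move=> oD; elim: k F G => [|k IH] F G hF hG; split=> //;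
  try by move=> x Dx; apply: cvgM; [exact: Ck_cont hF _|exact: Ck_cont hG _].
move=> i; split=> [x Dx|].
  by apply: derivableM; apply: Ck_derivable Dx; eassumption.
apply: Ck_congr (CkD oD (IH _ _ (Ck_pd i hF) (CkW hG)) (IH _ _ (CkW hF) (Ck_pd i hG))) => // x Dx.
by rewrite pdM //; apply: Ck_derivable Dx; eassumption.
Qed.

Lemma CkV k D F : open D -> (forall x, D x -> F x != 0) -> Ck k D F ->
  Ck k D (fun x => (F x)^-1).
Proof.
move=> oD h0; elim: k => [|k IH] hF; split=> //;
  try by move=> x Dx; apply: cvgV; [exact: h0|exact: Ck_cont hF _].
move=> i; split=> [x Dx|].
  by apply: derivableV; [exact: h0|apply: Ck_derivable Dx; eassumption].
have H := IH (CkW hF).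
apply: Ck_congr (CkM oD (CkN oD (CkM oD H H)) (Ck_pd i hF)) => // x Dx.
rewrite pdV ?h0 //; last exact: Ck_derivable hF Dx.
by rewrite expr2 invfM.
Qed.

(** The increment is cut into one step along each axis, with the mean value theorem on both; [c] and
    [d] are partial derivatives at intermediate points, close to those at [x] by continuity. *)
Lemma C1_incr D F x (e : R) : open D -> D x -> Ck 1 D F -> 0 < e ->
  \forall h \near (0 : P), exists c d : R,
   [/\ `|c - pds ord0 F x| <= e, `|d - pds ord_max F x| <= e &
   F (h + x) - F x = c * h.1 + d * h.2].
Proof.
move=> oD Dx hF e0.
have c0 := Ck_cont (Ck_pd ord0 hF) Dx.
have c1 := Ck_cont (Ck_pd ord_max hF) Dx.
move/cvgrPdist_le : c0 => /(_ e e0) n0.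
move/cvgrPdist_le : c1 => /(_ e e0) n1.
have nD : nbhs x D by exact: open_nbhs_nbhs.
have /nbhs_ballP[r /= r0 hr] : nbhs x (fun y => [/\ D y, `|pds ord0 F x - pds ord0 F y| <= e &
   `|pds ord_max F x - pds ord_max F y| <= e]).
  apply: filter_app nD; apply: filter_app n0; apply: filterS n1 => y h1 h2 h3.
  exact: (And3 h3 h2 h1).
have B (a b : R) (h : P) : `|h| < r -> `|a| <= `|h.1| -> `|b| <= `|h.2| ->
   ball x r (a *: cv ord0 + (b *: cv ord_max + x)).
  rewrite prod_normE gt_max => /andP[h1 h2] ha hb.
  have E : a *: cv ord0 + (b *: cv ord_max + x) = (a + x.1, b + x.2).
    rewrite /coord_vec /=; congr (_, _) => /=; rewrite /GRing.scale /=; ring.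
  rewrite E; split; rewrite /ball /= opprD addrCA subrr addr0 normrN.
    exact: le_lt_trans ha h1.
  exact: le_lt_trans hb h2.
have n0' : \forall h \near (0 : P), `|h| < r by exact: nbhs0_lt.
apply: filterS n0' => h hr'.
have [t ht|c hc Ec] := @mvt_line F (h.2 *: cv ord_max + x) (cv ord0) h.1.
  apply: (Ck_derivable hF); have := B t h.2 h hr' ht (lexx _).
  by move/hr => [].
have [t ht|d hd Ed] := @mvt_line F x (cv ord_max) h.2.
  apply: (Ck_derivable hF); have := B 0 t h hr' _ ht.
  by rewrite normr0 scale0r add0r => /(_ (normr_ge0 _)) /hr [].
exists (pds ord0 F (c *: cv ord0 + (h.2 *: cv ord_max + x))).
exists (pds ord_max F (d *: cv ord_max + x)); split.
- by rewrite distrC; have /hr[_ h1 _] := B c h.2 h hr' hc (lexx _); exact: h1.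
- rewrite distrC; have := B 0 d h hr' _ hd.
  by rewrite normr0 scale0r add0r => /(_ (normr_ge0 _)) /hr [_ _ h1]; exact: h1.
rewrite /pd -Ec -Ed addrA addrNK; congr (F _ - _).
rewrite addrA; congr (_ + _).
by rewrite /coord_vec /= [LHS]surjective_pairing; congr (_, _) => /=; rewrite /GRing.scale /=; ring.
Qed.

Lemma C1_is_diff D F x : open D -> D x -> Ck 1 D F ->
  is_diff x F (fun h => h.1 * pds ord0 F x + h.2 * pds ord_max F x).
Proof.
move=> oD Dx hF.
pose L (h : P) : R^o := h.1 * pds ord0 F x + h.2 * pds ord_max F x.
have HL : linear L.
  by move=> a u v; rewrite /L /= /GRing.scale /= /GRing.scale /=; ring.
pose LL : {linear P -> R^o} := HB.pack L (GRing.isLinear.Build _ _ _ _ L HL).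
have Lc : continuous LL.
  move=> h; apply: cvgD; apply: cvgM; try exact: cvg_cst.
    exact: cvg_fst.
  exact: cvg_snd.
apply: (is_diff_intro Lc) => e e0.
have e2 : 0 < e / 2 by rewrite divr_gt0.
apply: filterS (C1_incr oD Dx hF e2) => h [c [d [hc hd Eh]]].
rewrite Eh -[LL h]/(L h) /L.
have -> : c * h.1 + d * h.2 - (h.1 * pds ord0 F x + h.2 * pds ord_max F x) =
    (c - pds ord0 F x) * h.1 + (d - pds ord_max F x) * h.2 :> R by ring.
have m1 : `|h.1| <= `|h| by rewrite prod_normE le_max lexx.
have m2 : `|h.2| <= `|h| by rewrite prod_normE le_max lexx orbT.
apply: le_trans (ler_normD _ _) _; rewrite !normrM [e]splitr mulrDl.
apply: lerD; [exact: (ler_pM _ _ hc m1)|exact: (ler_pM _ _ hd m2)].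
Qed.

Lemma comp_cvg (tau : P -> P) x :
  {for x, continuous (fun y => (tau y).1 : R^o)} ->
  {for x, continuous (fun y => (tau y).2 : R^o)} -> {for x, continuous tau}.
Proof.
move=> h1 h2; have E : tau = fun y => ((tau y).1, (tau y).2).
  by apply/funext => y; rewrite -surjective_pairing.
rewrite /continuous_at E /=; exact: (cvg_pair h1 h2).
Qed.

Lemma pd_comp D D' (tau : P -> P) F x i : open D -> open D' -> D' x -> D (tau x) ->
  Ck 1 D F -> Ck 1 D' (fun y => (tau y).1) -> Ck 1 D' (fun y => (tau y).2) ->
  derivable (fun y => F (tau y)) x (cv i) /\
  pds i (fun y => F (tau y)) x =
  pds ord0 F (tau x) * pds i (fun y => (tau y).1) x
  + pds ord_max F (tau x) * pds i (fun y => (tau y).2) x.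
Proof.
move=> oD oD' Dx Dtx hF h1 h2.
have dF := C1_is_diff oD Dtx hF.
have d1 := C1_is_diff oD' Dx h1.
have d2 := C1_is_diff oD' Dx h2.
have dt : is_diff x tau (fun h =>
   (h.1 * pds ord0 (fun y => (tau y).1) x + h.2 * pds ord_max (fun y => (tau y).1) x,
    h.1 * pds ord0 (fun y => (tau y).2) x + h.2 * pds ord_max (fun y => (tau y).2) x)).
  have E : tau = fun y => ((tau y).1, (tau y).2).
    by apply/funext => y; rewrite -surjective_pairing.
  rewrite {1}E; exact: is_diff_pair.
have dcmp : differentiable (F \o tau) x by apply: differentiable_comp.
have E : 'd (F \o tau) x = 'd F (tau x) \o 'd tau x :> (_ -> _) by exact: diff_comp.
split; first exact: diff_derivable.
rewrite /pd -[LHS]/('D_(cv i) (F \o tau) x) (deriveE _ dcmp) E /= !diff_val /=.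
rewrite -!/(pd _ _ _).
have [->|->] := I2P i; rewrite /coord_vec /= !mul1r !mul0r ?addr0 ?add0r;
  by congr (_ + _); exact: mulrC.
Qed.

Lemma Ck_comp k D D' (tau : P -> P) F : open D -> open D' ->
  (forall x, D' x -> D (tau x)) ->
  Ck k D F -> Ck k D' (fun y => (tau y).1) -> Ck k D' (fun y => (tau y).2) ->
  Ck k D' (fun y => F (tau y)).
Proof.
move=> oD oD' tD; elim: k F => [|k IH] F hF h1 h2.
  split=> // x Dx; apply: (@continuous_comp _ _ _ tau F).
    by apply: comp_cvg; [exact: Ck_cont h1 Dx|exact: Ck_cont h2 Dx].
  exact: Ck_cont hF (tD _ Dx).
have W1 m (G : P -> R^o) (E : set P) : Ck m.+1 E G -> Ck 1 E G.
  by elim: m => [|m IHm] // /CkW /IHm.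
have C x i (Dx : D' x) := @pd_comp D D' tau F x i oD oD' Dx (tD _ Dx) (W1 _ _ _ hF) (W1 _ _ _ h1) (W1 _ _ _ h2).
split=> [x Dx|i].
  apply: (@continuous_comp _ _ _ tau F).
    by apply: comp_cvg; [exact: Ck_cont h1 Dx|exact: Ck_cont h2 Dx].
  exact: Ck_cont hF (tD _ Dx).
split=> [x Dx|]; first by have [] := C x i Dx.
have H0 := IH _ (Ck_pd ord0 hF) (CkW h1) (CkW h2).
have H1 := IH _ (Ck_pd ord_max hF) (CkW h1) (CkW h2).
apply: Ck_congr (CkD oD' (CkM oD' H0 (Ck_pd i h1)) (CkM oD' H1 (Ck_pd i h2))) => // x Dx.
by have [_ ->] := C x i Dx.
Qed.

Definition crd i x : R^o := if i == ord0 then x.1 else x.2.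

Lemma is_derive_crd i j x : is_derive x (cv j) (crd i) (i == j)%:R.
Proof.
have C : (fun h : R => h^-1 *: ((crd i \o shift x) (h *: cv j) - crd i x)) @ 0^' --> ((i == j)%:R : R^o).
  apply: cvg_near_cst; near=> h.
  have h0 : h != 0 by near: h; exact: nbhs_dnbhs_neq.
  have -> : (crd i \o shift x) (h *: cv j) - crd i x = h * (i == j)%:R.
    have [->|->] := I2P i; have [->|->] := I2P j;
      rewrite /crd /coord_vec /= /GRing.scale /=; ring.
  by rewrite /GRing.scale /= mulKf.
by split; [exact: cvgP C|exact: cvg_lim C].
Unshelve. all: by end_near. Qed.

Lemma Ck_crd k D i : Ck k D (crd i).
Proof.
have H x : {for x, continuous (crd i)}.
  by rewrite /crd /continuous_at; case: (i == ord0); [exact: cvg_fst|exact: cvg_snd].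
case: k => [|k]; split=> // j; split=> [x _|]; first by have [] := is_derive_crd i j x.
have -> : pds j (crd i) = cst (i == j)%:R.
  by apply/funext => x; have [_] := is_derive_crd i j x.
exact: Ck_cst.
Qed.

(** The mean value theorem is applied along [j] to the increment of [F] in direction [i], and then
    along [i] to the partial derivative in direction [j]. *)
Lemma schwarz_aux D F x i j (h : R) : open D ->
  (forall s t : R, `|s| <= `|h| -> `|t| <= `|h| -> D (s *: cv i + (t *: cv j + x))) ->
  Ck 2 D F -> exists c d : R, [/\ `|c| <= `|h|, `|d| <= `|h| &
  F (h *: cv i + (h *: cv j + x)) - F (h *: cv j + x) - (F (h *: cv i + x) - F x) =
  pds i (pds j F) (c *: cv i + (d *: cv j + x)) * h ^+ 2].
Proof.
move=> oD hD hF.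
pose G : P -> R^o := fun y => F (h *: cv i + y) - F y.
have dsh y : derivable F (h *: cv i + y) (cv j) ->
    is_derive y (cv j) ((fun y => F (h *: cv i + y)) : P -> R^o) (pds j F (h *: cv i + y)).
  move=> dF.
  have E : (fun h0 : R => h0^-1 *: ((((fun y => F (h *: cv i + y)) : P -> R^o) \o shift y) (h0 *: cv j) -
     F (h *: cv i + y))) =
   (fun h0 : R => h0^-1 *: ((F \o shift (h *: cv i + y)) (h0 *: cv j) - F (h *: cv i + y))).
    by apply/funext => t /=; congr (_ *: (F _ - _)); rewrite addrCA.
  by split; rewrite /derivable /derive E.
have dG (t : R) : `|t| <= `|h| -> is_derive (t *: cv j + x) (cv j) G
   (pds j F (h *: cv i + (t *: cv j + x)) - pds j F (t *: cv j + x)).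
  move=> ht; apply: is_deriveB; first by apply/dsh/(Ck_derivable hF)/hD.
  apply/derivableP/(Ck_derivable hF).
  by have := hD 0 t _ ht; rewrite normr0 scale0r add0r; apply.
have [t ht|d hd Ed] := @mvt_line G x (cv j) h; first by have [] := dG t ht.
have [t ht|c hc Ec] := @mvt_line (pds j F) (d *: cv j + x) (cv i) h.
  by apply/(Ck_derivable (Ck_pd j hF))/hD.
exists c, d; split=> //.
have := Ed; have [_ ->] := dG d hd; rewrite /G Ec /pd => ->.
by rewrite expr2 mulrA.
Qed.

(** The second difference over a square is symmetric in the two directions, so a value of one mixed
    derivative near [x] equals a value of the other; continuity puts each within e / 2 of its value
    at [x]. *)
Lemma schwarz D F x : open D -> D x -> Ck 2 D F ->
  pds ord0 (pds ord_max F) x = pds ord_max (pds ord0 F) x.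
Proof.
move=> oD Dx hF; apply/eqP; rewrite -subr_eq0 -normr_le0; apply/ler_addgt0Pr => e e0.
rewrite add0r.
have c0 := Ck_cont (Ck_pd ord0 (Ck_pd ord_max hF)) Dx.
have c1 := Ck_cont (Ck_pd ord_max (Ck_pd ord0 hF)) Dx.
have e2 : 0 < e / 2 by rewrite divr_gt0.
move/cvgrPdist_le : c0 => /(_ _ e2) n0.
move/cvgrPdist_le : c1 => /(_ _ e2) n1.
have nD : nbhs x D by exact: open_nbhs_nbhs.
have /nbhs_ballP[r /= r0 hr] : nbhs x (fun y => [/\ D y,
   `|pds ord0 (pds ord_max F) x - pds ord0 (pds ord_max F) y| <= e / 2 &
   `|pds ord_max (pds ord0 F) x - pds ord_max (pds ord0 F) y| <= e / 2]).
  apply: filter_app nD; apply: filter_app n0; apply: filterS n1 => y h1 h2 h3.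
  exact: (And3 h3 h2 h1).
pose h := r / 2; have h0 : 0 < h by rewrite divr_gt0.
have B (a b : R) : `|a| <= `|h| -> `|b| <= `|h| ->
   ball x r (a *: cv ord0 + (b *: cv ord_max + x)).
  have hr' : `|h| < r by rewrite gtr0_norm // /h ltr_pdivrMr // ltr_pMr // ltr1n.
  move=> ha hb.
  have E : a *: cv ord0 + (b *: cv ord_max + x) = (a + x.1, b + x.2).
    rewrite /coord_vec /=; congr (_, _) => /=; rewrite /GRing.scale /=; ring.
  rewrite E; split; rewrite /ball /= opprD addrCA subrr addr0 normrN.
    exact: le_lt_trans ha hr'.
  exact: le_lt_trans hb hr'.
have BC (a b : R) : b *: cv ord_max + (a *: cv ord0 + x) = a *: cv ord0 + (b *: cv ord_max + x).
  by rewrite addrCA.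
have [|c [d [hc hd E1]]] := @schwarz_aux D F x ord0 ord_max h oD _ hF.
  by move=> s t hs ht; have /hr[] := B s t hs ht.
have [|c' [d' [hc' hd' E2]]] := @schwarz_aux D F x ord_max ord0 h oD _ hF.
  by move=> s t hs ht; rewrite BC; have /hr[] := B t s ht hs.
have E : pds ord0 (pds ord_max F) (c *: cv ord0 + (d *: cv ord_max + x)) =
   pds ord_max (pds ord0 F) (c' *: cv ord_max + (d' *: cv ord0 + x)).
  apply: (@mulIf _ (h ^+ 2)); first by rewrite expf_neq0 // gt_eqF.
  have Z (V : zmodType) (a1 a2 a3 a4 : V) : a1 - a2 - (a3 - a4) = a1 - a3 - (a2 - a4).
    by rewrite !opprB addrACA [RHS]addrACA (addrC (- a2)).
  apply: (etrans (esym E1)); apply: (etrans _ E2); rewrite (BC h h).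
  exact: (Z R^o (F (h *: cv ord0 + (h *: cv ord_max + x)))
    (F (h *: cv ord_max + x)) (F (h *: cv ord0 + x)) (F x)).
have /hr[_ b1 _] := B c d hc hd.
have /hr[_ _ b2] := B d' c' hd' hc'.
rewrite BC in E; rewrite E in b1.
rewrite [e]splitr; apply: le_trans (ler_distD _ _ _) (lerD b1 _).
by rewrite distrC; exact: b2.
Qed.

Lemma is_derive_comp1 D F (f : R -> R) (d : R) x i : open D -> D x -> Ck 1 D F ->
  is_derive (F x : R) (1 : R) f d ->
  is_derive x (cv i) ((fun y => f (F y)) : P -> R^o) (d * pds i F x).
Proof.
move=> oD Dx hF [df dE].
have dF : differentiable F x by have [] := C1_is_diff oD Dx hF.
have df' : differentiable (f : R^o -> R^o) (F x) by apply/derivable1_diffP.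
have dcmp : differentiable ((f : R^o -> R^o) \o F) x by apply: differentiable_comp.
have E : 'd ((f : R^o -> R^o) \o F) x = 'd (f : R^o -> R^o) (F x) \o 'd F x :> (_ -> _) by exact: diff_comp.
apply: DeriveDef; first exact: (diff_derivable dcmp).
rewrite -[LHS]/('D_(cv i) ((f : R^o -> R^o) \o F) x) (deriveE _ dcmp) E /=.
rewrite (diff1E df') derive1E dE -(deriveE _ dF).
exact: mulrC.
Qed.

Lemma Ck_sqrt k D F : open D -> (forall x, D x -> 0 < F x) -> Ck k D F ->
  Ck k D (fun x => Num.sqrt (F x)).
Proof.
move=> oD h0.
have W1 m (G : P -> R^o) (E : set P) : Ck m.+1 E G -> Ck 1 E G.
  by elim: m => [|m IHm] // /CkW /IHm.
have H i x (hF : Ck 1 D F) (Dx : D x) :=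
  is_derive_comp1 i oD Dx hF (is_derive1_sqrt (h0 x Dx)).
have cs (hF : Ck 0 D F) x (Dx : D x) : {for x, continuous (fun x => Num.sqrt (F x) : R^o)}.
  apply: (@continuous_comp _ _ _ F (@Num.sqrt R : R^o -> R^o)).
    exact: Ck_cont hF Dx.
  exact: sqrt_continuous.
elim: k => [|k IH] hF.
  by split=> // x Dx; exact: cs.
have C0 : Ck 0 D F by elim: (k.+1) hF => [|m IHm] // /CkW.
split; first by move=> x Dx; exact: cs.
have s0 x : D x -> 2 * Num.sqrt (F x) != 0.
  by move=> Dx; rewrite mulf_neq0 // gt_eqF // sqrtr_gt0 h0.
move=> i; split=> [x Dx|]; first by have [] := H i x (W1 _ _ _ hF) Dx.
have Hs := IH (CkW hF).
apply: Ck_congr (CkM oD (CkV oD s0 (CkM oD (Ck_cst k D 2) Hs)) (Ck_pd i hF)) => // x Dx.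
by have [_ <-] := H i x (W1 _ _ _ hF) Dx.
Qed.

End Calculus.

(** * The differential ring of complex-valued smooth functions on an open set *)

Section SmoothFunctions.
Variable R : realType.
Local Notation P := (R * R)%type.
Local Notation cv := (coord_vec R).
Local Notation pds i F := (@pd R R^o i (F : P -> R^o)).

Record oset := OSet { os :> set P; os_open : open os }.
Arguments os : clear implicits.
Arguments os_open : clear implicits.
Variable D : oset.
Let oD := os_open D.

(** Real and imaginary parts vanish outside [D], so that agreement on [D] is equality, as the ring
    axioms demand. *)
Record sfun : Type := SFun {
  sre : P -> R; sim : P -> R;
  sre_sm : Csm (os D) sre; sim_sm : Csm (os D) sim;
  sre_off : forall x, ~ os D x -> sre x = 0;
  sim_off : forall x, ~ os D x -> sim x = 0 }.

HB.instance Definition _ := gen_eqMixin sfun.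
HB.instance Definition _ := gen_choiceMixin sfun.

Implicit Types F G H : sfun.

Lemma sfun_ext F G : (forall x, os D x -> sre F x = sre G x) ->
  (forall x, os D x -> sim F x = sim G x) -> F = G.
Proof.
move=> h1 h2.
have e1 : sre F = sre G.
  apply/funext => x; have [Dx|nDx] := pselect (os D x); first exact: h1.
  by rewrite !sre_off.
have e2 : sim F = sim G.
  apply/funext => x; have [Dx|nDx] := pselect (os D x); first exact: h2.
  by rewrite !sim_off.
case: F G e1 e2 {h1 h2} => [a b ? ? ? ?] [c d ? ? ? ?] /= e1 e2.
by subst c d; congr SFun; exact: Prop_irrelevance.
Qed.

Definition cut (f : P -> R^o) : P -> R^o := fun x => if pselect (os D x) then f x else 0.
Lemma cutE f x : os D x -> cut f x = f x.
Proof. by rewrite /cut; case: pselect. Qed.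
Lemma cut_off f x : ~ os D x -> cut f x = 0.
Proof. by rewrite /cut; case: pselect. Qed.
Lemma cut_sm f : Csm D f -> Csm D (cut f).
Proof. by move=> h k; apply: Ck_congr (h k) => // x Dx; rewrite cutE. Qed.

Lemma csm0 : Csm D (cst 0 : P -> R^o). Proof. by move=> k; exact: Ck_cst. Qed.

Definition smk f (h : Csm D f) : sfun :=
  SFun (cut_sm h) csm0 (@cut_off f) (fun x _ => erefl).

Lemma csm_cst (a : R) : Csm D (cst a : P -> R^o). Proof. by move=> k; exact: Ck_cst. Qed.
Definition scst a := smk (csm_cst a).

Definition sadd F G : sfun.
Proof.
apply: (@SFun (fun x => sre F x + sre G x) (fun x => sim F x + sim G x)).
- by move=> k; apply: CkD => //; exact: sre_sm.
- by move=> k; apply: CkD => //; exact: sim_sm.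
- by move=> x nD; rewrite !sre_off // addr0.
- by move=> x nD; rewrite !sim_off // addr0.
Defined.
Definition sopp F : sfun.
Proof.
apply: (@SFun (fun x => - sre F x) (fun x => - sim F x)).
- by move=> k; apply: CkN => //; exact: sre_sm.
- by move=> k; apply: CkN => //; exact: sim_sm.
- by move=> x nD; rewrite !sre_off // oppr0.
- by move=> x nD; rewrite !sim_off // oppr0.
Defined.
Definition smul F G : sfun.
Proof.
apply: (@SFun (fun x => sre F x * sre G x + - (sim F x * sim G x))
  (fun x => sre F x * sim G x + sim F x * sre G x)).
- move=> k; apply: CkD => //; last apply: CkN => //; apply: CkM => //;
    first [exact: sre_sm|exact: sim_sm].
- move=> k; apply: CkD => //; apply: CkM => //;
    first [exact: sre_sm|exact: sim_sm].
- by move=> x nD; rewrite !sre_off // !sim_off // !mul0r oppr0 addr0.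
- by move=> x nD; rewrite !sre_off // !sim_off // !mul0r addr0.
Defined.
Definition sconj F : sfun.
Proof.
apply: (@SFun (sre F) (fun x => - sim F x)).
- exact: sre_sm.
- by move=> k; apply: CkN => //; exact: sim_sm.
- exact: sre_off.
- by move=> x nD; rewrite !sim_off // oppr0.
Defined.

Lemma saddA : associative sadd.
Proof. by move=> F G H; apply: sfun_ext => x _ /=; rewrite addrA. Qed.
Lemma saddC : commutative sadd.
Proof. by move=> F G; apply: sfun_ext => x _ /=; rewrite addrC. Qed.
Lemma sadd0 : left_id (scst 0) sadd.
Proof. by move=> F; apply: sfun_ext => x Dx /=; rewrite ?cutE // add0r. Qed.
Lemma saddN : left_inverse (scst 0) sopp sadd.
Proof. by move=> F; apply: sfun_ext => x Dx /=; rewrite ?cutE // addNr. Qed.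
HB.instance Definition _ := GRing.isZmodule.Build sfun saddA saddC sadd0 saddN.

Let rg (a b c d e f : R) :
  (a * (c * e - d * f) - b * (c * f + d * e) =
  (a * c - b * d) * e - (a * d + b * c) * f) *
  (a * (c * f + d * e) + b * (c * e - d * f) =
  (a * c - b * d) * f + (a * d + b * c) * e).
Proof. by split; ring. Qed.

Lemma smulA : associative smul.
Proof. by move=> F G H; apply: sfun_ext => x _ /=; rewrite rg. Qed.
Lemma smulC : commutative smul.
Proof.
move=> F G; apply: sfun_ext => x _ /=.
  by rewrite (mulrC (sre F x)) (mulrC (sim F x)).
by rewrite addrC (mulrC (sre F x)) (mulrC (sim F x)).
Qed.
Lemma smul1 : left_id (scst 1) smul.
Proof.
move=> F; apply: sfun_ext => x Dx /=; rewrite !cutE //= !mul1r !mul0r.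
  by rewrite oppr0 addr0.
by rewrite addr0.
Qed.
Lemma smulD : left_distributive smul (+%R : sfun -> sfun -> sfun).
Proof.
move=> F G H; apply: sfun_ext => x _ /=; rewrite !mulrDl.
  by rewrite opprD addrACA.
by rewrite addrACA.
Qed.
HB.instance Definition _ := GRing.Zmodule_isComPzRing.Build sfun smulA smulC smul1 smulD.

Lemma sreD F G x : sre (F + G) x = sre F x + sre G x. Proof. by []. Qed.
Lemma simD F G x : sim (F + G) x = sim F x + sim G x. Proof. by []. Qed.
Lemma sreN F x : sre (- F) x = - sre F x. Proof. by []. Qed.
Lemma simN F x : sim (- F) x = - sim F x. Proof. by []. Qed.
Lemma sreM F G x : sre (F * G) x = sre F x * sre G x - sim F x * sim G x.
Proof. by []. Qed.
Lemma simM F G x : sim (F * G) x = sre F x * sim G x + sim F x * sre G x.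
Proof. by []. Qed.
Lemma sre0 x : sre (0 : sfun) x = 0. Proof. by rewrite /= /cut; case: pselect. Qed.
Lemma sim0 x : sim (0 : sfun) x = 0. Proof. by []. Qed.
Lemma sre1 x : os D x -> sre (1 : sfun) x = 1. Proof. exact: cutE. Qed.
Lemma sim1 x : sim (1 : sfun) x = 0. Proof. by []. Qed.

Lemma pd_sm f i : Csm D f -> Csm D (pds i f).
Proof. by move=> h k; exact: Ck_pd (h k.+1). Qed.

Definition spd (i : 'I_2) F : sfun :=
  SFun (cut_sm (pd_sm i (sre_sm F))) (cut_sm (pd_sm i (sim_sm F)))
    (@cut_off _) (@cut_off _).

Lemma spd_der i : derivation (spd i).
Proof.
have dr F x : os D x -> derivable (sre F) x (cv i).
  by move=> Dx; exact: (Ck_derivable (sre_sm F 1%N)).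
have di F x : os D x -> derivable (sim F) x (cv i).
  by move=> Dx; exact: (Ck_derivable (sim_sm F 1%N)).
split=> F G; apply: sfun_ext => x Dx /=; rewrite !cutE //.
- by apply: pdD; exact: dr.
- by apply: pdD; exact: di.
- rewrite pdD; [|apply: derivableM; exact: dr|apply/derivableN/derivableM; exact: di].
  rewrite pdN; last by apply: derivableM; exact: di.
  by rewrite !pdM; [|exact: di..|exact: dr|exact: dr]; rewrite opprD addrACA.
- rewrite pdD; [|by apply: derivableM; [exact: dr|exact: di]|by apply: derivableM; [exact: di|exact: dr]].
  by rewrite !pdM; [|exact: di|exact: dr|exact: dr|exact: di]; rewrite addrACA.
Qed.

Lemma spd_comm F : spd ord0 (spd ord_max F) = spd ord_max (spd ord0 F).
Proof.
have E i j f x : os D x -> pds i (cut (pds j f)) x = pds i (pds j f) x.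
  by move=> Dx; apply: (pd_congr i oD Dx) => y; exact: cutE.
have S f x : Csm D f -> os D x ->
    cut (pds ord0 (cut (pds ord_max f))) x = cut (pds ord_max (cut (pds ord0 f))) x.
  move=> hf Dx; apply: (etrans (cutE _ Dx)); apply: (etrans (E _ _ _ _ Dx)).
  apply: (etrans (schwarz oD Dx (hf 2%N))).
  exact: (esym (etrans (cutE _ Dx) (E _ _ _ _ Dx))).
apply: sfun_ext => x Dx; [exact: (S _ _ (sre_sm F) Dx)|exact: (S _ _ (sim_sm F) Dx)].
Qed.

Lemma sconj_spd i F : sconj (spd i F) = spd i (sconj F).
Proof.
apply: sfun_ext => x Dx //=; rewrite !cutE // pdN //.
exact: (Ck_derivable (sim_sm F 1%N)).
Qed.
Lemma sconjD F G : sconj (F + G) = sconj F + sconj G.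
Proof. by apply: sfun_ext => x Dx //=; rewrite opprD. Qed.
Lemma sconjN F : sconj (- F) = - sconj F.
Proof. by apply: sfun_ext. Qed.
Lemma sconjM F G : sconj (F * G) = sconj F * sconj G.
Proof.
by apply: sfun_ext => x Dx //=; rewrite ?mulrNN // opprD mulrN mulNr.
Qed.
Lemma sconjK F : sconj (sconj F) = F.
Proof. by apply: sfun_ext => x Dx //=; rewrite opprK. Qed.
Lemma sconj_real F : (forall x, os D x -> sim F x = 0) -> sconj F = F.
Proof. by move=> h; apply: sfun_ext => x Dx //=; rewrite h ?oppr0. Qed.

Definition shalf := scst (2^-1).
Lemma shalfE : shalf * 2%:R = 1.
Proof.
rewrite mulr_natr mulr2n; apply: sfun_ext => x Dx //=; rewrite ?cutE //=; last by rewrite addr0.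
by have := splitr (1 : R); rewrite div1r => <-.
Qed.
End SmoothFunctions.

Arguments os {R} _ _.
Arguments os_open {R} _.

Section BigTuples.
Variables (V : nmodType) (T : finType).
Lemma big_tuple_cons r (F : seq T -> V) :
  \sum_(s : r.+1.-tuple T) F s = \sum_(i : T) \sum_(s : r.-tuple T) F (i :: s).
Proof.
rewrite pair_big /= (reindex (fun p : T * r.-tuple T => [tuple of p.1 :: p.2])) //=.
exists (fun s : r.+1.-tuple T => (thead s, [tuple of behead s])) => [[i s] _|s _] /=.
  by congr (_, _); apply/val_inj.
by rewrite -tuple_eta.
Qed.
Lemma big_tuple_nil (F : seq T -> V) : \sum_(s : 0.-tuple T) F s = F [::].
Proof.
by rewrite (big_pred1 [tuple]) // => s; apply/esym/eqP/val_inj; rewrite (tuple0 s).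
Qed.
End BigTuples.

Lemma tensor_sum_nsq (R : comPzRingType) n (g : 'M[R]_2) r (T U : seq 'I_2 -> 'rV[R]_n) :
  \sum_(s : r.-tuple 'I_2) \sum_(t : r.-tuple 'I_2)
    (\prod_(a < r) g (tnth s a) (tnth t a)) * adot (T s) (U t) = nsq g r T U.
Proof.
elim: r T U => [|r IH] T U.
  rewrite (eq_bigr (fun s : 0.-tuple 'I_2 => \sum_(t : 0.-tuple 'I_2) adot (T s) (U t))).
    by rewrite (big_tuple_nil (fun s => \sum_(t : 0.-tuple 'I_2) adot (T s) (U t)))
      (big_tuple_nil (fun t => adot (T [::]) (U t))).
  by move=> s _; apply: eq_bigr => t _; rewrite big_ord0 mul1r.
pose p (r : nat) (s t : seq 'I_2) : R := \prod_(a < r) g (nth ord0 s a) (nth ord0 t a).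
have E (r' : nat) (T' U' : seq 'I_2 -> 'rV[R]_n) : \sum_(s : r'.-tuple 'I_2) \sum_(t : r'.-tuple 'I_2)
    (\prod_(a < r') g (tnth s a) (tnth t a)) * adot (T' s) (U' t) =
   \sum_(s : r'.-tuple 'I_2) \sum_(t : r'.-tuple 'I_2) p r' s t * adot (T' s) (U' t).
  apply: eq_bigr => s _; apply: eq_bigr => t _; congr (_ * _).
  by apply: eq_bigr => a _; rewrite !(tnth_nth ord0).
rewrite E (@big_tuple_cons _ _ r (fun s => \sum_(t : r.+1.-tuple 'I_2) p r.+1 s t * adot (T s) (U t))).
apply: eq_bigr => i _.
under eq_bigr => s _ do rewrite (@big_tuple_cons _ _ r (fun t => p r.+1 (i :: s) t * adot (T (i :: s)) (U t))).
rewrite exchange_big; apply: eq_bigr => j _.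
transitivity (g i j * nsq g r (fun s => T (i :: s)) (fun s => U (j :: s))); last by [].
rewrite -IH (E r (fun s => T (i :: s)) (fun s => U (j :: s))) mulr_sumr; apply: eq_bigr => s _.
rewrite mulr_sumr; apply: eq_bigr => t _.
by rewrite mulrA; congr (_ * _); rewrite /p big_ord_recl.
Qed.

(** * Coordinate expressions as elements of the ring of functions *)

Section Link.
#[local] Opaque derive.
Variables (R : realType) (n : nat).
Local Notation P := (R * R)%type.
Local Notation cv := (coord_vec R).
Local Notation pds i F := (@pd R R^o i (F : P -> R^o)).
Variables (D : oset R) (tau : P -> P) (Der : 'I_2 -> sfun D -> sfun D).
Local Notation Dm := (os D).

Definition rep (G : P -> R) (F : sfun D) : Prop :=
  forall x, Dm x -> sre F x = G (tau x) /\ sim F x = 0.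

(** The derivations [Der] act on pulled-back functions as the partial derivatives of the target
    coordinates. The cases used are the identity with [spd] and a transition map, which lets two
    coordinate systems be compared inside one ring. *)
Record link : Prop := Link {
  lk_der : forall a, derivation (Der a);
  lk_diff : forall G F a x, rep G F -> Dm x -> derivable (G : P -> R^o) (tau x) (cv a);
  lk_rep : forall G F a, rep G F -> rep (pds a G) (Der a F) }.

Hypothesis lk : link.

Lemma rep_re G F x : rep G F -> Dm x -> sre F x = G (tau x).
Proof. by move=> h /h []. Qed.
Lemma rep_im G F x : rep G F -> Dm x -> sim F x = 0.
Proof. by move=> h /h []. Qed.
Lemma repD G G' F F' : rep G F -> rep G' F' -> rep (fun y => G y + G' y) (F + F').
Proof. by move=> h h' x Dx; rewrite sreD simD (rep_re h) // (rep_re h') // (rep_im h) // (rep_im h') // addr0. Qed.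
Lemma repN G F : rep G F -> rep (fun y => - G y) (- F).
Proof. by move=> h x Dx; rewrite sreN simN (rep_re h) // (rep_im h) // oppr0. Qed.
Lemma repB G G' F F' : rep G F -> rep G' F' -> rep (fun y => G y - G' y) (F - F').
Proof. by move=> h h'; apply: repD => //; exact: repN. Qed.
Lemma repM G G' F F' : rep G F -> rep G' F' -> rep (fun y => G y * G' y) (F * F').
Proof.
move=> h h' x Dx; rewrite sreM simM (rep_re h) // (rep_re h') // (rep_im h) // (rep_im h') //.
by rewrite !mulr0 !mul0r subr0 addr0.
Qed.
Lemma rep0 : rep (fun=> 0) 0.
Proof. by move=> x Dx; rewrite sre0 sim0. Qed.
Lemma rep1 : rep (fun=> 1) 1.
Proof. by move=> x Dx; rewrite sre1. Qed.
Lemma rep_half : rep (fun=> 2^-1) (shalf D).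
Proof. by move=> x Dx; split=> //=; rewrite cutE. Qed.
Lemma rep_sum (I : Type) (r : seq I) (G : I -> P -> R) (F : I -> sfun D) :
  (forall i, rep (G i) (F i)) ->
  rep (fun y => \sum_(i <- r) G i y) (\sum_(i <- r) F i).
Proof.
move=> h; elim: r => [|i r IH].
  by rewrite big_nil => x Dx; rewrite big_nil sre0 sim0.
by rewrite big_cons => x Dx; rewrite big_cons; exact: (repD (h i) IH).
Qed.
Lemma eq_rep G G' F : (forall x, Dm x -> G (tau x) = G' (tau x)) -> rep G F -> rep G' F.
Proof. by move=> e h x Dx; rewrite -e //; exact: h. Qed.

Definition repv (V : P -> 'rV[R]_n.+1) (Y : 'rV[sfun D]_n.+1) : Prop :=
  forall j, rep (fun y => V y ord0 j) (Y ord0 j).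

Lemma eq_repv V V' Y : (forall x, Dm x -> V (tau x) = V' (tau x)) -> repv V Y -> repv V' Y.
Proof. by move=> e h j; apply: eq_rep (h j) => x Dx; rewrite e. Qed.
Lemma repvD V V' Y Y' : repv V Y -> repv V' Y' -> repv (fun y => V y + V' y) (Y + Y').
Proof.
move=> h h' j; rewrite mxE; apply: eq_rep (repD (h j) (h' j)) => x _.
by rewrite mxE.
Qed.
Lemma repvZ G V F Y : rep G F -> repv V Y -> repv (fun y => G y *: V y) (F *: Y).
Proof.
move=> h h' j; rewrite mxE; apply: eq_rep (repM h (h' j)) => x _.
by rewrite mxE.
Qed.
Lemma repvN V Y : repv V Y -> repv (fun y => - V y) (- Y).
Proof.
move=> h j; rewrite mxE; apply: eq_rep (repN (h j)) => x _.
by rewrite mxE.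
Qed.
Lemma repvB V V' Y Y' : repv V Y -> repv V' Y' -> repv (fun y => V y - V' y) (Y - Y').
Proof. by move=> h h'; apply: repvD => //; exact: repvN. Qed.
Lemma repv0 : repv (fun=> 0) 0.
Proof. by move=> j; rewrite !mxE; exact: rep0. Qed.
Lemma repv_sum (I : Type) (r : seq I) (V : I -> P -> 'rV[R]_n.+1) (Y : I -> 'rV[sfun D]_n.+1) :
  (forall i, repv (V i) (Y i)) ->
  repv (fun y => \sum_(i <- r) V i y) (\sum_(i <- r) Y i).
Proof.
move=> h; elim: r => [|i r IH].
  by rewrite big_nil; apply: eq_repv repv0 => x _; rewrite big_nil.
by rewrite big_cons; apply: eq_repv (repvD (h i) IH) => x _; rewrite big_cons.
Qed.
Lemma rep_dot V V' Y Y' : repv V Y -> repv V' Y' ->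
  rep (fun y => dot (V y) (V' y)) (adot Y Y').
Proof. by move=> h h'; apply: rep_sum => j; apply: repM. Qed.

Lemma repv_pd a V Y : repv V Y -> repv (pd a V) (dv (Der a) Y).
Proof.
move=> h j; rewrite mxE; apply: eq_rep (lk_rep lk a (h j)) => x Dx.
have dV : derivable V (tau x) (cv a).
  apply/derivable_mxP => i k; have -> : i = ord0 by exact: ord1.
  exact: (lk_diff lk (h k) Dx).
by rewrite [in RHS]/pd (derive_mx dV) mxE.
Qed.

Variables (X : P -> 'rV[R]_n.+1) (Y : 'rV[sfun D]_n.+1).
Variable gi : 'M[sfun D]_2.
Hypothesis XY : repv X Y.
Hypothesis fh : frame (shalf D) Y Der gi.
Hypothesis gi_real : forall i j x, Dm x -> sim (gi i j) x = 0.
Hypothesis Ycomm : forall i j, dv (Der i) (fr Y Der j) = dv (Der j) (fr Y Der i).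

Lemma repv_fr i : repv (pd i X) (fr Y Der i).
Proof. exact: repv_pd. Qed.

Lemma rep_gm i j : rep (fun y => metric X y i j) (gm Y Der i j).
Proof.
rewrite mxE; apply: eq_rep (rep_dot (repv_fr i) (repv_fr j)) => x _.
by rewrite mxE.
Qed.

Lemma rep_gi i j : rep (fun y => imetric X y i j) (gi i j).
Proof.
move=> x Dx; split; last exact: gi_real.
pose G : 'M[R]_2 := \matrix_(i, j) sre (gi i j) x.
have GK : G *m metric X (tau x) = 1%:M.
  apply/matrixP => k l; have /matrixP/(_ k l) := fr_gi fh; rewrite !mxE => E.
  have := congr1 (fun F => sre F x) E; rewrite /= sum_I2 sreD !sreM !gi_real // !mul0r !subr0.
  rewrite !(rep_re (rep_gm _ _) Dx) sum_I2 !mxE => ->.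
  by case: (k == l); rewrite ?sre1 ?sre0.
have U : metric X (tau x) \in unitmx by case: (mulmx1_unit GK).
suff -> : imetric X (tau x) = G by rewrite mxE.
by rewrite /imetric -[LHS]mul1mx -GK -mulmxA (mulmxV U) mulmx1.
Qed.

(** Koszul's formula: since mixed derivatives of [Y] agree, half the usual combination of
    derivatives of the metric is the product of the derivative of one frame vector with another. *)
Lemma rep_chr k i j : rep (christoffel X k i j) (chr Y Der gi k i j).
Proof.
have hd := lk_der lk.
have -> : chr Y Der gi k i j = shalf D * \sum_l gi k l *
   (Der i (gm Y Der j l) + Der j (gm Y Der i l) - Der l (gm Y Der i j)).
  rewrite mulr_sumr; apply: eq_bigr => l _.
  rewrite !mxE !(der_adot (hd _)) (Ycomm l i) (Ycomm l j) (Ycomm j i).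
  have h2 := fr_half fh.
  rewrite (adotC (fr Y Der j) (dv (Der i) _)) (adotC (fr Y Der i) (dv (Der j) (fr Y Der l))).
  transitivity (shalf D * 2%:R * (gi k l * adot (dv (Der i) (fr Y Der j)) (fr Y Der l))).
    by rewrite h2 mul1r.
  by ring.
apply: repM; first exact: rep_half.
apply: rep_sum => l; apply: repM; first exact: rep_gi.
by apply: repB; [apply: repD|]; apply: (lk_rep lk); exact: rep_gm.
Qed.

Lemma repv_proj V W : repv V W ->
  repv (fun y => normal_proj X y (V y)) (nproj Y Der gi W).
Proof.
move=> h; apply: repvB; first apply: repvB => //.
  by apply: repvZ => //; exact: rep_dot.
apply: repv_sum => i; apply: repv_sum => j; apply: repvZ; last exact: repv_fr.
by apply: repM; [exact: rep_gi|apply: rep_dot => //; exact: repv_fr].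
Qed.

Lemma repv_ncov k V W : repv V W -> repv (normal_deriv X k V) (ncov Y Der gi k W).
Proof. by move=> h; apply: (repv_proj (V := pd k V)); exact: repv_pd. Qed.

Lemma repv_sff s : repv (second_ff X s) (sff Y Der gi s).
Proof. by apply: repv_ncov; exact: repv_fr. Qed.

Lemma repv_mcv : repv (mean_curv X) (mcv (shalf D) Y Der gi).
Proof.
apply: (repvZ (G := fun=> 2^-1)); first exact: rep_half.
apply: repv_sum => i; apply: repv_sum => j; apply: repvZ; first exact: rep_gi.
exact: repv_sff.
Qed.

Lemma rep_aC : rep (cconst X) (aC (shalf D) Y Der gi).
Proof. by apply: repD; [exact: rep1|apply: rep_dot; exact: repv_mcv]. Qed.

Definition rept (T : normal_tensor R n) (U : tens (sfun D) n.+1) : Prop :=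
  forall s, repv (T s) (U s).

Lemma rept_sff0 : rept (second_ff0 X) (sff0 (shalf D) Y Der gi).
Proof.
move=> s; apply: repvB; first exact: repv_sff.
by apply: repvZ; [exact: rep_gm|exact: repv_mcv].
Qed.

Lemma rept_corr k s T U : rept T U ->
  repv (fun y => \sum_(a < size s) \sum_(l < 2)
     christoffel X l k (nth ord0 s a) y *: T (set_nth ord0 s a l) y)
   (corr Y Der gi k s U).
Proof.
elim: s T U => [|i s IH] T U h /=.
  by apply: eq_repv repv0 => x _; rewrite big_ord0.
have h' : rept (fun s => T (i :: s)) (fun s => U (i :: s)) by move=> s'; exact: h.
apply: eq_repv (repvD (repv_sum _ (fun l => repvZ (rep_chr l k i) (h (l :: s)))) (IH _ _ h')) => x _.
by rewrite [RHS]big_ord_recl.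
Qed.

Lemma rept_cov T U : rept T U -> rept (cov_deriv X T) (covd Y Der gi U).
Proof.
move=> h [|k s] /=; first exact: repv0.
by apply: repvB; [apply: repv_ncov|exact: rept_corr].
Qed.

Lemma rep_nsq r T U T' U' : rept T U -> rept T' U' ->
  rep (fun y => nsq (imetric X y) r (T^~ y) (T'^~ y)) (nsq gi r U U').
Proof.
elim: r T U T' U' => [|r IH] T U T' U' h h' /=; first exact: rep_dot.
apply: rep_sum => i; apply: rep_sum => j; apply: repM; first exact: rep_gi.
by apply: (IH (fun s => T (i :: s)) _ (fun s => T' (j :: s))) => s; [exact: h|exact: h'].
Qed.

Lemma rep_norm r T U : rept T U -> rep (tensor_norm_sq X r T) (nsq gi r U U).
Proof.
move=> h; apply: eq_rep (rep_nsq r h h) => x _.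
by rewrite -tensor_sum_nsq.
Qed.

Lemma rep_aS : rep (Stilde X) (aS (shalf D) Y Der gi).
Proof. exact: rep_norm rept_sff0. Qed.

Lemma rep_aB m : rep (Btilde X m) (aB (shalf D) Y Der gi m).
Proof.
apply: rep_norm; elim: m => [|m IH]; [exact: rept_sff0|exact: rept_cov].
Qed.

Lemma rep_agrad u U w W : rep u U -> rep w W ->
  rep (fun y => \sum_(i < 2) \sum_(j < 2)
    imetric X y i j * (pds i u y * pds j w y)) (agrad Der gi U W).
Proof.
move=> h h'; apply: rep_sum => i; apply: rep_sum => j; apply: repM.
  exact: rep_gi.
by apply: repM; apply: (lk_rep lk).
Qed.

Lemma rep_alap u U : rep u U -> rep (laplacian X u) (alap Y Der gi U).
Proof.
move=> h; apply: rep_sum => i; apply: rep_sum => j; apply: repM.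
  exact: rep_gi.
apply: repB.
  by apply: (lk_rep lk); apply: (lk_rep lk).
apply: rep_sum => k; apply: repM; first exact: rep_chr.
exact: (lk_rep lk).
Qed.

Lemma rep_riem l k i j : rep (riemann X l k i j) (riem Y Der gi l k i j).
Proof.
apply: repD; first by apply: repB; apply: (lk_rep lk); exact: rep_chr.
by apply: rep_sum => m; apply: repB; apply: repM; exact: rep_chr.
Qed.

End Link.

Section SmoothOn.
Variable R : realType.
Local Notation P := (R * R)%type.
Local Notation cv := (coord_vec R).
Local Notation pds i F := (@pd R R^o i (F : P -> R^o)).

(** Vector-valued smoothness is reduced to scalar functions by a continuous [pr] that commutes with
    directional derivatives; it is applied to the entries of a row vector and to the two coordinates
    of the plane. *)
Lemma smooth_on_Csm (V : normedModType R) (pr : V -> R^o) (D : set P) (F : P -> V) :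
  open D -> continuous pr ->
  (forall (G : P -> V) x v, derivable G x v -> is_derive x v (pr \o G) (pr ('D_v G x))) ->
  smooth_on D F -> Csm D (pr \o F).
Proof.
move=> oD prc prd sF k; elim: k F sF => [|k IH] F sF.
  split=> // x Dx; apply: (@continuous_comp _ _ _ F pr); last exact: prc.
  by have [] := sF [::] x Dx.
split=> [x Dx|i].
  apply: (@continuous_comp _ _ _ F pr); last exact: prc.
  by have [] := sF [::] x Dx.
have dF x (Dx : D x) : derivable F x (cv i) by have [_] := sF [::] x Dx; apply.
split=> [x Dx|]; first by have [] := prd _ _ _ (dF x Dx).
have sG : smooth_on D (pd i F).
  by move=> s x Dx; have := sF (rcons s i) x Dx; rewrite foldr_rcons.
apply: Ck_congr (IH _ sG) => // x Dx.
by have [_ E] := prd _ _ _ (dF x Dx); rewrite /pd E.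
Qed.

#[local] Opaque derive.

Lemma smooth_on_entry n (D : set P) (F : P -> 'rV[R]_n) j : open D ->
  smooth_on D F -> Csm D (fun x => F x ord0 j).
Proof.
move=> oD; apply: (@smooth_on_Csm _ (fun v : 'rV[R]_n => v ord0 j : R^o)) => //.
  by move=> v; apply: coord_continuous.
move=> G x v dG; apply: DeriveDef.
  by have := (derivable_mxP G x v).1 dG; apply.
by rewrite (derive_mx dG) mxE.
Qed.

Lemma is_derive_proj (V : normedModType R) (pr : {linear V -> R^o}) :
  continuous pr -> forall (G : P -> V) x v, derivable G x v ->
  is_derive x v (pr \o G) (pr ('D_v G x)).
Proof.
move=> prc G x v dG.
have H : (fun h => h^-1 *: (((pr \o G) \o shift x) (h *: v) - (pr \o G) x)) @ 0^' --> pr ('D_v G x).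
  have -> : (fun h => h^-1 *: (((pr \o G) \o shift x) (h *: v) - (pr \o G) x)) =
     pr \o (fun h => h^-1 *: ((G \o shift x) (h *: v) - G x)).
    apply/funext => h; rewrite [RHS]/= [RHS]linearZ_LR; congr (_ *: _).
    exact: (esym (linearB pr _ _)).
  by apply: cvg_comp dG _; exact: prc.
by apply: DeriveDef; [exact: cvgP H|exact: cvg_lim H].
Qed.

Lemma smooth_on_fst (D : set P) (F : P -> P) : open D ->
  smooth_on D F -> Csm D (fun x => (F x).1).
Proof.
move=> oD.
have L : linear (fun x : P => x.1 : R^o) by [].
pose LL : {linear P -> R^o} := HB.pack (fun x : P => x.1 : R^o) (GRing.isLinear.Build _ _ _ _ _ L).
apply: (@smooth_on_Csm _ LL) => //; first by move=> v; exact: cvg_fst.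
by apply: is_derive_proj => v; exact: cvg_fst.
Qed.
Lemma smooth_on_snd (D : set P) (F : P -> P) : open D ->
  smooth_on D F -> Csm D (fun x => (F x).2).
Proof.
move=> oD.
have L : linear (fun x : P => x.2 : R^o) by [].
pose LL : {linear P -> R^o} := HB.pack (fun x : P => x.2 : R^o) (GRing.isLinear.Build _ _ _ _ _ L).
apply: (@smooth_on_Csm _ LL) => //; first by move=> v; exact: cvg_snd.
by apply: is_derive_proj => v; exact: cvg_snd.
Qed.
End SmoothOn.

Section LinkId.
Variables (R : realType) (D : oset R).
Local Notation P := (R * R)%type.
Local Notation cv := (coord_vec R).
Local Notation pds i F := (@pd R R^o i (F : P -> R^o)).
#[local] Opaque derive.

Lemma link_id : link id (@spd R D).
Proof.
split; first exact: spd_der.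
- move=> G F a x h Dx; apply: near_eq_derivable (Ck_derivable (sre_sm F 1%N) Dx).
  have nD : nbhs x (os D) by apply: open_nbhs_nbhs; split=> //; exact: os_open.
  by apply: filterS nD => y Dy; exact: (rep_re h Dy).
- move=> G F a h x Dx; split.
    rewrite /= cutE //; apply: (pd_congr a (os_open D) Dx) => y Dy.
    exact: (rep_re h Dy).
  rewrite /= cutE // (pd_congr (G := cst 0) a (os_open D) Dx) /pd ?derive_cst //.
  by move=> y Dy; rewrite (rep_im h).
Qed.
End LinkId.

(** * Transition maps between coordinates *)

Section LinkChange.
Variables (R : realType) (D D' : oset R).
Local Notation P := (R * R)%type.
Local Notation cv := (coord_vec R).
Local Notation pds i F := (@pd R R^o i (F : P -> R^o)).
Variables (tau sig : P -> P).
Hypothesis tD : forall x, os D x -> os D' (tau x).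
Hypothesis sD : forall y, os D' y -> os D (sig y).
Hypothesis tauK : forall x, os D x -> sig (tau x) = x.
Hypothesis sigK : forall y, os D' y -> tau (sig y) = y.
Hypothesis t_sm : forall i, Csm (os D) (fun x => crd i (tau x)).
Hypothesis s_sm : forall i, Csm (os D') (fun x => crd i (sig x)).
#[local] Opaque derive.

Let t1 k : Ck k (os D) (fun x => (tau x).1). Proof. exact: (t_sm ord0 k). Qed.
Let t2 k : Ck k (os D) (fun x => (tau x).2). Proof. exact: (t_sm ord_max k). Qed.
Let s1 k : Ck k (os D') (fun x => (sig x).1). Proof. exact: (s_sm ord0 k). Qed.
Let s2 k : Ck k (os D') (fun x => (sig x).2). Proof. exact: (s_sm ord_max k). Qed.

Lemma chP_sm a i : Csm (os D) (fun x => pds a (fun y => crd i (sig y)) (tau x)).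
Proof.
move=> k; apply: (Ck_comp (os_open D') (os_open D) tD) => //.
exact: (Ck_pd a (s_sm i k.+1)).
Qed.
(** [chP] and [chQ] are the Jacobian matrices of the two transition maps, that of [sig] being taken
    at [tau x] so that both are functions on the same open set. [chD a] is then the coordinate field
    [a] of the target, written in source coordinates. *)
Definition chP : 'M[sfun D]_2 := \matrix_(a, i) smk (chP_sm a i).
Definition chQ : 'M[sfun D]_2 := \matrix_(i, a) smk (pd_sm i (t_sm a)).
Definition chD a (F : sfun D) : sfun D := \sum_i chP a i * spd i F.

Lemma chD_der a : derivation (chD a).
Proof.
split=> F G; rewrite /chD.
  rewrite -big_split; apply: eq_bigr => i _.
  by rewrite (derD (spd_der D i)) mulrDr.
rewrite mulr_suml mulr_sumr -big_split; apply: eq_bigr => i _ /=.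
by rewrite (derM (spd_der D i)); ring.
Qed.

Lemma chP_re a i x : os D x -> sre (chP a i) x = pds a (fun y => crd i (sig y)) (tau x).
Proof. by move=> Dx; rewrite mxE /= cutE. Qed.
Lemma chP_im a i x : sim (chP a i) x = 0.
Proof. by rewrite mxE. Qed.
Lemma chQ_re a i x : os D x -> sre (chQ i a) x = pds i (fun y => crd a (tau y)) x.
Proof. by move=> Dx; rewrite mxE /= cutE. Qed.
Lemma chQ_im a i x : sim (chQ i a) x = 0.
Proof. by rewrite mxE. Qed.

Lemma chQP : chQ *m chP = 1%:M.
Proof.
apply/matrixP => i j; rewrite !mxE; apply: sfun_ext => x Dx; last first.
  rewrite sum_I2 simD !simM !chP_im !chQ_im !mulr0 !mul0r !addr0.
  by case: (i == j).
rewrite sum_I2 sreD !sreM !chP_im !chQ_im !mulr0 !subr0 !chQ_re // !chP_re //.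
have [_ E] := pd_comp i (os_open D') (os_open D) Dx (tD Dx) (s_sm j 1%N) (t1 1%N) (t2 1%N).
have E2 : pds i (fun y => crd j (sig (tau y))) x = pds i (crd j) x.
  by apply: (pd_congr i (os_open D) Dx) => y Dy; rewrite tauK.
have [_ E3] := is_derive_crd j i x.
have -> : sre (((i == j)%:R : sfun D)) x = (j == i)%:R.
  by rewrite [j == i]eq_sym; case: (i == j); [exact: (sre1 Dx)|exact: sre0].
rewrite -E3 -/(pd _ _ _) -E2 E.
by congr (_ + _); exact: mulrC.
Qed.

Lemma chD_re (G : P -> R) (F : sfun D) a x : rep tau G F -> os D x ->
  derivable (G : P -> R^o) (tau x) (cv a) /\
  pds a G (tau x) = \sum_i sre (chP a i) x * pds i (sre F) x.
Proof.
move=> h Dx.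
have E y : os D' y -> (sre F (sig y) : R^o) = G y.
  by move=> Dy; rewrite (rep_re h (sD Dy)) sigK.
have Dsx : os D (sig (tau x)) by rewrite tauK.
have [d e] := pd_comp a (os_open D) (os_open D') (tD Dx) Dsx (sre_sm F 1%N) (s1 1%N) (s2 1%N).
split.
  apply: near_eq_derivable d.
  have nD : nbhs (tau x) (os D') by apply: open_nbhs_nbhs; split; [exact: os_open|exact: tD].
  by apply: filterS nD => y Dy; exact: (E y Dy).
rewrite -(pd_congr a (os_open D') (tD Dx) E) e tauK // sum_I2 !chP_re //.
by congr (_ + _); exact: mulrC.
Qed.

Lemma link_change : link tau chD.
Proof.
split; first exact: chD_der.
- by move=> G F a x h Dx; have [] := chD_re a h Dx.
- move=> G F a h x Dx; have [_ ->] := chD_re a h Dx.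
  have i0 i : sim (spd i F) x = 0.
    rewrite /= cutE // (pd_congr (G := cst 0) i (os_open D) Dx) /pd ?derive_cst //.
    by move=> y Dy; rewrite (rep_im h).
  have r i : sre (chP a i * spd i F) x = sre (chP a i) x * sre (spd i F) x.
    by rewrite sreM chP_im mul0r subr0.
  have m i : sim (chP a i * spd i F) x = 0.
    by rewrite simM chP_im i0 mulr0 mul0r addr0.
  rewrite /chD !sum_I2 sreD simD !r !m addr0; split; last exact: erefl.
  by congr (_ * _ + _ * _); exact: cutE.
Qed.
End LinkChange.

(** * The null frame of an immersion *)

Section DotReal.
Variables (R : realType) (n : nat).
Implicit Types u v : 'rV[R]_n.
Lemma dot_adot u v : dot u v = adot u v. Proof. by []. Qed.
Lemma dot_ge0 u : 0 <= dot u u.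
Proof. by apply: sumr_ge0 => i _; rewrite -expr2 sqr_ge0. Qed.
Lemma dot_eq0 u : dot u u = 0 -> u = 0.
Proof.
move=> h; apply/rowP => j; rewrite mxE; apply/eqP.
rewrite -sqrf_eq0 expr2; apply/eqP/(psumr_eq0P _ h) => // i _.
by rewrite -expr2 sqr_ge0.
Qed.
End DotReal.

Section Immersed.
Variables (R : realType) (n : nat) (D : oset R).
Local Notation P := (R * R)%type.
Local Notation cv := (coord_vec R).
Local Notation pds i F := (@pd R R^o i (F : P -> R^o)).
Local Notation i0 := (ord0 : 'I_2).
Local Notation i1 := (ord_max : 'I_2).
Variable X : P -> 'rV[R]_n.+1.
Hypothesis sX : smooth_on (os D) X.
Hypothesis X1 : forall x, os D x -> dot (X x) (X x) = 1.
Hypothesis rfX : forall x, os D x -> row_free (Defs.jacobian X x).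
#[local] Opaque derive spd.
Let oD := os_open D.
Let b01 : (i0 == i1) = false. Proof. by []. Qed.
Let b10 : (i1 == i0) = false. Proof. by []. Qed.

Definition imm : 'rV[sfun D]_n.+1 := \row_j smk (smooth_on_entry j oD sX).
Local Notation Y := imm.
Local Notation g := (gm Y (@spd R D)).

Lemma rep_imm : repv id X Y.
Proof. by move=> j x Dx; rewrite mxE /= cutE. Qed.

Lemma imm_gE i j x : os D x -> sre (g i j) x = metric X x i j.
Proof. exact: (rep_re (rep_gm (link_id D) rep_imm i j)). Qed.
Lemma imm_gim i j x : os D x -> sim (g i j) x = 0.
Proof. exact: (rep_im (rep_gm (link_id D) rep_imm i j)). Qed.

Lemma metricE i j x : metric X x i j = dot (pd i X x) (pd j X x).
Proof. by rewrite /metric mxE. Qed.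

Let mul_rows (U : 'I_2 -> 'rV[R]_n.+1) (a b : R) :
  (\row_i (if i == i0 then a else b)) *m (\matrix_(i, j) U i ord0 j) =
  a *: U i0 + b *: U i1.
Proof. by apply/rowP => j; rewrite !mxE sum_I2 !mxE. Qed.

Lemma jac_free x (a b : R) : os D x -> a *: pd i0 X x + b *: pd i1 X x = 0 ->
  a = 0 /\ b = 0.
Proof.
move=> Dx h; pose M : 'rV[R]_2 := \row_i (if i == i0 then a else b).
have E : M *m Defs.jacobian X x = 0.
  exact: (etrans (mul_rows (fun i => pd i X x) a b) h).
have := mulmx_free_eq0 M (rfX Dx); rewrite E eqxx => /esym/eqP M0.
have /rowP h0 := M0; have := h0 i0; have := h0 i1; rewrite !mxE /= => -> ->.
by [].
Qed.

Lemma g00_gt0 x : os D x -> 0 < metric X x i0 i0.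
Proof.
move=> Dx; rewrite metricE lt_def dot_ge0 andbT; apply/eqP => h.
have u0 := dot_eq0 h.
have [] := @jac_free x 1 0 Dx; first by rewrite u0 scaler0 scale0r addr0.
by move/eqP; rewrite oner_eq0.
Qed.

Let gram (u w : 'rV[R]_n.+1) (v := (- dot u w) *: u + dot u u *: w) :
  dot v v = dot u u * (dot u u * dot w w - dot u w ^+ 2).
Proof.
rewrite !dot_adot /v !(adotDl, adotDr, adotZl, adotZr) !dot_adot (adotC w u).
by ring.
Qed.

Definition mdet x : R := metric X x i0 i0 * metric X x i1 i1 - metric X x i0 i1 ^+ 2.

(** [v] is the second tangent vector made orthogonal to the first, up to the factor g00. Its squared
    length is g00 times the determinant, and it is nonzero because the differential is injective. *)
Lemma mdet_gt0 x : os D x -> 0 < mdet x.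
Proof.
move=> Dx; have g0 := g00_gt0 Dx.
pose v := (- metric X x i0 i1) *: pd i0 X x + metric X x i0 i0 *: pd i1 X x.
have v0 : dot v v = metric X x i0 i0 * mdet x.
  by rewrite /mdet /v !metricE; exact: gram.
have : dot v v != 0.
  apply/eqP => /dot_eq0 /(jac_free Dx) [_ e].
  by move: g0; rewrite e ltxx.
rewrite v0 mulf_eq0 negb_or => /andP[_ d0].
have := dot_ge0 v; rewrite v0 pmulr_rge0 // => d1.
by rewrite lt_def d0 d1.
Qed.

Definition sdet : sfun D := g i0 i0 * g i1 i1 - g i0 i1 ^+ 2.
Lemma sdet_re x : os D x -> sre sdet x = mdet x.
Proof.
move=> Dx; rewrite /sdet expr2 sreD sreN !sreM !imm_gim // !imm_gE //.
by rewrite !mul0r !subr0 /mdet expr2.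
Qed.
Lemma sdet_im x : os D x -> sim sdet x = 0.
Proof.
move=> Dx; rewrite /sdet expr2 simD simN !simM !imm_gim //.
by rewrite !mulr0 !mul0r !addr0 subr0.
Qed.

Lemma sarea_sm : Csm (os D) (fun x => Num.sqrt (sre sdet x) : R^o).
Proof.
move=> k; apply: Ck_sqrt => //; last exact: sre_sm.
by move=> x Dx; rewrite sdet_re // mdet_gt0.
Qed.
Definition sarea : sfun D := smk sarea_sm.

Lemma sarea_re x : os D x -> sre sarea x = Num.sqrt (mdet x).
Proof. by move=> Dx; rewrite -sdet_re //; exact: cutE. Qed.
Lemma sarea_im x : sim sarea x = 0. Proof. by []. Qed.

Lemma sarea_gt0 x : os D x -> 0 < sre sarea x.
Proof. by move=> Dx; rewrite sarea_re // sqrtr_gt0 mdet_gt0. Qed.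

Lemma sinv_sm (F : sfun D) (h : forall x, os D x -> 0 < sre F x) :
  Csm (os D) (fun x => (sre F x)^-1 : R^o).
Proof.
move=> k; apply: CkV => //; last exact: sre_sm.
by move=> x Dx; rewrite gt_eqF // h.
Qed.

Definition sbeta : sfun D := smk (sinv_sm sarea_gt0).

Lemma sbeta_re x : os D x -> sre sbeta x = (sre sarea x)^-1.
Proof. by move=> Dx; exact: cutE. Qed.
Lemma sbeta_im x : sim sbeta x = 0. Proof. by []. Qed.

Lemma sarea_sq : sarea * sarea = sdet.
Proof.
apply: sfun_ext => x Dx.
  rewrite sreM sarea_im mul0r subr0 sarea_re // -expr2 sqr_sqrtr ?sdet_re //.
  by rewrite ltW // mdet_gt0.
by rewrite simM sdet_im // sarea_im mulr0 mul0r addr0.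
Qed.

Lemma sbetaK : sbeta * sarea = 1.
Proof.
apply: sfun_ext => x Dx; last by rewrite simM sarea_im sbeta_im mulr0 mul0r addr0.
rewrite sreM (sre1 Dx) sbeta_im mul0r subr0 sbeta_re // mulVf // gt_eqF //.
exact: sarea_gt0.
Qed.

Lemma sbeta_sq : sbeta * sbeta * sdet = 1.
Proof. by rewrite -sarea_sq mulrACA sbetaK mul1r. Qed.

(** The adjugate matrix over the determinant; the square of [sbeta] is the inverse of the
    determinant. *)
Definition sgi : 'M[sfun D]_2 := \matrix_(i, j)
  (sbeta * sbeta * (if i == j then g (if i == i0 then i1 else i0) (if i == i0 then i1 else i0)
   else - g i0 i1)).

Lemma sgiK : sgi *m g = 1%:M.
Proof.
have gs := gm_sym Y (@spd R D) i1 i0.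
have b2 := sbeta_sq; rewrite /sdet expr2 in b2.
apply/matrixP => i j; rewrite [LHS]mxE sum_I2 [(1%:M) i j]mxE.
have -> : sgi i i0 = sbeta * sbeta * (if i == i0 then g i1 i1 else - g i0 i1).
  by rewrite mxE; have [->|->] := I2P i.
have -> : sgi i i1 = sbeta * sbeta * (if i == i0 then - g i0 i1 else g i0 i0).
  by rewrite mxE; have [->|->] := I2P i.
have [->|->] := I2P i; have [->|->] := I2P j; rewrite ?eqxx ?b01 ?b10 ?mulr1n ?mulr0n ?gs.
- by rewrite -b2; ring.
- by ring.
- by ring.
- by rewrite -b2; ring.
Qed.

Lemma sgi_real i j x : os D x -> sim (sgi i j) x = 0.
Proof.
move=> Dx; rewrite mxE simM [sim (sbeta * sbeta) x]simM sbeta_im mulr0 mul0r addr0 mul0r addr0.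
by case: (i == j); rewrite ?simN imm_gim ?oppr0 ?mulr0.
Qed.

Lemma spd_comm2 i j (F : sfun D) : spd i (spd j F) = spd j (spd i F).
Proof.
have [->|->] := I2P i; have [->|->] := I2P j; [exact: erefl|exact: spd_comm|
  exact: (esym (spd_comm F))|exact: erefl].
Qed.

Lemma imm_comm i j : dv (spd i) (fr Y (@spd R D) j) = dv (spd j) (fr Y (@spd R D) i).
Proof.
apply/rowP => k; rewrite [LHS]mxE [RHS]mxE ![fr _ _ _ _ _]mxE.
exact: spd_comm2.
Qed.

Lemma imm_XX : adot Y Y = 1.
Proof.
have h := rep_dot rep_imm rep_imm; apply: sfun_ext => x Dx.
  by rewrite (rep_re h Dx) X1 // sre1.
by rewrite (rep_im h Dx).
Qed.

Lemma imm_frame : frame (shalf D) Y (@spd R D) sgi.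
Proof.
split.
- exact: spd_der.
- exact: shalfE.
- exact: imm_XX.
- exact: sgiK.
- move=> i j x; rewrite spd_comm2 subrr big1 // => k _.
  by rewrite /chr imm_comm subrr mul0r.
Qed.

Definition sI : sfun D.
Proof.
by apply: (@SFun R D (cst 0) (cut D (cst 1))); [exact: csm0|apply: cut_sm; exact: csm_cst|
  |exact: cut_off].
Defined.

Lemma sI2 : sI * sI = -1.
Proof.
apply: sfun_ext => x Dx.
  by rewrite sreM sreN (sre1 Dx) /= cutE // mul0r mul1r sub0r.
by rewrite simM simN /= mul0r mulr0 addr0 oppr0.
Qed.

Lemma salpha_sm : Csm (os D) (fun x => (Num.sqrt (2 * sre (g i0 i0) x))^-1 : R^o).
Proof.
have p x : os D x -> 0 < 2 * sre (g i0 i0) x.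
  by move=> Dx; rewrite mulr_gt0 // imm_gE // g00_gt0.
move=> k; apply: CkV => //; first by move=> x Dx; rewrite gt_eqF // sqrtr_gt0 p.
apply: Ck_sqrt => //; apply: CkM => //; [exact: Ck_cst|exact: sre_sm].
Qed.
Definition salpha : sfun D := smk salpha_sm.
Lemma salphaE : 2%:R * (salpha * salpha) * g i0 i0 = 1.
Proof.
rewrite mulr_natl mulr2n; apply: sfun_ext => x Dx.
  rewrite sreM imm_gim // mulr0 subr0 sreD !sreM (sre1 Dx) /= !cutE // !mul0r !subr0.
  rewrite -mulr2n -mulr_natl imm_gE // -expr2 exprVn sqr_sqrtr; last first.
    by rewrite mulr_ge0 // ltW // g00_gt0.
  have := g00_gt0 Dx; move: (metric X x i0 i0) => a a0.
  by rewrite mulr1 -[_^-1 *+ 2]mulr_natl invfM mulrA divff ?mul1r ?mulVf ?gt_eqF ?pnatr_eq0.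
by rewrite simM imm_gim // simD !simM /= !mulr0 !mul0r !addr0 mul0r add0r.
Qed.

(** Gram-Schmidt turns the coordinate fields into an orthonormal pair e1, e2; the rows are (e1 - i
    e2) / sqrt 2 and its conjugate. Here [salpha] is 1 / sqrt (2 g00) and [sbeta] is 1 / sqrt (det
    g). *)
Definition nP : 'M[sfun D]_2 := \matrix_(a, i)
  (if i == i0 then salpha + (if a == i0 then 1 else -1) * sI * salpha * sbeta * g i0 i1
   else - (if a == i0 then 1 else -1) * sI * salpha * sbeta * g i0 i0).
Definition nQ : 'M[sfun D]_2 := \matrix_(i, a)
  (- sI * sarea * (if i == a then nP (if i == i0 then i1 else i0) (if i == i0 then i1 else i0)
   else - nP i a)).
Definition nD a (F : sfun D) : sfun D := \sum_i nP a i * spd i F.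

Lemma nQP : nQ *m nP = 1%:M.
Proof.
have E00 : nP i0 i0 = salpha + sI * salpha * sbeta * g i0 i1 by rewrite mxE /= mul1r.
have E01 : nP i0 i1 = - sI * salpha * sbeta * g i0 i0 by rewrite mxE /= mulN1r.
have E10 : nP i1 i0 = salpha - sI * salpha * sbeta * g i0 i1 by rewrite mxE /= mulN1r !mulNr.
have E11 : nP i1 i1 = sI * salpha * sbeta * g i0 i0 by rewrite mxE /= opprK mul1r.
have dt : - sI * sarea * (nP i0 i0 * nP i1 i1 - nP i0 i1 * nP i1 i0) = 1.
  rewrite E00 E01 E10 E11.
  transitivity (- (sI * sI) * (sbeta * sarea) * (2%:R * (salpha * salpha) * g i0 i0)).
    by ring.
  by rewrite sI2 sbetaK salphaE opprK !mulr1.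
apply/matrixP => i j; rewrite [LHS]mxE sum_I2 [(1%:M) i j]mxE.
have F0 : nQ i i0 = - sI * sarea * (if i == i0 then nP i1 i1 else - nP i1 i0).
  by rewrite mxE; have [->|->] := I2P i.
have F1 : nQ i i1 = - sI * sarea * (if i == i0 then - nP i0 i1 else nP i0 i0).
  by rewrite mxE; have [->|->] := I2P i.
rewrite F0 F1 {F0 F1}; have [->|->] := I2P i; have [->|->] := I2P j;
  rewrite ?eqxx ?b01 ?b10 ?mulr1n ?mulr0n -?dt; ring.
Qed.

Lemma n_gm : gm Y nD = swapmx (sfun D).
Proof.
have E00 : nP i0 i0 = salpha + sI * salpha * sbeta * g i0 i1 by rewrite mxE /= mul1r.
have E01 : nP i0 i1 = - sI * salpha * sbeta * g i0 i0 by rewrite mxE /= mulN1r.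
have E10 : nP i1 i0 = salpha - sI * salpha * sbeta * g i0 i1 by rewrite mxE /= mulN1r !mulNr.
have E11 : nP i1 i1 = sI * salpha * sbeta * g i0 i0 by rewrite mxE /= opprK mul1r.
have gs := gm_sym Y (@spd R D) i1 i0.
rewrite (fc_gm Y (D := @spd R D) (P := nP)) //.
have b2 := sbeta_sq; rewrite /sdet expr2 in b2.
have a2 := salphaE.
pose w := (salpha * salpha) * g i0 i0.
have w2 : 2%:R * w = 1 by rewrite /w mulrA.
(* Isotropy of both rows at once: the computation uses only e * e = -1, which holds for [sI] and for
   its opposite. *)
have diag (e : sfun D) : e * e = -1 ->
   (salpha + e * salpha * sbeta * g i0 i1) * (salpha + e * salpha * sbeta * g i0 i1) * g i0 i0
   - 2%:R * (salpha + e * salpha * sbeta * g i0 i1) * (e * salpha * sbeta * g i0 i0) * g i0 i1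
   + (e * salpha * sbeta * g i0 i0) * (e * salpha * sbeta * g i0 i0) * g i1 i1 = 0.
  move=> e2.
  transitivity (w * (1 + (e * e) * (sbeta * sbeta * (g i0 i0 * g i1 i1 - g i0 i1 * g i0 i1)))).
    by rewrite /w; ring.
  by rewrite e2 b2 mulr1 subrr mulr0.
have off : (salpha + sI * salpha * sbeta * g i0 i1) * (salpha - sI * salpha * sbeta * g i0 i1) * g i0 i0
   + ((salpha + sI * salpha * sbeta * g i0 i1) * (sI * salpha * sbeta * g i0 i0)
      - (sI * salpha * sbeta * g i0 i0) * (salpha - sI * salpha * sbeta * g i0 i1)) * g i0 i1
   - (sI * salpha * sbeta * g i0 i0) * (sI * salpha * sbeta * g i0 i0) * g i1 i1 = 1.
  transitivity (w * (1 - (sI * sI) * (sbeta * sbeta * (g i0 i0 * g i1 i1 - g i0 i1 * g i0 i1)))).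
    by rewrite /w; ring.
  by rewrite sI2 b2 mulr1 opprK -[1 + 1]/(2%:R) mulrC.
have d1 := diag sI sI2.
have d2 := diag (- sI); rewrite mulrNN sI2 in d2; have {}d2 := d2 erefl.
apply/matrixP => i j; rewrite [LHS]mxE sum_I2 [(_^T) _ _]mxE [(_^T) _ _]mxE.
rewrite ![(nP *m _) _ _]mxE !sum_I2 gs [swapmx _ _ _]mxE.
have [->|->] := I2P i; have [->|->] := I2P j; rewrite ?eqxx ?b01 ?b10 ?mulr1n ?mulr0n
  ?E00 ?E01 ?E10 ?E11.
- by rewrite -d1; ring.
- by rewrite -off; ring.
- by rewrite -off; ring.
- by rewrite -d2; ring.
Qed.

Lemma swap2 : swapmx (sfun D) *m swapmx (sfun D) = 1%:M.
Proof.
apply/matrixP => i j; rewrite !mxE sum_I2 !mxE.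
by have [->|->] := I2P i; have [->|->] := I2P j; rewrite /=; ring.
Qed.

Lemma n_giK : swapmx (sfun D) *m gm Y nD = 1%:M.
Proof. by rewrite n_gm swap2. Qed.

Lemma n_nullframe : nullframe (shalf D) Y (nD i0) (nD i1).
Proof. exact: frame_null (fc_frame imm_frame (fun=> fun=> erefl) nQP n_giK). Qed.

Lemma n_pairD a (x : sfun D) : pairD (nD i0) (nD i1) a x = \sum_i nP a i * spd i x.
Proof. by rewrite /pairD; have [->|->] := I2P a. Qed.

Lemma sconj_I : sconj sI = - sI.
Proof. by apply: sfun_ext => x Dx //=; rewrite oppr0. Qed.

Lemma sconj_nP i : sconj (nP i0 i) = nP i1 i.
Proof.
have r (f : P -> R^o) (h : Csm (os D) f) : sconj (smk h) = smk h.
  by apply: sconj_real.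
have rg k l : sconj (g k l) = g k l by apply: sconj_real => x; exact: imm_gim.
rewrite ![nP _ _]mxE /=; case: (i == i0).
  by rewrite sconjD !sconjM sconj_I !r rg ?mul1r ?mulN1r.
by rewrite !(sconjM, sconjN) sconj_I !r rg opprK; rewrite -[smk (csm_cst D 1)]/(1 : sfun D) mulN1r opprK mul1r.
Qed.

Lemma sconj_nD (x : sfun D) : sconj (nD i0 x) = nD i1 (sconj x).
Proof. by rewrite /nD !sum_I2 sconjD !sconjM !sconj_nP !sconj_spd. Qed.

Lemma sconj_Y j : sconj (Y ord0 j) = Y ord0 j.
Proof. by apply: sconj_real => x Dx; rewrite (rep_im (rep_imm j) Dx). Qed.

Lemma sconj1 : sconj (1 : sfun D) = 1. Proof. exact: sconj_real. Qed.

End Immersed.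

Lemma adot_conj_ge0 (R : realType) (D : oset R) m (v : 'rV[sfun D]_m) x :
  0 <= sre (adot v (kv (@sconj R D) v)) x /\ sim (adot v (kv (@sconj R D) v)) x = 0.
Proof.
rewrite /adot; elim/big_ind: _ => [|a b [a1 a2] [b1 b2]|i _].
- by rewrite sre0 sim0.
- by rewrite sreD simD a2 b2 addr0 addr_ge0.
- rewrite mxE sreM simM /= mulrN opprK addr_ge0 -?expr2 ?sqr_ge0 //.
  by rewrite mulrN mulrC addNr.
Qed.

Lemma mul_conj_ge0 (R : realType) (D : oset R) (a : sfun D) x :
  [/\ 0 <= sre (a * sconj a) x, sim (a * sconj a) x = 0 &
   sre (a * sconj a) x = 0 -> sre a x = 0 /\ sim a x = 0].
Proof.
rewrite sreM simM /= mulrN opprK -!expr2; split.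
- by rewrite addr_ge0 // sqr_ge0.
- by rewrite mulrN mulrC addNr.
- move/eqP; rewrite paddr_eq0 ?sqr_ge0 // !sqrf_eq0 => /andP[/eqP -> /eqP ->].
  by [].
Qed.

(** * Functions on the surface *)

Lemma congr_gi (A : comPzRingType) n (P Q gi G : 'M[A]_n) :
  Q *m P = 1%:M -> gi *m G = 1%:M -> (Q^T *m gi *m Q) *m (P *m G *m P^T) = 1%:M.
Proof.
move=> QP giG; rewrite -!mulmxA (mulmxA Q P) QP mul1mx (mulmxA gi G) giG mul1mx.
by rewrite -trmx_mul (mulmx1C QP) trmx1.
Qed.

Definition gradb (R : realType) n (X : R * R -> 'rV[R]_n.+1) (u w : R * R -> R) x : R :=
  \sum_(i < 2) \sum_(j < 2)
    imetric X x i j * (pd i (u : R * R -> R^o) x * pd j (w : R * R -> R^o) x).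

Section ChartDomains.
Variables (R : realType) (M : closedSurface R).
Local Notation P := (R * R)%type.
Implicit Types c d : chart R M.

Definition codo c : oset R := OSet (@cod_open _ _ c).

Lemma overlap_open c d : open (cod c `&` bwd c @^-1` dom d).
Proof.
rewrite openE => x [cx dx]; rewrite /interior.
have n1 : nbhs x (cod c) by apply: open_nbhs_nbhs; split=> //; exact: cod_open.
have n2 : nbhs (bwd c x) (dom d) by apply: open_nbhs_nbhs; split=> //; exact: dom_open.
by apply: filterI n1 _; exact: (bwd_continuous cx n2).
Qed.
Definition overlap c d : oset R := OSet (@overlap_open c d).

Definition trans c d (x : P) : P := fwd d (bwd c x).

Lemma trans_in c d x : os (overlap c d) x -> os (overlap d c) (trans c d x).
Proof.
move=> [cx dx]; split; first exact: fwd_cod.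
by rewrite /trans /preimage /= fwdK //; exact: bwd_dom.
Qed.
Lemma transK c d x : os (overlap c d) x -> trans d c (trans c d x) = x.
Proof. by move=> [cx dx]; rewrite /trans fwdK // bwdK. Qed.

Lemma trans_sm c d i : atlas c -> atlas d ->
  Csm (os (overlap c d)) (fun x => crd i (trans c d x)).
Proof.
move=> ac ad; have h := atlas_compat ac ad; rewrite /crd.
case: (i == ord0); [apply: smooth_on_fst h|apply: smooth_on_snd h];
  exact: overlap_open.
Qed.

Definition gsm (w : M -> R) : Prop := forall c, atlas c -> Csm (cod c) (w \o bwd c : P -> R^o).

End ChartDomains.

Section Invariance.
Variables (R : realType) (n : nat) (M : closedSurface R).
Variable f : M -> 'rV[R]_n.+1.
Hypothesis fi : sphere_immersion f.
Local Notation P := (R * R)%type.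
Local Notation cv := (coord_vec R).
Implicit Types c d : chart R M.
#[local] Opaque derive.

Section TwoCharts.
Variables c d : chart R M.
Hypotheses (ac : atlas c) (ad : atlas d).
Local Notation D := (overlap c d).
Local Notation Xc := (f \o bwd c).
Local Notation Xd := (f \o bwd d).
Local Notation tau := (trans c d).

Lemma tc_sm : smooth_on (os D) Xc.
Proof. by move=> s x [cx _]; exact: (fi.2 c ac).1. Qed.
Lemma tc_1 x : os D x -> dot (Xc x) (Xc x) = 1.
Proof. by move=> _; exact: fi.1. Qed.
Lemma tc_rf x : os D x -> row_free (Defs.jacobian Xc x).
Proof. by move=> [cx _]; exact: (fi.2 c ac).2. Qed.

Let t_sm i := trans_sm i ac ad.
Let s_sm i := trans_sm i ad ac.
Local Notation Y := (imm tc_sm).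
Local Notation Der := (chD (@trans_in R M c d) t_sm s_sm).
Local Notation Pm := (chP (@trans_in R M c d) t_sm s_sm).
Local Notation Qm := (chQ t_sm).

Lemma tc_link : link tau Der.
Proof.
apply: link_change.
- exact: (@trans_in R M d c).
- exact: (@transK R M c d).
- exact: (@transK R M d c).
Qed.

Lemma tc_QP : Qm *m Pm = 1%:M.
Proof. by apply: chQP; exact: (@transK R M c d). Qed.

Lemma tc_rep : repv tau Xd Y.
Proof.
move=> j x Dx; have [-> ->] := rep_imm tc_sm j Dx; split=> //.
by rewrite /= /trans fwdK //; exact: Dx.2.
Qed.

Let fh := imm_frame tc_sm tc_1 tc_rf.
Let gi' : 'M[sfun D]_2 := Qm^T *m sgi tc_sm tc_rf *m Qm.

Lemma tc_gi'K : gi' *m gm Y Der = 1%:M.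
Proof.
have E := fc_gm Y (D := @spd R D) (D' := Der) (P := Pm) (fun=> fun=> erefl).
by rewrite E; exact: congr_gi tc_QP (fr_gi fh).
Qed.

Lemma tc_frame : frame (shalf D) Y Der gi'.
Proof. exact: fc_frame fh (fun=> fun=> erefl) tc_QP tc_gi'K. Qed.

Lemma tc_real i j x : os D x -> sim (gi' i j) x = 0.
Proof.
move=> Dx; rewrite /gi' mxE sum_I2 simD !simM !chQ_im !mulr0 !add0r.
rewrite ![(Qm^T *m _) _ _]mxE !sum_I2 !simD !simM !(sgi_real _ _ _ _ Dx).
rewrite ![Qm^T _ _]mxE !chQ_im.
by rewrite !(mulr0, mul0r, addr0).
Qed.

(** Symmetry of second partial derivatives in the coordinates of [d]: the derivations [Der] are
    these coordinate fields, carried to the coordinates of [c]. *)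
Lemma tc_comm i j : dv (Der i) (fr Y Der j) = dv (Der j) (fr Y Der i).
Proof.
have H k l := repv_pd tc_link k (repv_pd tc_link l tc_rep).
have sXd : smooth_on (cod d) Xd by exact: (fi.2 d ad).1.
suff S01 : dv (Der ord0) (fr Y Der ord_max) = dv (Der ord_max) (fr Y Der ord0).
  have [->|->] := I2P i; have [->|->] := I2P j;
    [exact: erefl|exact: S01|exact: (esym S01)|exact: erefl].
apply/rowP => m; apply: sfun_ext => x Dx.
  apply: (etrans (rep_re (H ord0 ord_max m) Dx)).
  apply: etrans (esym (rep_re (H ord_max ord0 m) Dx)).
  have Dt : cod d (tau x) by exact: (trans_in Dx).1.
  have e k y : cod d y -> pd k Xd y ord0 m = pd k (fun y => Xd y ord0 m : R^o) y.
    move=> dy; have [_ dX] := sXd [::] y dy.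
    by rewrite [in LHS]/pd (derive_mx (dX k)) mxE.
  have e2 k l : pd k (pd l Xd) (tau x) ord0 m = pd k (pd l (fun y => Xd y ord0 m : R^o)) (tau x).
    have [_ dX] := sXd [:: l] _ Dt.
    rewrite [in LHS]/pd (derive_mx (dX k)) mxE.
    by apply: (pd_congr k (@cod_open _ _ d) Dt) => y dy; exact: e.
  have s2 := smooth_on_entry m (@cod_open _ _ d) sXd 2%N.
  have sw := schwarz (@cod_open _ _ d) Dt s2.
  exact: (etrans (e2 _ _) (etrans sw (esym (e2 _ _)))).
exact: (etrans (rep_im (H ord0 ord_max m) Dx) (esym (rep_im (H ord_max ord0 m) Dx))).
Qed.

Let lid := link_id D.
Let rid := rep_imm tc_sm.
Let gr := fun i j x (Dx : os D x) => sgi_real tc_sm tc_rf i j Dx.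
Let cm := imm_comm tc_sm.

(** The value in the chart [d] is the invariant of the frame [Der], the value in [c] that of [spd].
    Both are elements of the ring of functions on the overlap, where frame independence equates
    them; the comparisons below have the same reason. *)
Lemma tc_S x : os D x -> Stilde Xd (tau x) = Stilde Xc x.
Proof.
move=> Dx; apply: etrans (esym (rep_re (rep_aS tc_link tc_rep tc_frame tc_real) Dx)) _.
apply: etrans (congr1 (fun F => sre F x) (fc_aS fh (fun=> fun=> erefl) tc_QP tc_gi'K)) _.
exact: (rep_re (rep_aS lid rid fh gr) Dx).
Qed.
Lemma tc_C x : os D x -> cconst Xd (tau x) = cconst Xc x.
Proof.
move=> Dx; apply: etrans (esym (rep_re (rep_aC tc_link tc_rep tc_frame tc_real) Dx)) _.
apply: etrans (congr1 (fun F => sre F x) (fc_aC fh (fun=> fun=> erefl) tc_QP tc_gi'K)) _.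
exact: (rep_re (rep_aC lid rid fh gr) Dx).
Qed.
Lemma tc_B m x : os D x -> Btilde Xd m (tau x) = Btilde Xc m x.
Proof.
move=> Dx.
apply: etrans (esym (rep_re (rep_aB tc_link tc_rep tc_frame tc_real tc_comm m) Dx)) _.
apply: etrans (congr1 (fun F => sre F x) (fc_aB fh (fun=> fun=> erefl) tc_QP tc_gi'K _)) _.
exact: (rep_re (rep_aB lid rid fh gr cm m) Dx).
Qed.

Variables (u w : M -> R) (gu : gsm u) (gw : gsm w).
Let el (v : M -> R) (gv : gsm v) : sfun D :=
  smk (D := D) (fun k => Ck_sub (@subIsetl _ _ _) (gv c ac k)).
Let el_id v gv : rep id (v \o bwd c) (@el v gv).
Proof. by move=> x Dx; rewrite /= cutE. Qed.
Let el_tau v gv : rep tau (v \o bwd d) (@el v gv).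
Proof.
move=> x Dx; have [-> ->] := el_id gv Dx; split=> //.
by rewrite /= /trans fwdK //; exact: Dx.2.
Qed.

Lemma tc_lap x : os D x -> laplacian Xd (w \o bwd d) (tau x) = laplacian Xc (w \o bwd c) x.
Proof.
move=> Dx.
apply: etrans (esym (rep_re (rep_alap tc_link tc_rep tc_frame tc_real tc_comm (el_tau gw)) Dx)) _.
apply: etrans (congr1 (fun F => sre F x) (fc_alap fh (fun=> fun=> erefl) tc_QP tc_gi'K _)) _.
exact: (rep_re (rep_alap lid rid fh gr cm (el_id gw)) Dx).
Qed.
Lemma tc_grad x : os D x ->
  gradb Xd (u \o bwd d) (w \o bwd d) (tau x) = gradb Xc (u \o bwd c) (w \o bwd c) x.
Proof.
move=> Dx.
apply: etrans (esym (rep_re (rep_agrad tc_link tc_rep tc_frame tc_real (el_tau gu) (el_tau gw)) Dx)) _.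
apply: etrans (congr1 (fun F => sre F x) (fc_agrad fh (fun=> fun=> erefl) tc_QP tc_gi'K _ _)) _.
exact: (rep_re (rep_agrad lid rid fh gr (el_id gu) (el_id gw)) Dx).
Qed.
End TwoCharts.
End Invariance.

(** * Green formula *)

Section Divergence.
Variables (A : comPzRingType) (n : nat) (half : A) (X : 'rV[A]_n).
Variables (D : 'I_2 -> A -> A) (gi : 'M[A]_2).
Hypothesis fh : frame half X D gi.
Hypothesis Dcomm : forall i j x, D i (D j x) = D j (D i x).
Hypothesis Xcomm : forall i j, dv (D i) (fr X D j) = dv (D j) (fr X D i).
Local Notation g := (gm X D).
Local Notation Ga := (chr X D gi).
Local Notation i0 := (ord0 : 'I_2).
Local Notation i1 := (ord_max : 'I_2).
Let hd := fr_der fh.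

Lemma gi_gm a b : \sum_c gi a c * g c b = (a == b)%:R.
Proof. by have /matrixP/(_ a b) := fr_gi fh; rewrite [LHS]mxE [RHS]mxE. Qed.
Lemma gm_gi a b : \sum_c g a c * gi c b = (a == b)%:R.
Proof. by have /matrixP/(_ a b) := fr_gi' fh; rewrite [LHS]mxE [RHS]mxE. Qed.

Lemma chr_lower i j l : \sum_k g l k * Ga k i j = adot (dv (D i) (fr X D j)) (fr X D l).
Proof.
transitivity (\sum_m (\sum_k g l k * gi k m) * adot (dv (D i) (fr X D j)) (fr X D m)).
  rewrite /chr /tan; under eq_bigr do rewrite mulr_sumr.
  rewrite exchange_big; apply: eq_bigr => m _; rewrite mulr_suml.
  by apply: eq_bigr => k _; rewrite mulrA.
under eq_bigr do rewrite gm_gi.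
rewrite (bigD1 l) //= big1 ?addr0 ?eqxx ?mul1r // => m ml.
by rewrite eq_sym (negPf ml) mul0r.
Qed.

Lemma der_gm k i j : D k (g i j) = \sum_l g j l * Ga l k i + \sum_l g i l * Ga l k j.
Proof. by rewrite !chr_lower mxE (der_adot (hd k)) (adotC (fr X D i)). Qed.

Lemma chr_symm k i j : Ga k i j = Ga k j i.
Proof. by rewrite /chr Xcomm. Qed.

(** The product of the metric with its inverse is constant; differentiating it and contracting with
    the inverse gives the derivative of [gi] from that of the metric. *)
Lemma der_gi k i j : D k (gi i j) = - (\sum_l Ga i k l * gi l j + \sum_l Ga j k l * gi l i).
Proof.
have E a b : D k (\sum_c gi a c * g c b) = 0.
  rewrite gi_gm.
  by case: (a == b); [exact: (der1 (hd k))|exact: (der0 (hd k))].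
have gs := gi_sym fh i1 i0; have gms := gm_sym X D i1 i0.
have := E i i0; have := E i i1.
have := gm_gi i0 j; have := gm_gi i1 j.
have := gi_gm i i0; have := gi_gm i i1.
rewrite !sum_I2 !(derD (hd k)) !(derM (hd k)) !der_gm !sum_I2 !gms => a1 a0 b1 b0 e1 e0.
pose u := D k (gi i i0) ; pose v := D k (gi i i1).
rewrite -/u -/v in e0 e1.
have S : D k (gi i j) = u * (i0 == j)%:R + v * (i1 == j)%:R.
  by have [->|->] := I2P j; rewrite /= ?mulr1 ?mulr0 ?addr0 ?add0r.
rewrite S -b0 -b1.
pose w b := gi i i0 * (g b i0 * Ga i0 k i0 + g b i1 * Ga i1 k i0) +
            gi i i1 * (g b i0 * Ga i0 k i1 + g b i1 * Ga i1 k i1).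
pose z (b : 'I_2) := (i == i0)%:R * Ga i0 k b + (i == i1)%:R * Ga i1 k b.
have e0' : u * g i0 i0 + v * g i0 i1 = - (z i0 + w i0).
  apply/eqP; rewrite -addr_eq0 -e0 /z /w -a0 -a1; apply/eqP; rewrite ?gms; ring.
have e1' : u * g i0 i1 + v * g i1 i1 = - (z i1 + w i1).
  apply/eqP; rewrite -addr_eq0 -e1 /z /w -a0 -a1; apply/eqP; rewrite ?gms; ring.
transitivity ((u * g i0 i0 + v * g i0 i1) * gi i0 j + (u * g i0 i1 + v * g i1 i1) * gi i1 j).
  by ring.
rewrite e0' e1' /w /z.
transitivity (- (((i == i0)%:R * Ga i0 k i0 + (i == i1)%:R * Ga i1 k i0) * gi i0 j
  + ((i == i0)%:R * Ga i0 k i1 + (i == i1)%:R * Ga i1 k i1) * gi i1 j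
  + (gi i i0 * Ga i0 k i0 + gi i i1 * Ga i0 k i1) * (g i0 i0 * gi i0 j + g i0 i1 * gi i1 j)
  + (gi i i0 * Ga i1 k i0 + gi i i1 * Ga i1 k i1) * (g i0 i1 * gi i0 j + g i1 i1 * gi i1 j))).
  by rewrite ?gms; ring.
rewrite b0 b1.
by have [->|->] := I2P i; have [->|->] := I2P j; rewrite /= ?gs; ring.
Qed.

Variables (al be : A).
Hypothesis alK : be * al = 1.
Hypothesis al2 : al * al = g i0 i0 * g i1 i1 - g i0 i1 ^+ 2.

(** Jacobi's formula for the square root of the determinant: the square is differentiated instead,
    and then 2 and [al] are cancelled. *)
Lemma der_al i : D i al = al * \sum_k Ga k i k.
Proof.
have gms := gm_sym X D i1 i0.
have : al * D i al + al * D i al = al * (al * \sum_k Ga k i k) + al * (al * \sum_k Ga k i k).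
  transitivity (D i (al * al)); first by rewrite (derM (hd i)) (mulrC (D i al)).
  transitivity ((al * al) * (2%:R * \sum_k Ga k i k)); last by rewrite -[2%:R]/(1 + 1); ring.
  rewrite al2 expr2 (derB (hd i)) !(derM (hd i)) !der_gm !sum_I2 !gms.
  by ring.
move/(halfI fh)/(congr1 ( *%R be)); rewrite !mulrA alK !mul1r.
by move=> ->.
Qed.

(** The Laplacian in divergence form: the derivative of the area density cancels one of the two
    Christoffel terms in the derivative of the inverse metric, and the other one is that of the
    Hessian. *)
Lemma divergence v w :
  al * (v * alap X D gi w + agrad D gi v w) =
  \sum_i D i (al * \sum_j gi i j * (v * D j w)).
Proof.
have gs := gi_sym fh i1 i0.
have c1 k : Ga k i1 i0 = Ga k i0 i1 by exact: chr_symm.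
rewrite /alap /agrad !sum_I2 !(derM (hd _), derD (hd _)) !der_al !der_gi !sum_I2 !gs !c1.
rewrite (Dcomm i1 i0).
by ring.
Qed.
End Divergence.

(** * Smooth bump functions *)

Section Bump.
Variable R : realType.
Local Notation P := (R * R)%type.
Local Notation cv := (coord_vec R).
Local Notation pds i F := (@pd R R^o i (F : P -> R^o)).

(* [t^-n exp(-1/t)] extended by zero; the derivative of the n-th function is a
   combination of the next two. *)
Definition flat (n : nat) (t : R) : R := if 0 < t then t^-1 ^+ n * expR (- t^-1) else 0.

Lemma flat_ge0 n t : 0 <= flat n t.
Proof.
by rewrite /flat; case: ifP => // t0; rewrite mulr_ge0 ?expR_ge0 ?exprn_ge0 // invr_ge0 ltW.
Qed.

Lemma flat_gt0 n t : 0 < t -> 0 < flat n t.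
Proof. by move=> t0; rewrite /flat t0 mulr_gt0 ?expR_gt0 // exprn_gt0 // invr_gt0. Qed.

(** With s = 1 / t and m = n + 2, exp s is the m-th power of exp (s / m), hence at least (s / m)^m.
    The quadratic bound makes the derivative at the origin zero. *)
Lemma flat_le n t : `|flat n t| <= (n.+2%:R ^+ n.+2) * t ^+ 2.
Proof.
rewrite ger0_norm ?flat_ge0 // /flat; case: ifP => t0; last first.
  by apply: mulr_ge0; [exact: exprn_ge0|exact: sqr_ge0].
have s0 : 0 < t^-1 by rewrite invr_gt0.
have -> : t^-1 ^+ n * expR (- t^-1) = (t^-1 ^+ n.+2 * expR (- t^-1)) * t ^+ 2.
  rewrite !exprS !expr0; field; by rewrite gt_eqF.
apply: ler_wpM2r; first exact: sqr_ge0.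
rewrite expRN ler_pdivrMr ?expR_gt0 //.
have {2}-> : t^-1 = n.+2%:R * (t^-1 / n.+2%:R) by rewrite mulrC divfK // pnatr_eq0.
rewrite expRM_natl -exprMn.
apply: lerXn2r; rewrite ?nnegrE; [exact: ltW|by rewrite mulr_ge0 ?expR_ge0|].
rewrite -ler_pdivrMl ?ltr0n // mulrC.
by apply: le_trans (expR_ge1Dx _); rewrite lerDr.
Qed.

Lemma is_derive_flat n (t : R) :
  is_derive t (1 : R) (flat n : R -> R) (- n%:R * flat n.+1 t + flat n.+2 t).
Proof.
have [t0|t0|t0] := ltgtP t 0.
- rewrite /flat ltNge (ltW t0) /= mulr0 addr0.
  apply: (near_eq_is_derive (f := cst 0)).
  near=> s; have : s < 0 by near: s; exact: lt_nbhsl.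
  by move=> s0; rewrite ltNge (ltW s0).
- rewrite /flat t0.
  have tn : t != 0 by rewrite gt_eqF.
  apply: (near_eq_is_derive (f := fun s : R => s^-1 ^+ n * expR (- s^-1))).
    near=> s; have -> // : 0 < s by near: s; exact: lt_nbhsr.
  have iV : is_derive t (1 : R) (fun s : R => s^-1) (- t ^- 2).
    by have := @is_deriveV R id t 1 1 tn (is_derive_id _ _); rewrite /GRing.scale /= mulr1.
  have e m : ([eta GRing.inv] : R -> R) ^+ m = (fun s : R => s^-1 ^+ m).
    elim: m => [|m IH]; first by rewrite expr0; apply/funext => s; rewrite expr0.
    by rewrite exprS IH; apply/funext => s; rewrite exprS.
  have iX := is_deriveX n iV; rewrite e in iX.
  have iE : is_derive t (1 : R) (fun s : R => expR (- s^-1)) (t ^- 2 * expR (- t^-1)).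
    have iN := is_deriveN iV; rewrite opprK in iN.
    have := @is_derive1_comp R (@expR R) (- [eta GRing.inv]) t _ _ (is_derive_expR _) iN.
    by rewrite mulrC.
  have iM := is_deriveM iX iE.
  apply: (is_derive_eq iM).
  rewrite /= /GRing.scale /= -!exprVn !exprS; case: n {iX iM} => [|n] /=; rewrite ?expr0 ?exprS; ring.
- rewrite {}t0 {2 3}/flat ltxx mulr0 addr0.
  pose C : R := n.+2%:R ^+ n.+2.
  have C0 : 0 <= C by rewrite exprn_ge0.
  have H : (fun h : R => h^-1 *: ((flat n \o shift 0) (h *: (1 : R)) - flat n 0)) @ 0^' --> (0 : R).
    apply/cvgrPdist_le => e e0.
    (* The difference quotient is at most C |h| by [flat_le]; adding 1 keeps the denominator
       positive. *)
    rewrite /dnbhs; apply/nbhs_ballP; exists (e / (C + 1)).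
      by rewrite /= divr_gt0 // ltr_wpDl.
    move=> h; rewrite /ball /= sub0r normrN => hb hn0.
    rewrite /= sub0r normrN /flat ltxx subr0 -/(flat n _) addr0 /GRing.scale /= mulr1.
    rewrite normrM normrV ?unitfE // ler_pdivrMl ?normr_gt0 //.
    apply: le_trans (flat_le n h) _; rewrite -/C -[h ^+ 2](real_normK (num_real h)) expr2 mulrCA.
    apply: ler_wpM2l => //.
    move: hb; rewrite ltr_pdivlMr; last by rewrite ltr_wpDl.
    move=> /ltW; apply: le_trans; rewrite mulrC; apply: ler_wpM2l => //.
    by rewrite lerDl.
  by apply: DeriveDef; [exact: cvgP H|exact: cvg_lim H].
Unshelve. all: by end_near. Qed.

#[local] Opaque derive.

Lemma Ck_flat n k (D : set P) F : open D -> Ck k D F -> Ck k D (fun x => flat n (F x) : R^o).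
Proof.
move=> oD; elim: k n => [|k IH] n hF.
  split=> // x Dx; apply: (@continuous_comp _ _ _ F (flat n : R^o -> R^o)).
    exact: Ck_cont hF Dx.
  apply: differentiable_continuous; apply/derivable1_diffP.
  by have [] := is_derive_flat n (F x).
have W1 m (G : P -> R^o) (E : set P) : Ck m.+1 E G -> Ck 1 E G.
  by elim: m => [|m IHm] // /CkW /IHm.
have H i x (Dx : D x) := is_derive_comp1 i oD Dx (W1 _ _ _ hF) (is_derive_flat n (F x)).
split=> [x Dx|i].
  apply: (@continuous_comp _ _ _ F (flat n : R^o -> R^o)); first exact: Ck_cont hF Dx.
  apply: differentiable_continuous; apply/derivable1_diffP.
  by have [] := is_derive_flat n (F x).
split=> [x Dx|]; first by have [] := H i x Dx.
have h1 := IH n.+1 (CkW hF); have h2 := IH n.+2 (CkW hF).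
apply: Ck_congr (CkM oD (CkD oD (CkM oD (Ck_cst k D (- n%:R)) h1) h2) (Ck_pd i hF)) => // x Dx.
by have [_ <-] := H i x Dx.
Qed.

Lemma Ck_local k (D : set P) F :
  (forall x, D x -> exists U, [/\ open U, U x & Ck k U F]) -> Ck k D F.
Proof.
elim: k F => [|k IH] F h.
  by split=> // x /h [U [_ Ux hU]]; exact: Ck_cont hU Ux.
split=> [x /h [U [_ Ux hU]]|i]; first exact: Ck_cont hU Ux.
split=> [x /h [U [_ Ux hU]]|]; first exact: Ck_derivable hU Ux.
by apply: IH => x /h [U [oU Ux hU]]; exists U; split=> //; exact: Ck_pd hU.
Qed.

Definition bump (a : P) (r : R) (x : P) : R :=
  flat 0 (r ^+ 2 - ((x.1 - a.1) ^+ 2 + (x.2 - a.2) ^+ 2)).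

Lemma bump_sm a r : Csm setT (bump a r : P -> R^o).
Proof.
move=> k; apply: Ck_flat; first exact: openT.
have oT : open (setT : set P) by exact: openT.
apply: CkD => //; first exact: Ck_cst.
apply: CkN => //.
have s i : Ck k setT (fun x : P => crd i x - crd i a : R^o).
  by apply: CkD => //; [exact: Ck_crd|exact: Ck_cst].
apply: CkD => //; [have h := CkM oT (s ord0) (s ord0)|have h := CkM oT (s ord_max) (s ord_max)];
  by apply: Ck_congr h => // x _; rewrite expr2.
Qed.
Lemma bump_ge0 a r x : 0 <= bump a r x. Proof. exact: flat_ge0. Qed.
Lemma bump_gt0 a r : 0 < r -> 0 < bump a r a.
Proof. by move=> r0; apply: flat_gt0; rewrite !subrr expr0n addr0 subr0 exprn_gt0. Qed.
Lemma bump_off a r x : 0 <= r -> bump a r x != 0 -> `|x.1 - a.1| <= r /\ `|x.2 - a.2| <= r.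
Proof.
move=> r0; rewrite /bump /flat; case: ifP; last by rewrite eqxx.
rewrite subr_gt0 => h _; split; rewrite -(ger0_norm r0) -ler_sqr ?nnegrE // !real_normK ?num_real //;
 apply: ltW; apply: le_lt_trans h; rewrite ?lerDl ?lerDr sqr_ge0 //.
Qed.
End Bump.

(** * Integration in the plane *)

Section MeasurableR.
Context d (T : measurableType d) (R : realType).

Lemma measurable_fun_openP (f : T -> R) (D : set T) :
  (forall B : set R, open B -> measurable (D `&` f @^-1` B)) -> measurable_fun D f.
Proof.
move=> h; apply: (measurability _ (RGenOInfty.measurableE R)) => _ [_ [a ->] <-].
by apply: h; exact: interval_open.
Qed.
End MeasurableR.

Lemma open_preim (T U : topologicalType) (f : T -> U) (D : set T) (B : set U) : open D ->
  (forall x, D x -> {for x, continuous f}) -> open B -> open (D `&` f @^-1` B).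
Proof.
move=> oD cf oB; rewrite openE => x [Dx Bx]; rewrite /interior.
have n1 : nbhs x D by apply: open_nbhs_nbhs.
have n2 : nbhs (f x) B by apply: open_nbhs_nbhs.
by apply: filterI n1 _; exact: (cf x Dx _ n2).
Qed.

Section Plane.
Variable R : realType.
Local Notation P := (measurableTypeR R * measurableTypeR R)%type.
Local Notation la := (@lebesgue_measure R \x @lebesgue_measure R)%E.

(** An open set of the plane is a countable union of boxes with rational corners; indices that code
    no box inside the set contribute the empty set. *)
Lemma open_measurable2 (A : set (R * R)) : open A -> measurable (A : set P).
Proof.
move=> oA.
pose box (q : (rat * rat) * (rat * rat)) : set P :=
  `]ratr q.1.1, ratr q.1.2[ `*` `]ratr q.2.1, ratr q.2.2[.
pose F (n : nat) : set P := if unpickle n is Some q then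
  (if pselect (box q `<=` A) then box q else set0) else set0.
have -> : A = \bigcup_n F n.
  rewrite eqEsubset; split=> [x Ax|x [n _]]; last first.
    by rewrite /F; case: unpickle => // q; case: pselect => // s /s.
  have /nbhs_ballP[e /= e0 be] : nbhs x A by exact: open_nbhs_nbhs.
  have [a] := @rat_in_itvoo R (x.1 - e) x.1 ltac:(by rewrite ltrBlDr ltrDl).
  have [b] := @rat_in_itvoo R x.1 (x.1 + e) ltac:(by rewrite ltrDl).
  have [c] := @rat_in_itvoo R (x.2 - e) x.2 ltac:(by rewrite ltrBlDr ltrDl).
  have [d] := @rat_in_itvoo R x.2 (x.2 + e) ltac:(by rewrite ltrDl).
  rewrite !in_itv /= => /andP[d1 d2] /andP[c1 c2] /andP[b1 b2] /andP[a1 a2].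
  have bx : box ((a, b), (c, d)) x by split; rewrite /= in_itv /= ?a2 ?c2.
  have bA : box ((a, b), (c, d)) `<=` A.
    move=> y []; rewrite /= !in_itv /= => /andP[y1 y2] /andP[y3 y4]; apply: be.
    by split; rewrite /ball /= ltr_norml; apply/andP; split; lra.
  move: ((a, b), (c, d)) bx bA => q bx bA.
  by exists (pickle q); [exact: I|rewrite /F pickleK; case: pselect].
apply: bigcupT_measurable => n; rewrite /F; case: unpickle => [q|]; last exact: measurable0.
case: pselect => s; last exact: measurable0.
by rewrite /box; apply: measurableX; apply: measurable_itv.
Qed.

Lemma cont_measurable2 (f : R * R -> R) (D : set (R * R)) : open D ->
  (forall x, D x -> {for x, continuous f}) -> measurable_fun (D : set P) f.
Proof.
move=> oD cf; apply: measurable_fun_openP => B oB.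
by apply: open_measurable2; exact: open_preim.
Qed.

Lemma measurable_box2 (a b c d : R) : measurable (`[a, b] `*` `[c, d] : set P).
Proof. by apply: measurableX; apply: measurable_itv. Qed.

Lemma la_box (a b c d : R) : a < b -> c < d ->
  la (`[a, b] `*` `[c, d] : set P) = ((b - a) * (d - c))%:E.
Proof.
move=> ab cd; rewrite product_measure1E; [|apply: measurable_itv|apply: measurable_itv].
have Li (x y : R) : x < y -> lebesgue_measure (`[x, y]%classic : set R) = (y - x)%:E.
  by move=> xy; rewrite lebesgue_measure_itv /= lte_fin xy.
by rewrite EFinM; congr (_ * _)%E; apply: Li.
Qed.

Local Notation pds i F := (@pd R R^o i (F : R * R -> R^o)).

Lemma pd_fst (W : R * R -> R^o) x y :
  (derivable W (x, y) (coord_vec R ord0) <-> derivable (fun t => W (t, y) : R^o) x 1) /\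
  pds ord0 W (x, y) = derive1 (fun t => W (t, y) : R^o) x.
Proof.
have E : (fun h : R => h^-1 *: ((W \o shift (x, y)) (h *: coord_vec R ord0) - W (x, y))) =
  (fun h : R => h^-1 *: (((fun t => W (t, y) : R^o) \o shift x) (h *: (1 : R)) - W (x, y))).
  apply/funext => h; congr (_ *: (W _ - _)); rewrite /shift /=.
  have -> : h *: coord_vec R ord0 + (x, y) = (h *: (1 : R) + x, h *: (0 : R) + y) by [].
  by rewrite scaler0 add0r.
by rewrite derive1E /pd /derive /derivable E.
Qed.
Lemma pd_snd (W : R * R -> R^o) x y :
  (derivable W (x, y) (coord_vec R ord_max) <-> derivable (fun t => W (x, t) : R^o) y 1) /\
  pds ord_max W (x, y) = derive1 (fun t => W (x, t) : R^o) y.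
Proof.
have E : (fun h : R => h^-1 *: ((W \o shift (x, y)) (h *: coord_vec R ord_max) - W (x, y))) =
  (fun h : R => h^-1 *: (((fun t => W (x, t) : R^o) \o shift y) (h *: (1 : R)) - W (x, y))).
  apply/funext => h; congr (_ *: (W _ - _)); rewrite /shift /=.
  have -> : h *: coord_vec R ord_max + (x, y) = (h *: (0 : R) + x, h *: (1 : R) + y) by [].
  by rewrite scaler0 add0r.
by rewrite derive1E /pd /derive /derivable E.
Qed.

Lemma int_line0 (f : R -> R^o) (L : R) : 0 < L ->
  (forall t, derivable f t 1) -> (forall t, {for t, continuous ((derive1 f))}) ->
  (forall t, L <= `|t| -> f t = 0) ->
  (\int[@lebesgue_measure R]_t (derive1 f t)%:E = 0)%E.
Proof.
move=> L0 df cf f0.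
have fc t : {for t, continuous f} by apply: differentiable_continuous; apply/derivable1_diffP.
have d0 t : L < `|t| -> (derive1 f) t = 0.
  move=> Lt; rewrite derive1E (near_eq_derive (g := cst 0)) ?derive_cst //.
  have nc : (fun s : R => `|s|) @ t --> `|t| by exact: norm_continuous.
  have nL : \forall s \near t, L < `|s| by exact: (nc _ (lt_nbhsr Lt)).
  by apply: filterS nL => s Ls; exact: (f0 _ (ltW Ls)).
pose B : set R := `[(- L), L]%classic.
have -> : (\int[@lebesgue_measure R]_t (derive1 f t)%:E =
    \int[@lebesgue_measure R]_(t in B) (derive1 f t)%:E)%E.
  rewrite [RHS]integral_mkcond; apply: eq_integral => t _; rewrite /patch.
  case: ifPn => //; rewrite notin_setE /B /= in_itv /= => /negP.
  by rewrite -ler_norml -ltNge => /d0 ->.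
have ab : - L < L by exact: gtrN.
have cdf : {within `[(- L), L], continuous (derive1 f)}.
  by apply: continuous_in_subspaceT => t _; exact: cf.
have lr : derivable_oo_LRcontinuous f (- L) L.
  split; first by move=> t _; exact: df.
  + by apply: cvg_at_right_filter; exact: fc.
  + by apply: cvg_at_left_filter; exact: fc.
have E := continuous_FTC2 ab cdf lr (fun t _ => erefl).
apply: etrans E _.
by rewrite !f0 ?normrN ?ger0_norm ?subee // ltW.
Qed.

Lemma supp_integrable (F : R * R -> R) (L : R) : 0 < L ->
  continuous F -> (forall x, L <= `|x.1| \/ L <= `|x.2| -> F x = 0) ->
  la.-integrable [set: P] (EFin \o F).
Proof.
move=> L0 cF F0.
pose B : set P := `[(- L), L] `*` `[(- L), L].
have mB : measurable B by exact: measurable_box2.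
have -> : EFin \o F = (EFin \o F) \_ B.
  apply/funext => x; rewrite /patch; case: ifPn => //.
  rewrite notin_setE /B /= !in_itv /= -!ler_norml => h; rewrite F0 //.
  have [h1|h1] := leP L `|x.1|; first by left.
  by right; rewrite leNgt; apply/negP => h2; apply: h; split; exact: ltW.
apply/(integrable_mkcond _ mB).
apply: measurable_bounded_integrable => //.
- exact: (eq_ind_r (fun z => (z < +oo)%E) (ltry _) (la_box (gtrN L0) (gtrN L0))).
- apply: measurable_funTS.
  by apply: (cont_measurable2 (D := setT)); [exact: openT|move=> x _; exact: cF].
have cB : compact (B : set (R * R)).
  by apply: compact_setX; exact: segment_compact.
have := compact_bounded (continuous_compact (continuous_subspaceT cF) cB).
rewrite /bounded_set /bounded_near; apply: filterS => M hM x Bx /=.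
by apply: hM; exists x.
Qed.

(** Fubini's theorem, integrating first along the direction of differentiation, where the
    fundamental theorem of calculus gives zero. *)
Lemma int_pd0 (W : R * R -> R^o) i (L : R) : 0 < L -> Csm setT W ->
  (forall x, L <= `|x.1| \/ L <= `|x.2| -> W x = 0) ->
  la.-integrable [set: P] (EFin \o pds i W) /\ (\int[la]_x (pds i W x)%:E = 0)%E.
Proof.
move=> L0 sW W0.
have oT : open [set: R * R] by exact: openT.
have cp x : {for x, continuous (pds i W)} by exact: (Ck_cont (Ck_pd i (sW 1%N)) I).
(* The derivative vanishes where [W] is zero on a whole neighbourhood; replacing L by L + 1 puts the
   closed region inside an open one. *)
have p0 (x : R * R) : L + 1 <= `|x.1| \/ L + 1 <= `|x.2| -> pds i W x = 0.
  move=> h; pose U := [set y : R * R | L < `|y.1|] `|` [set y : R * R | L < `|y.2|].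
  have oU : open U.
    have c1 : continuous (fun y : R * R => `|y.1|).
      by move=> y; apply: (@continuous_comp _ _ _ fst (@Num.norm R R)); [exact: cvg_fst|exact: norm_continuous].
    have c2 : continuous (fun y : R * R => `|y.2|).
      by move=> y; apply: (@continuous_comp _ _ _ snd (@Num.norm R R)); [exact: cvg_snd|exact: norm_continuous].
    by apply: openU; apply: (open_comp _ (@open_gt R L)) => y _; [exact: c1|exact: c2].
  have Ux : U x by case: h => h; [left|right]; apply: lt_le_trans h; rewrite ltrDl.
  rewrite (pd_congr (G := cst 0) i oU Ux); first by rewrite /pd derive_cst.
  by move=> y [|] /= /ltW yL; apply: W0; [left|right].
have iF : la.-integrable [set: P] (EFin \o pds i W).
  by apply: (supp_integrable (L := L + 1)) p0 => //; exact: addr_gt0.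
split=> //.
have W1 := sW 1%N.
have [ie|ie] := I2P i; rewrite ie in iF cp *.
- rewrite -(integral21_prod_meas1 iF) /fubini_G.
  apply: integral0_eq => y _.
  have D1 x := pd_fst W x y.
  have -> : (\int[@lebesgue_measure R]_x (EFin \o pds ord0 W) (x, y) =
     \int[@lebesgue_measure R]_x (derive1 (fun t => W (t, y) : R^o) x)%:E)%E.
    by apply: eq_integral => x _ /=; rewrite (D1 x).2.
  apply: (int_line0 L0).
  + by move=> t; apply: (D1 t).1.1; exact: (Ck_derivable (i := ord0) W1 I).
  + move=> t; have -> : derive1 (fun t => W (t, y) : R^o) = (fun t => pds ord0 W (t, y)).
      by apply/funext => s; rewrite (D1 s).2.
    apply: (@continuous_comp _ _ _ (fun t : R => (t, y)) (pds ord0 W)); last exact: cp.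
    exact: (cvg_pair cvg_id (cvg_cst y)).
  + by move=> t Lt; apply: W0; left.
- rewrite -(integral12_prod_meas1 iF) /fubini_F.
  apply: integral0_eq => y _.
  have D1 x := pd_snd W y x.
  have -> : (\int[@lebesgue_measure R]_x (EFin \o pds ord_max W) (y, x) =
     \int[@lebesgue_measure R]_x (derive1 (fun t => W (y, t) : R^o) x)%:E)%E.
    by apply: eq_integral => x _ /=; rewrite (D1 x).2.
  apply: (int_line0 L0).
  + by move=> t; apply: (D1 t).1.1; exact: (Ck_derivable (i := ord_max) W1 I).
  + move=> t; have -> : derive1 (fun t => W (y, t) : R^o) = (fun t => pds ord_max W (y, t)).
      by apply/funext => s; rewrite (D1 s).2.
    apply: (@continuous_comp _ _ _ (fun t : R => (y, t)) (pds ord_max W)); last exact: cp.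
    exact: (cvg_pair (cvg_cst y) cvg_id).
  + by move=> t Lt; apply: W0; right.
Qed.
End Plane.

(** * Change of variables for a measure given by a density *)

Section Transfer.
Import HBNNSimple.
Context d1 d2 (X : measurableType d1) (T : measurableType d2) (R : realType).
Variables (mu : {measure set X -> \bar R}) (la : {measure set T -> \bar R}).
Variables (D : set X) (E : set T) (b : T -> X) (g : T -> R).
Hypotheses (mD : measurable D) (mE : measurable E).
Hypotheses (mb : measurable_fun E b) (mg : measurable_fun E g).
Hypotheses (g0 : forall x, E x -> 0 <= g x) (bE : forall x, E x -> D (b x)).
Hypothesis density : forall A, measurable A -> A `<=` D ->
  mu A = (\int[la]_(x in E `&` b @^-1` A) (g x)%:E)%E.
Local Open Scope ereal_scope.

Let mgE : measurable_fun E (EFin \o g). Proof. exact/measurable_EFinP. Qed.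

(** For indicators this is the hypothesis [density]; simple functions follow by additivity, and the
    general case by monotone convergence on both sides. *)
Lemma ge0_transfer (f : X -> \bar R) : (forall p, D p -> 0 <= f p) -> measurable_fun D f ->
  \int[mu]_(p in D) f p = \int[la]_(x in E) (f (b x) * (g x)%:E).
Proof.
move=> f0 mf; pose h := nnsfun_approx mD mf.
have mh (s : X -> R) : measurable_fun setT s -> measurable_fun E (EFin \o (s \o b)).
  by move=> ms; apply/measurable_EFinP; exact: measurableT_comp ms mb.
have -> : \int[mu]_(p in D) f p = lim (\int[mu]_(p in D) (EFin \o h n) p @[n --> \oo]).
  have fE p : D p -> f p = lim ((EFin \o h n) p @[n --> \oo]).
    by move=> Dp; apply/esym/cvg_lim => //; exact: cvg_nnsfun_approx.
  under eq_integral => p /[!inE] /fE -> //.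
  apply: monotone_convergence => //.
  - by move=> n; apply/measurable_EFinP; exact: measurable_funTS.
  - by move=> n p Dp //=; rewrite lee_fin.
  - by move=> p Dp m n mn; rewrite lee_fin; exact/lefP/nd_nnsfun_approx.
have -> : \int[la]_(x in E) (f (b x) * (g x)%:E) =
    lim (\int[la]_(x in E) ((h n (b x))%:E * (g x)%:E) @[n --> \oo]).
  have fE x : E x -> f (b x) * (g x)%:E = lim ((h n (b x))%:E * (g x)%:E @[n --> \oo]).
    move=> Ex; apply/esym/cvg_lim => //; apply: cvgeZr => //.
    by have := cvg_nnsfun_approx mD mf f0 (bE Ex).
  under eq_integral => x /[!inE] /fE -> //.
  apply: monotone_convergence => //.
  - move=> n; apply: emeasurable_funM => //. exact: (mh (h n) (measurable_funPT _)).
  - by move=> n x Ex; rewrite mule_ge0 ?lee_fin ?g0.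
  - by move=> x Ex m n mn; rewrite lee_wpmul2r ?lee_fin ?g0 //; exact/lefP/nd_nnsfun_approx.
suff suf n : \int[mu]_(p in D) (EFin \o h n) p = \int[la]_(x in E) ((h n (b x))%:E * (g x)%:E).
  by under eq_fun do rewrite suf.
pose s := h n; rewrite -/s.
have ms r : measurable_fun setT (fun p => (r * \1_(s @^-1` [set r]) p)%R) by exact: measurable_funM.
have -> : \int[mu]_(p in D) (EFin \o s) p =
   \sum_(r \in range s) \int[mu]_(p in D) (r * \1_(s @^-1` [set r]) p)%:E.
  rewrite -ge0_integral_fsum //.
  - by apply: eq_integral => p _; rewrite /= fimfunE -fsumEFin.
  - by move=> r; apply/measurable_EFinP; exact: measurable_funTS.
  - by move=> r p _; exact: nnfun_muleindic_ge0.
have -> : \int[la]_(x in E) ((s (b x))%:E * (g x)%:E) =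
   \sum_(r \in range s) \int[la]_(x in E) ((r * \1_(s @^-1` [set r]) (b x))%:E * (g x)%:E).
  rewrite -ge0_integral_fsum //.
  - apply: eq_integral => x _; rewrite -ge0_mule_fsuml => [|r]; last exact: nnfun_muleindic_ge0.
    by rewrite fsumEFin // -(fimfunE s (b x)).
  - by move=> r; apply: emeasurable_funM => //; by apply: (mh _ (ms r)).
  - by move=> r x Ex; rewrite mule_ge0 ?lee_fin ?g0 // -lee_fin nnfun_muleindic_ge0.
apply: eq_fsbigr => r rs.
have r0 : 0 <= r%:E by move: rs; rewrite inE => -[p _ <-]; rewrite lee_fin.
have mS : measurable (s @^-1` [set r]) by [].
rewrite integralZl_indic_nnsfun // integral_indic //.
under [RHS]eq_integral do rewrite EFinM -muleA.
rewrite ge0_integralZl //; last 2 first.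
- apply: emeasurable_funM => //.
  by apply: (mh (\1_(s @^-1` [set r]))); exact: measurable_indic.
- by move=> x Ex; rewrite mule_ge0 ?lee_fin ?g0.
congr (_ * _); rewrite density; [|exact: measurableI|by move=> p []].
rewrite (_ : E `&` b @^-1` _ = E `&` (b @^-1` (s @^-1` [set r]))); last first.
  apply/seteqP; split=> x /= [Ex sx]; first by split=> //; case: sx.
  by split=> //; split=> //; exact: bE.
rewrite integral_mkcondr; apply: eq_integral => x _.
by rewrite epatch_indic muleC.
Qed.

Lemma transfer (f : X -> R) : measurable_fun D f ->
  \int[mu]_(p in D) (f p)%:E = \int[la]_(x in E) (f (b x) * g x)%:E.
Proof.
move=> mf; have mfE : measurable_fun D (EFin \o f) by exact/measurable_EFinP.
rewrite integralE [RHS]integralE !ge0_transfer //;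
  [|exact: measurable_funeneg|exact: measurable_funepos].
have M (a c : R) : (0 <= c)%R -> maxe a%:E 0 * c%:E = maxe (a * c)%:E 0.
  by move=> c0; rewrite -!EFin_max -EFinM maxr_pMl // mul0r.
congr (_ - _); apply: eq_integral => x; rewrite inE => Ex.
  by rewrite !funeposE /= M ?g0.
by rewrite !funenegE /= -mulNr M ?g0.
Qed.
End Transfer.

(** * Smooth functions on the surface and their chart expressions *)

Definition gr (R : realType) (M : closedSurface R) (c : chart R M) (w : M -> R)
  (F : sfun (codo c)) := rep id (w \o bwd c) F.
Arguments gr {R M} c w F.

Section Glob.
Variables (R : realType) (n : nat) (M : closedSurface R).
Variable f : M -> 'rV[R]_n.+1.
Hypothesis fi : sphere_immersion f.
Local Notation P := (R * R)%type.
Local Notation cv := (coord_vec R).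
Implicit Types (c d : chart R M) (u w : M -> R).
#[local] Opaque derive spd.

Lemma gsmD u w : gsm u -> gsm w -> gsm (fun p => u p + w p).
Proof. by move=> gu gw c ac k; apply: CkD; [exact: cod_open|exact: gu|exact: gw]. Qed.
Lemma gsmN u : gsm u -> gsm (fun p => - u p).
Proof. by move=> gu c ac k; apply: CkN; [exact: cod_open|exact: gu]. Qed.
Lemma gsmM u w : gsm u -> gsm w -> gsm (fun p => u p * w p).
Proof. by move=> gu gw c ac k; apply: CkM; [exact: cod_open|exact: gu|exact: gw]. Qed.
Lemma gsmV u : (forall p, u p != 0) -> gsm u -> gsm (fun p => (u p)^-1).
Proof. by move=> u0 gu c ac k; apply: CkV; [exact: cod_open|move=> x _; exact: u0|exact: gu]. Qed.
Lemma gsm_cst (a : R) : gsm (fun _ : M => a).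
Proof. by move=> c ac k; exact: Ck_cst. Qed.

Definition Lap w p := laplacian (f \o bwd (chart_at p)) (w \o bwd (chart_at p)) (fwd (chart_at p) p).
Definition Gam u w p :=
  gradb (f \o bwd (chart_at p)) (u \o bwd (chart_at p)) (w \o bwd (chart_at p)) (fwd (chart_at p) p).

Section OneChart.
Variable c : chart R M.
Hypothesis ac : atlas c.
Local Notation Xc := (f \o bwd c).
Local Notation D := (codo c).

Lemma ch_sm : smooth_on (os D) Xc. Proof. exact: (fi.2 c ac).1. Qed.
Lemma ch_1 x : os D x -> dot (Xc x) (Xc x) = 1. Proof. by move=> _; exact: fi.1. Qed.
Lemma ch_rf x : os D x -> row_free (Defs.jacobian Xc x). Proof. exact: (fi.2 c ac).2. Qed.

Let ov x (Dx : cod c x) : os (overlap c (chart_at (bwd c x))) x.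
Proof. by split=> //; exact: chart_at_dom. Qed.
Let at_atlas (p : M) : atlas (chart_at p). Proof. exact: chart_at_atlas. Qed.

Lemma val_S x : cod c x -> surface_fun f (@Stilde R n) (bwd c x) = Stilde Xc x.
Proof. by move=> Dx; exact: (tc_S fi ac (at_atlas _) (ov Dx)). Qed.
Lemma val_C x : cod c x -> surface_fun f (@cconst R n) (bwd c x) = cconst Xc x.
Proof. by move=> Dx; exact: (tc_C fi ac (at_atlas _) (ov Dx)). Qed.
Lemma val_B m x : cod c x -> surface_fun f (fun X => Btilde X m) (bwd c x) = Btilde Xc m x.
Proof. by move=> Dx; exact: (tc_B fi ac (at_atlas _) m (ov Dx)). Qed.
Lemma val_Lap w x : gsm w -> cod c x -> Lap w (bwd c x) = laplacian Xc (w \o bwd c) x.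
Proof. by move=> gw Dx; exact: (tc_lap fi ac (at_atlas _) gw (ov Dx)). Qed.
Lemma val_Gam u w x : gsm u -> gsm w -> cod c x ->
  Gam u w (bwd c x) = gradb Xc (u \o bwd c) (w \o bwd c) x.
Proof. by move=> gu gw Dx; exact: (tc_grad fi ac (at_atlas _) gu gw (ov Dx)). Qed.

Definition cY := imm ch_sm.
Definition cgi := sgi ch_sm ch_rf.
Lemma cfh : frame (shalf D) cY (@spd R D) cgi.
Proof. exact: imm_frame ch_1 _. Qed.
Let rl i j x (Dx : os D x) : sim (cgi i j) x = 0 := sgi_real ch_sm ch_rf i j Dx.
Let cm := imm_comm ch_sm.
Let lid := link_id D.
Let rid : repv id Xc cY := rep_imm ch_sm.

Definition gel w (gw : gsm w) : sfun D := smk (D := D) (gw c ac).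
Lemma gr_gel w (gw : gsm w) : gr c w (gel gw).
Proof. by move=> x Dx; rewrite /= cutE. Qed.

Lemma gr_S : gr c (surface_fun f (@Stilde R n)) (aS (shalf D) cY (@spd R D) cgi).
Proof.
by apply: eq_rep (rep_aS lid rid cfh rl) => x Dx; rewrite /= val_S.
Qed.
Lemma gr_C : gr c (surface_fun f (@cconst R n)) (aC (shalf D) cY (@spd R D) cgi).
Proof.
by apply: eq_rep (rep_aC lid rid cfh rl) => x Dx; rewrite /= val_C.
Qed.
Lemma gr_B m : gr c (surface_fun f (fun X => Btilde X m)) (aB (shalf D) cY (@spd R D) cgi m).
Proof.
by apply: eq_rep (rep_aB lid rid cfh rl cm m) => x Dx; rewrite /= val_B.
Qed.
Lemma gr_Lap w F : gsm w -> gr c w F -> gr c (Lap w) (alap cY (@spd R D) cgi F).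
Proof.
move=> gw h; apply: eq_rep (rep_alap lid rid cfh rl cm h) => x Dx.
by rewrite /= val_Lap.
Qed.
Lemma gr_Gam u w F G : gsm u -> gsm w -> gr c u F -> gr c w G ->
  gr c (Gam u w) (agrad (@spd R D) cgi F G).
Proof.
move=> gu gw h h'; apply: eq_rep (rep_agrad lid rid cfh rl h h') => x Dx.
by rewrite /= val_Gam.
Qed.
End OneChart.

Lemma gr_gsm w : (forall c (ac : atlas c), exists F, gr c w F) -> gsm w.
Proof.
move=> h c ac k; have [F rF] := h c ac.
apply: Ck_congr (sre_sm F k); first exact: cod_open.
by move=> x Dx; exact: (rep_re rF Dx).
Qed.

Lemma gsm_S : gsm (surface_fun f (@Stilde R n)).
Proof. by apply: gr_gsm => c ac; eexists; exact: (gr_S ac). Qed.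
Lemma gsm_C : gsm (surface_fun f (@cconst R n)).
Proof. by apply: gr_gsm => c ac; eexists; exact: (gr_C ac). Qed.
Lemma gsm_B m : gsm (surface_fun f (fun X => Btilde X m)).
Proof. by apply: gr_gsm => c ac; eexists; exact: (gr_B ac m). Qed.
Lemma gsm_Lap w : gsm w -> gsm (Lap w).
Proof. by move=> gw; apply: gr_gsm => c ac; eexists; exact: (gr_Lap ac gw (gr_gel ac gw)). Qed.
Lemma gsm_Gam u w : gsm u -> gsm w -> gsm (Gam u w).
Proof.
move=> gu gw; apply: gr_gsm => c ac; eexists.
exact: (gr_Gam ac gu gw (gr_gel ac gu) (gr_gel ac gw)).
Qed.

Lemma gr_eq c x w w' F : gr c w F -> gr c w' F -> cod c x -> w (bwd c x) = w' (bwd c x).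
Proof. by move=> h h' Dx; rewrite -[LHS](rep_re h Dx) (rep_re h' Dx). Qed.

Lemma grD c u w F G : gr c u F -> gr c w G -> gr c (fun p => u p + w p) (F + G).
Proof. exact: repD. Qed.
Lemma grN c u F : gr c u F -> gr c (fun p => - u p) (- F).
Proof. exact: repN. Qed.
Lemma grM c u w F G : gr c u F -> gr c w G -> gr c (fun p => u p * w p) (F * G).
Proof. exact: repM. Qed.
Lemma gr_nat c k : gr c (fun _ => k%:R) (k%:R).
Proof.
elim: k => [|k IH]; first exact: rep0.
move=> x Dx; rewrite /= !mulrS sreD simD sim1 (sre1 Dx) (rep_re IH Dx) (rep_im IH Dx).
by rewrite addr0.
Qed.
Lemma gr_half c : gr c (fun _ => 2^-1) (shalf (codo c)).
Proof. exact: rep_half. Qed.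

(** Statements about a point of the surface are verified in the chart selected around it. *)
Lemma gr_pt (Q : M -> Prop) : (forall c (ac : atlas c) x, cod c x -> Q (bwd c x)) -> forall p, Q p.
Proof.
move=> h p; rewrite -(fwdK (chart_at_dom p)); apply: h; first exact: chart_at_atlas.
exact: fwd_cod (chart_at_dom p).
Qed.

End Glob.

Lemma metric_sym (R : realType) n (X : R * R -> 'rV[R]_n.+1) x i j :
  metric X x i j = metric X x j i.
Proof.
rewrite [LHS]mxE [RHS]mxE; move: (pd i X x) (pd j X x) => u w.
by apply: eq_bigr => k _; exact: mulrC.
Qed.

(** * Green's formula for a function supported in one chart *)

Section Integration.
Variables (R : realType) (n : nat) (M : closedSurface R).
Variable f : M -> 'rV[R]_n.+1.
Variable mu : {measure set (borel M) -> \bar R}.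
Hypothesis fi : sphere_immersion f.
Hypothesis am : is_area_measure f mu.
Local Notation P := (measurableTypeR R * measurableTypeR R)%type.
Local Notation la := (@lebesgue_measure R \x @lebesgue_measure R)%E.
Local Notation pds i F := (@pd R R^o i (F : R * R -> R^o)).
Implicit Types (c d : chart R M) (u w : M -> R).
#[local] Opaque derive spd.

Lemma gsm_cont w : gsm w -> continuous w.
Proof.
move=> gw p; have ac := chart_at_atlas p; have dp := chart_at_dom p.
move: (chart_at p) ac dp => c ac dp.
have cw : {for fwd c p, continuous (w \o bwd c)} by exact: (Ck_cont (gw c ac 0%N) (fwd_cod dp)).
have cf : {for p, continuous (fwd c)} by exact: fwd_continuous.
have : {for p, continuous ((w \o bwd c) \o fwd c)} by exact: continuous_comp cf cw.
move=> h; have {}h : ((w \o bwd c) \o fwd c) @ p --> w p by rewrite -[X in w X](fwdK dp).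
apply: cvg_trans h; apply: near_eq_cvg.
have : nbhs p (dom c) by apply: open_nbhs_nbhs; split=> //; exact: dom_open.
by apply: filterS => q dq /=; rewrite fwdK.
Qed.

Lemma open_meas (B : set M) : open B -> measurable (B : set (borel M)).
Proof. by move=> oB; exact: sub_sigma_algebra. Qed.

Lemma cont_meas w : continuous w -> measurable_fun [set: borel M] w.
Proof.
move=> cw; apply: measurable_fun_openP => B oB; rewrite setTI.
by apply: open_meas; apply: (open_comp _ oB) => q _; exact: cw.
Qed.

Lemma det2 (A : 'M[R]_2) : \det A = A ord0 ord0 * A ord_max ord_max - A ord0 ord_max * A ord_max ord0.
Proof.
rewrite (expand_det_row _ ord0) sum_I2 /cofactor !det_mx11 !mxE /= expr0 mul1r.
rewrite (_ : (0 + 1)%N = 1%N) // expr1 mulN1r mulrN.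
by congr (_ * A _ _ - _ * A _ _); apply/val_inj.
Qed.

Section OneChart.
Variable c : chart R M.
Hypothesis ac : atlas c.
Local Notation Xc := (f \o bwd c).
Local Notation D := (codo c).
Let sX := ch_sm fi ac.
Let rf := ch_rf fi ac.
Let ar := sarea sX rf.

Lemma area_sarea x : cod c x -> area_density Xc x = sre ar x.
Proof.
move=> Dx; rewrite (sarea_re sX rf Dx) /area_density det2 /mdet expr2.
by congr (Num.sqrt (_ - _ * _)); exact: metric_sym.
Qed.

Lemma mu_chart (A : set (borel M)) : measurable A -> A `<=` dom c ->
  mu A = (\int[la]_(x in (cod c : set P) `&` bwd c @^-1` A) (sre ar x)%:E)%E.
Proof.
move=> mA Ad; rewrite (am ac mA Ad).
have -> : fwd c @` A = (cod c : set P) `&` bwd c @^-1` A.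
  apply/seteqP; split=> [_ [p Ap <-]|x [Dx Ax]].
    by split; [apply: fwd_cod; exact: Ad|rewrite /preimage /= fwdK //; exact: Ad].
  by exists (bwd c x) => //; exact: bwdK.
by apply: eq_integral => x; rewrite inE => -[Dx _]; rewrite area_sarea.
Qed.

Let mcod : measurable (cod c : set P). Proof. by apply: open_measurable2; exact: cod_open. Qed.
Let mdom : measurable (dom c : set (borel M)). Proof. by apply: open_meas; exact: dom_open. Qed.

Lemma sre_meas (F : sfun D) : measurable_fun (cod c : set P) (sre F).
Proof.
apply: cont_measurable2; first exact: cod_open.
by move=> x Dx; exact: (Ck_cont (sre_sm F 0%N) Dx).
Qed.

Lemma bwd_meas : measurable_fun (cod c : set P) (bwd c : P -> borel M).
Proof.
have h : preimage_set_system (cod c : set P) (bwd c : P -> borel M) (@open M) `<=` measurable.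
  move=> _ [B oB <-].
  by apply: open_measurable2; apply: open_preim oB; [exact: cod_open|exact: bwd_continuous].
exact: (@measurability _ _ P (borel M) (cod c : set P) (bwd c) (@open M) erefl h).
Qed.

Lemma chart_int w : continuous w ->
  (\int[mu]_(p in dom c) (w p)%:E = \int[la]_(x in cod c) (w (bwd c x) * sre ar x)%:E)%E.
Proof.
move=> cw; apply: (transfer mdom mcod bwd_meas (sre_meas ar)).
- by move=> x Dx; apply: ltW; exact: sarea_gt0.
- exact: bwd_dom.
- exact: mu_chart.
- by apply: measurable_funTS; exact: cont_meas.
Qed.

(** [K] will contain the support of a function read in the chart; [L] confines it to an open square,
    as the integration over lines requires. *)
Definition boxin (K : set (R * R)) (L : R) := [/\ 0 < L, compact K, K `<=` cod c &
  forall x, L <= `|x.1| \/ L <= `|x.2| -> ~ K x].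

Lemma bwd_closed K L : boxin K L -> closed (bwd c @` K).
Proof.
move=> [_ cK Kc _]; apply: compact_closed; first exact: surface_hausdorff.
apply: continuous_compact => //.
by apply: continuous_in_subspaceT => y; rewrite inE => /Kc; exact: bwd_continuous.
Qed.

(* [v] lives in the chart, so Green's formula reduces to the divergence theorem
   for the compactly supported field [sqrt (det g) g^ij v d_j w]. *)
Lemma green_chart v w K L : gsm v -> gsm w -> boxin K L ->
  (forall p, v p != 0 -> dom c p /\ K (fwd c p)) ->
  (\int[mu]_p (v p * Lap f w p + Gam f v w p)%:E = 0)%E.
Proof.
move=> gv gw bK sv; have [L0 cK Kc KL] := bK.
have clK : closed K by apply: compact_closed cK; exact: norm_hausdorff.
pose K' := bwd c @` K; have cK' : closed K' := bwd_closed bK.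
have v0 p : ~ K' p -> v p = 0.
  move=> nK; apply/eqP/negP => /negP v1; have [dp Kp] := sv p v1.
  by apply: nK; exists (fwd c p) => //; exact: fwdK.
pose h p := v p * Lap f w p + Gam f v w p.
have gh : gsm h by apply: gsmD; [apply: gsmM => //; exact: gsm_Lap|exact: gsm_Gam].
have ch := gsm_cont gh.
(* The gradient product vanishes off [K'] as well, since [v] is zero on the open complement of this
   closed set. *)
have h0 p : ~ K' p -> h p = 0.
  move: p; apply: gr_pt => d ad x Dx nK.
  rewrite /h v0 // mul0r add0r (val_Gam fi ad gv gw Dx).
  rewrite /gradb big1 // => i _; rewrite big1 // => j _.
  have oU : open (cod d `&` bwd d @^-1` (~` K')).
    apply: open_preim; [exact: cod_open|exact: bwd_continuous|exact: closed_openC].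
  rewrite (pd_congr (F := v \o bwd d) (G := cst 0) i oU) //; last by move=> y [_ ny]; exact: v0.
  by rewrite [pd _ (cst _) _]derive_cst mul0r mulr0.
have -> : (\int[mu]_p (h p)%:E = \int[mu]_(p in dom c) (h p)%:E)%E.
  rewrite [RHS]integral_mkcond; apply: eq_integral => p _; rewrite /patch.
  case: ifPn => //; rewrite notin_setE => nd; rewrite h0 // => -[x Kx xp].
  by apply: nd; rewrite -xp; apply: bwd_dom; exact: Kc.
rewrite chart_int //.
pose V := gel ac gv; pose W := gel ac gw.
pose Fi i : sfun D := ar * \sum_j cgi fi ac i j * (V * spd j W).
have V0 x : ~ K x -> sre V x = 0.
  move=> nK; have [Dx|nD] := pselect (cod c x); last exact: sre_off.
  rewrite (rep_re (gr_gel ac gv) Dx) /= v0 // => -[y Ky yx]; apply: nK.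
  by rewrite -(bwdK Dx) -yx bwdK //; exact: Kc.
have Vi x : sim V x = 0.
  by have [Dx|nD] := pselect (cod c x); [exact: (rep_im (gr_gel ac gv) Dx)|exact: sim_off].
have F0 i x : ~ K x -> sre (Fi i) x = 0.
  move=> nK.
  have z1 (U : sfun D) : sre (V * U) x = 0 by rewrite sreM (V0 x nK) (Vi x) !mul0r subr0.
  have z2 (U : sfun D) : sim (V * U) x = 0 by rewrite simM (V0 x nK) (Vi x) !mul0r addr0.
  have z3 (T U : sfun D) : sre (T * (V * U)) x = 0 by rewrite sreM z1 z2 !mulr0 subr0.
  have z4 (T0 T1 U0 U1 : sfun D) : sre (ar * (T0 * (V * U0) + T1 * (V * U1))) x = 0.
    clear -z3; rewrite mulrDr (mulrA ar T0) (mulrA ar T1) sreD !z3.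
    exact: addr0.
  have -> : Fi i = ar * (cgi fi ac i ord0 * (V * spd ord0 W) + cgi fi ac i ord_max * (V * spd ord_max W)).
    exact: (congr1 ( *%R ar) (sum_I2 _)).
  exact: z4.
have oK : open (~` K) by exact: closed_openC.
(* The field is smooth on the whole plane: on the chart image by construction, on the complement of
   [K] as the zero function, and these two open sets cover the plane. *)
have sF i : Csm setT (sre (Fi i) : R * R -> R^o).
  move=> k; apply: Ck_local => x _; have [Dx|nD] := pselect (cod c x).
    by exists (cod c); split; [exact: cod_open|exact: Dx|exact: (sre_sm (Fi i) k)].
  exists (~` K); split=> //; first by move=> /Kc.
  by apply: Ck_congr (Ck_cst k _ 0) => // y ny; rewrite F0.
have FL i x : L <= `|x.1| \/ L <= `|x.2| -> sre (Fi i) x = 0 by move=> /KL; exact: F0.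
have I0 := int_pd0 ord0 L0 (sF ord0) (FL ord0).
have I1 := int_pd0 ord_max L0 (sF ord_max) (FL ord_max).
have dv : ar * (V * alap (cY fi ac) (@spd R D) (cgi fi ac) W + agrad (@spd R D) (cgi fi ac) V W) =
   \sum_i spd i (Fi i).
  apply: (divergence (cfh fi ac) _ _ (sbetaK sX rf) (sarea_sq sX rf)).
  - by move=> i j y; exact: spd_comm2.
  - exact: imm_comm.
have hE x : cod c x -> h (bwd c x) * sre ar x = pds ord0 (sre (Fi ord0)) x + pds ord_max (sre (Fi ord_max)) x.
  move=> Dx.
  have rh : gr c h (V * alap (cY fi ac) (@spd R D) (cgi fi ac) W + agrad (@spd R D) (cgi fi ac) V W).
    apply: grD.
      by apply: grM; [exact: gr_gel|apply: gr_Lap => //; exact: gr_gel].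
    by apply: gr_Gam => //; exact: gr_gel.
  have E : sre (ar * (V * alap (cY fi ac) (@spd R D) (cgi fi ac) W + agrad (@spd R D) (cgi fi ac) V W)) x =
    sre (\sum_i spd i (Fi i)) x by rewrite dv.
  rewrite sreM sarea_im mul0r subr0 (rep_re rh Dx) sum_I2 sreD in E.
  rewrite mulrC E.
  by congr (_ + _); exact: cutE.
pose G i x := pds i (sre (Fi i)) x.
transitivity (\int[la]_(x in cod c) (G ord0 x + G ord_max x)%:E)%E.
  by apply: eq_integral => x; rewrite inE => Dx; rewrite hE.
have G0 i x : ~ K x -> G i x = 0.
  move=> nK; rewrite /G (pd_congr (G := cst 0) i oK nK); first by rewrite /pd derive_cst.
  by move=> y ny; exact: F0.
transitivity (\int[la]_x (G ord0 x + G ord_max x)%:E)%E.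
  rewrite integral_mkcond; apply: eq_integral => x _; rewrite /patch.
  case: ifPn => //; rewrite notin_setE => nd; rewrite !G0 ?addr0 // => /Kc //.
under eq_integral do rewrite EFinD.
rewrite integralD //; [|exact: I0.1|exact: I1.1].
by rewrite I0.2 I1.2 adde0.
Qed.

End OneChart.
End Integration.

(** * Partition of unity, Green's formula on the surface, vanishing of subsolutions *)

Section Global.
Variables (R : realType) (n : nat) (M : closedSurface R).
Variable f : M -> 'rV[R]_n.+1.
Variable mu : {measure set (borel M) -> \bar R}.
Hypothesis fi : sphere_immersion f.
Hypothesis am : is_area_measure f mu.
Local Notation P := (measurableTypeR R * measurableTypeR R)%type.
Local Notation la := (@lebesgue_measure R \x @lebesgue_measure R)%E.
Local Notation pds i F := (@pd R R^o i (F : R * R -> R^o)).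
Implicit Types (c d : chart R M) (u w : M -> R).
#[local] Opaque derive spd.

Definition cube (a : R * R) (r : R) : set P :=
  `[a.1 - r, a.1 + r] `*` `[a.2 - r, a.2 + r].

Lemma cubeP (a : R * R) r (x : R * R) : cube a r x <-> `|x.1 - a.1| <= r /\ `|x.2 - a.2| <= r.
Proof.
rewrite /cube /= !in_itv /= !ler_distl.
by split=> -[h1 h2]; split=> //; move: h1 h2.
Qed.

(** The extra 1 in the bound keeps the closed cube strictly inside the square. *)
Lemma cube_boxin c a r : 0 < r -> cube a r `<=` cod c ->
  boxin c (cube a r) (`|a.1| + `|a.2| + r + 1).
Proof.
move=> r0 s; split=> //.
- by rewrite ltr_wpDl // !addr_ge0 // ltW.
- by apply: compact_setX; exact: segment_compact.
- move=> x h /cubeP [h1 h2].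
  have t1 : `|x.1| <= `|a.1| + r.
    by rewrite -[x.1](subrK a.1); apply: le_trans (ler_normD _ _) _; rewrite addrC lerD2l.
  have t2 : `|x.2| <= `|a.2| + r.
    by rewrite -[x.2](subrK a.2); apply: le_trans (ler_normD _ _) _; rewrite addrC lerD2l.
  have n1 := normr_ge0 a.1; have n2 := normr_ge0 a.2.
  by case: h => h; lra.
Qed.

Lemma nbhs_cube (a : R * R) (U : set (R * R)) : nbhs a U -> exists2 r : R, 0 < r & cube a r `<=` U.
Proof.
move=> /nbhs_ballP[e /= e0 be]; exists (e / 2); first by rewrite divr_gt0.
move=> x /cubeP [h1 h2]; apply: be.
have e2 : e / 2 < e by rewrite ltr_pdivrMr // ltr_pMr // ltr1n.
by split; rewrite /ball /= distrC; [apply: le_lt_trans h1 _|apply: le_lt_trans h2 _].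
Qed.

Definition ub c a r (q : M) : R := if pselect (dom c q) then bump a r (fwd c q) else 0.

Lemma ub_supp c a r q : 0 < r -> ub c a r q != 0 -> dom c q /\ cube a r (fwd c q).
Proof.
move=> r0; rewrite /ub; case: (pselect (dom c q)) => [dq h|_ /eqP []] //.
by split=> //; apply/cubeP; apply: bump_off h; exact: ltW.
Qed.

Lemma ub_ge0 c a r q : 0 <= ub c a r q.
Proof. by rewrite /ub; case: (pselect (dom c q)) => dq; [exact: bump_ge0|exact: lexx]. Qed.

(** Two open sets cover the surface: the chart domain, where the function is a bump composed with a
    transition map, and the complement of the image of the cube, where it is zero. That image is
    closed, being compact in a Hausdorff space. *)
Lemma gsm_ub c a r : atlas c -> 0 < r -> cube a r `<=` cod c -> gsm (ub c a r).
Proof.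
move=> ac r0 s d ad k; apply: Ck_local => x Dx.
have [dx|nd] := pselect (dom c (bwd d x)).
  exists (os (overlap d c)); split; [exact: overlap_open|by split|].
  have h1 := trans_sm ord0 ad ac k; have h2 := trans_sm ord_max ad ac k.
  have H : Ck k (os (overlap d c)) ((fun y => bump a r (trans d c y)) : R * R -> R^o).
    apply: (@Ck_comp R k setT (os (overlap d c)) (trans d c) (bump a r : R * R -> R^o)) => //;
      first [exact: openT|exact: overlap_open|exact: h1|exact: h2|exact: bump_sm].
  apply: Ck_congr H; first exact: overlap_open.
  by move=> y [Dy dy]; rewrite /= /ub; case: (pselect (dom c (bwd d y))).
have cK := bwd_closed (cube_boxin r0 s).
exists (cod d `&` bwd d @^-1` (~` (bwd c @` cube a r))); split.
- by apply: open_preim; [exact: cod_open|exact: bwd_continuous|exact: closed_openC].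
- by split=> // -[y Ky yx]; apply: nd; rewrite -yx; apply: bwd_dom; exact: s.
- apply: Ck_congr (Ck_cst k _ 0).
    by apply: open_preim; [exact: cod_open|exact: bwd_continuous|exact: closed_openC].
  move=> y [Dy ny]; apply/esym/eqP/negPn/negP => h.
  have [dq Kq] := ub_supp r0 h; apply: ny; exists (fwd c (bwd d y)) => //.
  exact: fwdK.
Qed.

Lemma box_at (p : M) : exists2 r : R, 0 < r & cube (fwd (chart_at p) p) r `<=` cod (chart_at p).
Proof.
apply: nbhs_cube; apply: open_nbhs_nbhs; split; first exact: cod_open.
by apply: fwd_cod; exact: chart_at_dom.
Qed.
Definition rad (p : M) : R := s2val (cid2 (box_at p)).
Lemma rad_gt0 p : 0 < rad p. Proof. exact: (s2valP (cid2 (box_at p))). Qed.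
Lemma rad_cod p : cube (fwd (chart_at p) p) (rad p) `<=` cod (chart_at p).
Proof. exact: (s2valP' (cid2 (box_at p))). Qed.

Definition psi (p q : M) := ub (chart_at p) (fwd (chart_at p) p) (rad p) q.
Lemma gsm_psi p : gsm (psi p).
Proof. by apply: gsm_ub; [exact: chart_at_atlas|exact: rad_gt0|exact: rad_cod]. Qed.
Lemma psi_gt0 p : 0 < psi p p.
Proof.
rewrite /psi /ub; case: (pselect (dom (chart_at p) p)) => dp; last by case: dp; exact: chart_at_dom.
by apply: bump_gt0; exact: rad_gt0.
Qed.

Lemma psi_open p : open [set q | 0 < psi p q].
Proof.
by apply: (open_comp _ (@open_gt R 0)) => q _; exact: (gsm_cont (gsm_psi p)).
Qed.

Lemma psi_cover : exists s : seq M, forall q, exists2 p, p \in s & 0 < psi p q.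
Proof.
have := @surface_compact R M; rewrite compact_cover => cM.
have [||D' _ cov] := cM M setT (fun p => [set q | 0 < psi p q]).
- by move=> p _; exact: psi_open.
- by move=> q _; exists q => //; exact: psi_gt0.
- by exists (finmap.enum_fset D') => q; have [p Dp pq] := cov q I; exists p.
Qed.

Lemma gsm_integrable_if w : (mu setT < +oo)%E -> gsm w -> mu.-integrable setT (EFin \o w).
Proof.
move=> fm gw; have cw := gsm_cont gw.
apply: measurable_bounded_integrable => //; first exact: cont_meas.
have := @surface_compact R M => cM.
have := compact_bounded (continuous_compact (continuous_subspaceT cw) cM).
rewrite /bounded_set /bounded_near; apply: filterS => B hB x _ /=.
by apply: hB; exists x.
Qed.

(** The area density is continuous, hence bounded on the compact cube; with [psi_cover] this makes
    the total area finite. *)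
Lemma psi_finite p : (mu [set q | (0 < psi p q)%R] < +oo)%E.
Proof.
have ac := chart_at_atlas p; have r0 := rad_gt0 p; have s := rad_cod (p := p).
have mA := open_meas (psi_open p).
have supp q : 0 < psi p q -> dom (chart_at p) q /\ cube (fwd (chart_at p) p) (rad p) (fwd (chart_at p) q).
  by move=> h; apply: (ub_supp r0); rewrite gt_eqF.
rewrite (mu_chart fi am ac mA); last by move=> q /supp [].
move: (fwd (chart_at p) p) (rad p) r0 s supp => a r r0 s supp.
set ar := sarea _ _.
have mK : measurable (cube a r) by exact: measurable_box2.
have arc : {within cube a r, continuous (sre ar : R * R -> R)}.
  by apply: continuous_in_subspaceT => x; rewrite inE => /s Dx; exact: (Ck_cont (sre_sm ar 0%N) Dx).
have mar : measurable_fun (cube a r) (sre ar).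
  apply: (measurable_funS _ s (sre_meas ar)).
  by apply: open_measurable2; exact: cod_open.
have iar : la.-integrable (cube a r) (EFin \o sre ar).
  apply: measurable_bounded_integrable => //.
    have h1 : a.1 - r < a.1 + r by lra.
    have h2 : a.2 - r < a.2 + r by lra.
    exact: (eq_ind_r (fun z => (z < +oo)%E) (ltry _) (la_box h1 h2)).
  have cK : compact (cube a r : set (R * R)) by apply: compact_setX; exact: segment_compact.
  have := compact_bounded (continuous_compact arc cK).
  rewrite /bounded_set /bounded_near; apply: filterS => B hB x Kx /=.
  by apply: hB; exists x.
have ar0 x : cube a r x -> (0 <= (sre ar x)%:E)%E.
  by move=> /s Dx; rewrite lee_fin; apply: ltW; exact: sarea_gt0.
apply: le_lt_trans (integrable_lty mK iar).
apply: ge0_subset_integral => //.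
- apply: open_measurable2; apply: open_preim (psi_open p); first exact: cod_open.
  exact: bwd_continuous.
- exact/measurable_EFinP.
- by move=> x [Dx /supp [_]]; rewrite bwdK.
Qed.

Lemma mu_finite : (mu setT < +oo)%E.
Proof.
have [s cov] := psi_cover.
have H (t : seq M) : measurable ([set q | exists2 p, p \in t & 0 < psi p q] : set (borel M)) /\
   (mu [set q | exists2 p, p \in t & (0 < psi p q)%R] < +oo)%E.
  elim: t => [|p t [mt IH]].
    have -> : [set q | exists2 p, p \in [::] & 0 < psi p q] = set0 :> set M.
      by rewrite -subset0 => q [].
    by rewrite measure0; split; [exact: measurable0|exact: ltry].
  have E : [set q | exists2 p', p' \in p :: t & 0 < psi p' q] =
    [set q | 0 < psi p q] `|` [set q | exists2 p, p \in t & 0 < psi p q].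
    apply/seteqP; split=> q /=.
      by move=> [p']; rewrite inE => /orP[/eqP ->|pt] h; [left|right; exists p'].
    move=> [h|[p' pt h]]; first by exists p; rewrite ?mem_head.
    by exists p'; rewrite // inE pt orbT.
  have mp := open_meas (psi_open p).
  rewrite E; split; first exact: measurableU.
  apply: le_lt_trans (measureU2 mu mp mt) _.
  by apply: lte_add_pinfty; first exact: psi_finite.
have [_] := H s; congr (mu _ < _)%E; apply/seteqP; split=> q // _.
exact: cov.
Qed.

Lemma gsm_integrable w : gsm w -> mu.-integrable setT (EFin \o w).
Proof. exact: gsm_integrable_if mu_finite. Qed.

Lemma RintD u w : gsm u -> gsm w ->
  \int[mu]_p (u p + w p) = \int[mu]_p u p + \int[mu]_p w p.
Proof. by move=> gu gw; apply: RintegralD => //; exact: gsm_integrable. Qed.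
Lemma RintZ a w : gsm w -> \int[mu]_p (a * w p) = a * \int[mu]_p w p.
Proof. by move=> gw; apply: RintegralZl => //; exact: gsm_integrable. Qed.

Lemma GamD u u' w p : gsm u -> gsm u' -> Gam f (fun q => u q + u' q) w p = Gam f u w p + Gam f u' w p.
Proof.
move=> gu gu'; rewrite /Gam /gradb -big_split; apply: eq_bigr => i _.
rewrite -big_split; apply: eq_bigr => j _ /=; rewrite -mulrDr -mulrDl.
congr (_ * (_ * _)); have ac := chart_at_atlas p.
have Dx := fwd_cod (chart_at_dom p).
by apply: pdD; [exact: (Ck_derivable (gu _ ac 1%N))|exact: (Ck_derivable (gu' _ ac 1%N))].
Qed.

Lemma Gam_cst a w p : Gam f (fun=> a) w p = 0.
Proof.
rewrite /Gam /gradb big1 // => i _; rewrite big1 // => j _.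
by rewrite [pd i _ _](derive_cst _ _) mul0r mulr0.
Qed.

(** Only [u] is cut into pieces: each integrand lives where its piece of [u] does, whatever [w]
    is. *)
Lemma green u w : gsm u -> gsm w -> \int[mu]_p (u p * Lap f w p + Gam f u w p) = 0.
Proof.
move=> gu gw; have [s cov] := psi_cover.
pose Psi q := \sum_(p <- s) psi p q.
have Psi0 q : 0 < Psi q.
  have [p ps pq] := cov q; rewrite /Psi (big_rem p) //=.
  by apply: ltr_wpDr pq; apply: sumr_ge0 => i _; exact: ub_ge0.
have gsum (t : seq M) (G : M -> M -> R) : (forall p, gsm (G p)) -> gsm (fun q => \sum_(p <- t) G p q).
  move=> hG; elim: t => [|p t IH].
    have -> : (fun q => \sum_(p <- [::]) G p q) = (fun=> 0) by apply/funext => q; rewrite big_nil.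
    exact: gsm_cst.
  have -> : (fun q => \sum_(p <- p :: t) G p q) = (fun q => G p q + \sum_(p <- t) G p q).
    by apply/funext => q; rewrite big_cons.
  exact: gsmD.
have gPsi : gsm Psi by apply: gsum; exact: gsm_psi.
(* The division that turns the bumps into a partition of unity is put into the function, so that
   each piece is a bump times a smooth function. *)
pose u' q := u q * (Psi q)^-1.
have gu' : gsm u' by apply: gsmM => //; apply: gsmV => // q; rewrite gt_eqF.
pose G p q := psi p q * u' q.
have gG p : gsm (G p) by apply: gsmM => //; exact: gsm_psi.
have uE : u = (fun q => \sum_(p <- s) G p q).
  apply/funext => q; rewrite /G -mulr_suml -/(Psi q) /u' mulrCA divff ?mulr1 //.
  by rewrite gt_eqF.
have K0 p : \int[mu]_q (G p q * Lap f w q + Gam f (G p) w q) = 0.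
  rewrite /Rintegral (green_chart fi am (chart_at_atlas p) (gG p) gw
    (cube_boxin (rad_gt0 p) (rad_cod (p := p)))) // => q.
  rewrite /G mulf_eq0 negb_or => /andP[h _]; exact: (ub_supp (rad_gt0 p) h).
(* The induction is on the list of summands only: [Psi], hidden in [G], keeps the full list. *)
rewrite uE; elim: (s) => [|p t IH].
  transitivity (\int[mu]_(q in setT) (0 : R)); last by rewrite Rintegral_cst // mul0r.
  apply: eq_Rintegral => q _.
  have -> : (fun q => \sum_(p <- [::]) G p q) = (fun=> 0) by apply/funext => z; rewrite big_nil.
  by rewrite Gam_cst big_nil mul0r addr0.
transitivity (\int[mu]_q ((G p q * Lap f w q + Gam f (G p) w q) +
   ((\sum_(p <- t) G p q) * Lap f w q + Gam f (fun q => \sum_(p <- t) G p q) w q))).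
  apply: eq_Rintegral => q _.
  have -> : (fun q => \sum_(p <- p :: t) G p q) = (fun q => G p q + \sum_(p <- t) G p q).
    by apply/funext => z; rewrite big_cons.
  by rewrite GamD //; [rewrite big_cons; ring|exact: gsum].
have gL := gsm_Lap fi gw.
rewrite RintD ?K0 ?IH ?addr0 //.
- by apply: gsmD; [exact: gsmM|exact: gsm_Gam].
- by apply: gsmD; [apply: gsmM => //; exact: gsum|apply: gsm_Gam => //; exact: gsum].
Qed.
(** If [w] were positive at [p], then in a chart [w] times the area density would stay above half of
    its value there on a small cube, and the integral would be positive. *)
Lemma pos_int w : gsm w -> (forall p, 0 <= w p) -> \int[mu]_p w p = 0 -> forall p, w p = 0.
Proof.
move=> gw w0 iw p; apply/eqP/negPn/negP => wp.
have {}wp : 0 < w p by rewrite lt_def wp w0.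
have iE : (\int[mu]_q (w q)%:E = 0)%E.
  by rewrite -(fineK (integrable_fin_num measurableT (gsm_integrable gw))) -/(Rintegral _ _ _) iw.
have ac := chart_at_atlas p; have dp := chart_at_dom p.
have := chart_int fi am ac (gsm_cont gw).
move: (chart_at p) ac dp => c ac dp; set ar := sarea _ _ => ci.
pose F x := w (bwd c x) * sre ar x; pose a := fwd c p.
have Da : cod c a by exact: fwd_cod.
have cF x : cod c x -> {for x, continuous (F : R * R -> R^o)}.
  move=> Dx; apply: (Ck_cont (k := 0%N) (D := cod c)) Dx.
  by apply: CkM; [exact: cod_open|exact: gw|exact: (sre_sm ar)].
have Fa : 0 < F a by rewrite /F /a fwdK // mulr_gt0 //; exact: sarea_gt0.
have [r r0 rc] : exists2 r : R, 0 < r & cube a r `<=` cod c `&` [set x | F a / 2 < F x].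
  apply: nbhs_cube; apply: filterI; first by apply: open_nbhs_nbhs; split=> //; exact: cod_open.
  have h2 : F a / 2 < F a by rewrite ltr_pdivrMr // ltr_pMr // ltr1n.
  exact: (cF a Da _ (lt_nbhsr h2)).
have mK : measurable (cube a r) by exact: measurable_box2.
have mcod : measurable (cod c : set P) by apply: open_measurable2; exact: cod_open.
have mF : measurable_fun (cod c : set P) F.
  by apply: cont_measurable2; [exact: cod_open|exact: cF].
have F0 x : cod c x -> (0 <= (F x)%:E)%E.
  by move=> Dx; rewrite lee_fin mulr_ge0 //; apply: ltW; exact: sarea_gt0.
have /measurable_EFinP mw := cont_meas (gsm_cont gw).
have h1 : (\int[mu]_(q in dom c) (w q)%:E <= \int[mu]_q (w q)%:E)%E.
  apply: ge0_subset_integral => //; first by apply: open_meas; exact: dom_open.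
  by move=> q _; rewrite lee_fin.
have h2 : (\int[la]_(x in cube a r) (F x)%:E <= \int[la]_(x in cod c) (F x)%:E)%E.
  apply: ge0_subset_integral => //; first exact/measurable_EFinP.
  by move=> x Kx; exact: (rc x Kx).1.
have h3 : (\int[la]_(x in cube a r) (cst (F a / 2)%:E) x <= \int[la]_(x in cube a r) (F x)%:E)%E.
  apply: ge0_le_integral => //.
  - by move=> x _; rewrite lee_fin divr_ge0 // ltW.
    - apply/measurable_EFinP; apply: (measurable_funS mcod _ mF) => x Kx; exact: (rc x Kx).1.
  - by move=> x Kx; rewrite lee_fin; apply: ltW; exact: (rc x Kx).2.
have q1 : a.1 - r < a.1 + r by lra.
have q2 : a.2 - r < a.2 + r by lra.
rewrite integral_cst // in h3.
have := le_trans h3 (le_trans h2 _); rewrite -ci => /(_ _ h1); rewrite iE.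
move=> h4.
have : ((F a / 2 * ((a.1 + r - (a.1 - r)) * (a.2 + r - (a.2 - r))))%:E <= 0)%E.
  apply: le_trans h4; rewrite EFinM.
  exact: (eq_ind_r (fun z => ((F a / 2)%:E * _ <= (F a / 2)%:E * z)%E) (lexx _) (la_box q1 q2)).
rewrite lee_fin leNgt => /negP; apply.
apply: mulr_gt0; first exact: divr_gt0.
by apply: mulr_gt0; rewrite subr_gt0.
Qed.

(** The Laplacian is nonnegative and its integral vanishes by Green's formula with the constant 1,
    so it is zero everywhere; then [k] times [w] is at most zero. *)
Lemma vanish (k w : M -> R) : gsm w -> (forall p, 0 <= w p) -> (forall p, 0 < k p) ->
  (forall p, k p * w p <= Lap f w p) -> forall p, w p = 0.
Proof.
move=> gw w0 k0 h; have gL := gsm_Lap fi gw.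
have L0 p : 0 <= Lap f w p by apply: le_trans (h p); rewrite mulr_ge0 // ltW.
have iL : \int[mu]_p Lap f w p = 0.
  rewrite -(green (gsm_cst 1) gw); apply: eq_Rintegral => p _.
  by rewrite Gam_cst mul1r addr0.
move=> p; have := h p; rewrite (pos_int gL L0 iL p) pmulr_rle0 // => w1.
by apply/eqP; rewrite eq_le w1 w0.
Qed.
End Global.

(** * The integral formulas *)

Section ChartIdentities.
Variables (R : realType) (n : nat) (D : oset R).
Local Notation P := (R * R)%type.
Local Notation i0 := (ord0 : 'I_2).
Local Notation i1 := (ord_max : 'I_2).
Variable X : P -> 'rV[R]_n.+1.
Hypothesis sX : smooth_on (os D) X.
Hypothesis X1 : forall x, os D x -> dot (X x) (X x) = 1.
Hypothesis rfX : forall x, os D x -> row_free (Defs.jacobian X x).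
Hypothesis parX : forall x, os D x -> forall k, normal_deriv X k (mean_curv X) x = 0.
#[local] Opaque derive spd.

Local Notation A := (sfun D).
Local Notation Y := (imm sX).
Local Notation gi := (sgi sX rfX).
Local Notation half := (shalf D).
Local Notation E := (nD sX rfX i0).
Local Notation F := (nD sX rfX i1).
Let fh := imm_frame sX X1 rfX.
Let rl i j x (Dx : os D x) : sim (gi i j) x = 0 := sgi_real sX rfX i j Dx.
Let lid := link_id D.
Let rid : repv id X Y := rep_imm sX.
Let QP := nQP sX rfX.

Lemma imm_parallel k : ncov Y (@spd R D) gi k (mcv half Y (@spd R D) gi) = 0.
Proof.
apply/rowP => j; rewrite [RHS]mxE; apply: sfun_ext => x Dx.
  rewrite (rep_re (repv_ncov lid rid fh rl k (repv_mcv lid rid fh rl) j) Dx) parX //.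
  by rewrite mxE sre0.
by rewrite (rep_im (repv_ncov lid rid fh rl k (repv_mcv lid rid fh rl) j) Dx) sim0.
Qed.

Let nf := n_nullframe sX X1 rfX.
Let hE := n_pairD sX rfX.
Let giK : swapmx A *m gm Y (pairD E F) = 1%:M := fr_gi (null_frame nf).

Lemma imm_nparallel : nparallel Y E F.
Proof. exact: (frame_nparallel fh imm_parallel nf hE QP). Qed.
Let par := imm_nparallel.

Local Notation S := (aS half Y (@spd R D) gi).
Local Notation C := (aC half Y (@spd R D) gi).
Local Notation B := (aB half Y (@spd R D) gi).
Local Notation lap := (alap Y (@spd R D) gi).
Local Notation grad := (agrad (@spd R D) gi).
Let eS : aS half Y (pairD E F) (swapmx A) = S := fc_aS fh hE QP giK.
Let eC : aC half Y (pairD E F) (swapmx A) = C := fc_aC fh hE QP giK.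
Let eB m : aB half Y (pairD E F) (swapmx A) m = B m := fc_aB fh hE QP giK m.
Let eL w : alap Y (pairD E F) (swapmx A) w = lap w := fc_alap fh hE QP giK w.
Let eG u w : agrad (pairD E F) (swapmx A) u w = grad u w := fc_agrad fh hE QP giK u w.
Let ee := (eS, eC, eB, eL, eG).

Definition nng (G : A) := forall x, 0 <= sre G x /\ sim G x = 0.
Lemma nng_adot m (w : 'rV[A]_m) : nng (adot w (kv (@sconj R D) w)).
Proof. by move=> x; exact: adot_conj_ge0. Qed.
Lemma nng_mul (a : A) : nng (a * sconj a).
Proof. by move=> x; have [h1 h2 _] := mul_conj_ge0 a x; exact: (conj h1 h2). Qed.

Let kD := @sconjD R D.
Let kM := @sconjM R D.
Let k1 := sconj1 D.
Let kE := sconj_nD sX rfX.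
Let kX := sconj_Y sX.
Let kK := @sconjK R D.

Lemma chart_der_C k : spd k C = 0.
Proof. exact: (der_aC fh imm_parallel). Qed.

(** [Q] is the quartic differential in the null frame of the chart and the witness [T] its
    derivative, which enters only through |T|^2. The conjugation provides the factors belonging to
    [F]. *)
Lemma chart_quart : exists Q T : A,
  [/\ lap S = 2%:R * B 1 + (4%:R * C - 3%:R * S) * S + 4%:R * (Q * sconj Q),
      lap (Q * sconj Q) = 2%:R * (T * sconj T) + 4%:R * (2%:R * C - S) * (Q * sconj Q) &
      Q = nquart Y E F].
Proof.
have q1 : sconj (nquart Y E F) = nquart Y F E by exact: (k_quart kD kM kE kX kK).
exists (nquart Y E F), (seth Y E F 4 (nquart Y E F)).
have t1 : sconj (seth Y E F 4 (nquart Y E F)) = seth Y F E 4 (nquart Y F E).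
  by rewrite (k_seth kD kM k1 kE kX kK) q1.
rewrite q1 t1; split; last exact: erefl.
- have h := lap_S nf par; rewrite !ee in h; exact: h.
- have h := lap_q nf par; rewrite !ee in h; exact: h.
Qed.

Hypothesis quart0 : nquart Y E F = 0.
Let quart0' : nquart Y F E = 0.
Proof.
rewrite -(k_quart kD kM kE kX kK) quart0.
apply: sfun_ext => x Dx; [exact: erefl|exact: oppr0].
Qed.

(** Collects what later steps need from the null frame. The witnesses [p], [v], [y], [z] are
    |phi_0|^2 to |phi_3|^2, [w2] is the squared modulus of the second derivative of [p] along [E],
    [U] is the sextic differential and [T] its derivative. *)
Lemma chart_sext : exists p v y z w2 U T : A,
  let K := C - p in let a := 2%:R * K - p in let b := 5%:R * K - p in
  [/\ [/\ S = 2%:R * p, B 1 = 2%:R * v, 2%:R * B 2 = 4%:R * y + a ^+ 2 * 4%:R * p &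
          B 3 = 2%:R * z + 2%:R * b ^+ 2 * v + 2%:R * a ^+ 2 * v
            - 6%:R * a * grad p p - 8%:R * b * grad p p + 34%:R * p * grad p p],
      [/\ lap p = 2%:R * (v + a * p),
          lap (B 1) = 2%:R * B 2 + (14%:R * C - 9%:R * S) * B 1 - 7%:R * (2%:R * grad p p),
          lap (grad p p) = 4%:R * w2 + 4%:R * (v + a * p) ^+ 2
            + 4%:R * grad p (v + a * p) + 2%:R * K * grad p p &
          lap y = 2%:R * z + 2%:R * (b ^+ 2 * v - 4%:R * b * grad p p + 8%:R * p * grad p p)
            + 2%:R * (2%:R * b + 4%:R * K) * y - 20%:R * grad p v + 20%:R * a * grad p p
            - 18%:R * w2 + 2%:R * (U * sconj U)],
      lap (U * sconj U) = 2%:R * (T * sconj T) + 6%:R * (2%:R * C - S) * (U * sconj U) &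
      [/\ nng v, nng y, nng z & grad p p = 2%:R * (E p * sconj (E (sconj p)))]].
Proof.
pose p := nrho Y E F.
have s1 : sconj (nsext Y E F) = nsext Y F E by exact: (k_sext kD kM k1 kE kX kK).
exists p, (adot (nph1 Y E F) (nph1 Y F E)), (adot (nph2 Y E F) (nph2 Y F E)),
  (adot (nph3 Y E F) (nph3 Y F E)).
have L1 := lap_gg nf par quart0 quart0'.
(* The witness for [w2] is left open here and fixed by [L1]. *)
eexists; exists (nsext Y E F), (seth Y E F 6 (nsext Y E F)) => K a b.
have t1 : sconj (seth Y E F 6 (nsext Y E F)) = seth Y F E 6 (nsext Y F E).
  by rewrite (k_seth kD kM k1 kE kX kK) s1.
have eK : ncurv Y E F = K.
  have h := nul_C nf; rewrite eC in h; rewrite /K h -/p addrK; exact: erefl.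
have eSp : S = 2%:R * p.
  have h := nul_S nf; rewrite eS in h; exact: h.
rewrite s1 t1; split.
- split; first exact: eSp.
  + have h := B1_v nf par; rewrite !ee in h; exact: h.
  + have h := B2_y nf par quart0 quart0'; rewrite !ee eK in h; exact: h.
  + have h := B3_z nf par quart0 quart0'; rewrite !ee eK in h; exact: h.
- split.
  + have h := lap_p nf par quart0; rewrite !ee eK in h; exact: h.
  + have h := lap_B1 nf par quart0 quart0'; rewrite !ee in h; exact: h.
  + rewrite !ee eK in L1; exact: L1.
  + have h := lap_yy nf par quart0 quart0'; rewrite !ee eK in h; exact: h.
- have h := lap_s6 nf par quart0 quart0'; rewrite !ee in h; exact: h.
- split.
  + rewrite -(kv_nph1 kD kM k1 kE kX kK); exact: nng_adot.
  + rewrite -(kv_nph2 kD kM k1 kE kX kK); exact: nng_adot.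
  + rewrite -(kv_nph3 kD kM k1 kE kX kK); exact: nng_adot.
  + rewrite kE kK -eG; exact: grad_pp.
Qed.

(** Converts positivity of the intrinsic curvature, defined by Christoffel symbols, into positivity
    of 2c - S, the factor in both Bochner formulas. *)
Lemma chart_gauss x : os D x -> 2 * gauss_curv X x = 2 * cconst X x - Stilde X x.
Proof.
move=> Dx.
have G := gauss_frame fh (@spd_comm R D).
have cm := imm_comm sX.
have two : rep id (fun _ : P => 2%:R : R) (2%:R : A).
  move=> y Dy; split.
    rewrite mulr2n sreD (sre1 Dy); exact: erefl.
  rewrite mulr2n simD sim1; exact: addr0.
have r1 : rep id (fun y => 2 * (\sum_(l < 2) metric X y i0 l * riemann X l i1 i0 i1 y))
   (2%:R * \sum_l gm Y (@spd R D) i0 l * riem Y (@spd R D) gi l i1 i0 i1).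
  apply: repM; first exact: two.
  apply: rep_sum => l; apply: repM; [exact: (rep_gm lid rid)|exact: (rep_riem lid rid fh rl cm)].
have d1 y (Dy : os D y) : sre (sdet sX) y = mdet X y /\ sim (sdet sX) y = 0.
  by split; [exact: sdet_re|exact: sdet_im].
have r2 : rep id (fun y => mdet X y * (2 * cconst X y - Stilde X y))
   (sdet sX * (2%:R * C - S)).
  apply: repM; first exact: d1.
  apply: repB; last exact: (rep_aS lid rid fh rl).
  by apply: repM; [exact: two|exact: (rep_aC lid rid fh rl)].
have e : 2 * (\sum_(l < 2) metric X x i0 l * riemann X l i1 i0 i1 x) =
    mdet X x * (2 * cconst X x - Stilde X x).
  apply: etrans (esym (rep_re r1 Dx)) _; apply: etrans (rep_re r2 Dx).
  exact: (congr1 (fun F => sre F x) G).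
have m0 := mdet_gt0 rfX Dx.
rewrite /gauss_curv mulrA e.
have -> : \det (metric X x) = mdet X x.
  rewrite det2 /mdet expr2; congr (_ - _ * _).
  exact: metric_sym.
rewrite mulrC; exact: (mulKf (lt0r_neq0 m0)).
Qed.
End ChartIdentities.

(** * Passage from identities in the ring to functions on the surface *)

Section FrameCalculus.
Variables (A : comPzRingType) (n : nat) (half : A) (X : 'rV[A]_n).
Variables (D : 'I_2 -> A -> A) (gi : 'M[A]_2).
Hypothesis fh : frame half X D gi.
Local Notation lap := (alap X D gi).
Local Notation grad := (agrad D gi).
Let hd := fr_der fh.
Let D2 i x : D i (2%:R * x) = 2%:R * D i x.
Proof. by rewrite (derM (hd i)) (der_nat (hd i)) mul0r add0r. Qed.

Lemma alap2 w : lap (2%:R * w) = 2%:R * lap w.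
Proof. by rewrite /alap !sum_I2 !D2; ring. Qed.
Lemma agrad22 w : grad (2%:R * w) (2%:R * w) = 4%:R * grad w w.
Proof. by rewrite /agrad !sum_I2 !D2; ring. Qed.
Lemma agradC u w : grad u w = grad w u.
Proof. by rewrite /agrad !sum_I2 (gi_sym fh ord_max ord0); ring. Qed.
Lemma agradMl u u' w : grad (u * u') w = u * grad u' w + u' * grad u w.
Proof. by rewrite /agrad !sum_I2 !(derM (hd _)); ring. Qed.
Lemma agrad_const k w : (forall i, D i k = 0) -> grad k w = 0.
Proof. by move=> k0; rewrite /agrad !sum_I2 !k0 !mul0r !mulr0 !addr0. Qed.
(** With [k] constant, the gradient of the factor 2 (k - p) - p is -3 times that of [p]. *)
Lemma agrad_vap k p v : (forall i, D i k = 0) ->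
  grad p (v + (2%:R * (k - p) - p) * p) = grad p v + (2%:R * (k - p) - p - 3%:R * p) * grad p p.
Proof.
move=> k0; rewrite /agrad !sum_I2 !(derD (hd _), derM (hd _), derN (hd _)) ?(der_nat (hd _)) !(der1 (hd _)) !k0.
by ring.
Qed.
End FrameCalculus.

Section Solve.
Variables (A : comPzRingType) (half : A).
Hypothesis h2 : half * 2%:R = 1.
Lemma half_double x : half * (2%:R * x) = x.
Proof. by rewrite mulrA h2 mul1r. Qed.
Lemma half_quadruple x : half * (half * (4%:R * x)) = x.
Proof.
have -> : 4%:R * x = 2%:R * (2%:R * x) by ring.
by rewrite !half_double.
Qed.
End Solve.

Section Evaluate.
Variables (R : realType) (M : closedSurface R) (c : chart R M).
Local Notation A := (sfun (codo c)).
Local Notation half := (shalf (codo c)).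
Let h2 : half * 2%:R = 1 := shalfE (codo c).

Lemma grX2 (u : M -> R) (F : A) : gr c u F -> gr c (fun q => u q ^+ 2) (F ^+ 2).
Proof. by move=> h; exact: (grM h h). Qed.

Lemma gr_nng (u : M -> R) (F : A) x : nng F -> gr c u F -> cod c x -> 0 <= u (bwd c x).
Proof. move=> nF h Dx; have E : sre F x = u (bwd c x) := rep_re h Dx.
rewrite -E; exact: (nF x).1. Qed.

(* Syntactic dispatch: plain unification would unfold the operations of [sfun]. *)
Ltac reps := repeat (lazymatch goal with
  | H : gr _ _ ?F |- gr _ _ ?F => exact H
  | |- gr _ _ (GRing.mul _ _) => apply: grM
  | |- gr _ _ (GRing.add _ _) => apply: grD
  | |- gr _ _ (GRing.opp _) => apply: grN
  | |- gr _ _ (GRing.exp _ _) => apply: grX2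
  | |- gr _ _ (GRing.natmul _ _) => exact: gr_nat
  | |- gr _ _ (shalf _) => exact: gr_half
  end).

Variables (fp fk : M -> R) (p k : A).
Hypotheses (rp : gr c fp p) (rk : gr c fk k).
Local Notation a := (2%:R * (k - p) - p).
Local Notation b := (5%:R * (k - p) - p).
Local Notation fa q := (2%:R * (fk q - fp q) - fp q).
Local Notation fb q := (5%:R * (fk q - fp q) - fp q).

(** The identity is solved for [Q] by means of [half]. The resulting function involves surface
    functions alone, so that the unknown gets a meaning independent of the chart; [ev_y], [ev_z],
    [ev_w] and [ev_u] treat the other unknowns in the same way. *)
Lemma ev_quart fs fB fL s B L Q : gr c fs s -> gr c fB B -> gr c fL L ->
  L = 2%:R * B + (4%:R * k - 3%:R * s) * s + 4%:R * Q ->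
  gr c (fun q => 2^-1 * (2^-1 * (fL q - (2%:R * fB q + (4%:R * fk q - 3%:R * fs q) * fs q)))) Q.
Proof.
move=> r1 r2 r3 e.
have -> : Q = half * (half * (L - (2%:R * B + (4%:R * k - 3%:R * s) * s))).
  by rewrite e addrC addKr half_quadruple.
reps.
Qed.

Lemma ev_y fB B y : gr c fB B -> 2%:R * B = 4%:R * y + a ^+ 2 * 4%:R * p ->
  gr c (fun q => 2^-1 * fB q - fa q ^+ 2 * fp q) y.
Proof.
move=> r1 e.
have -> : y = half * B - a ^+ 2 * p.
  rewrite -[B](half_double h2) e.
  have -> : 4%:R * y + a ^+ 2 * 4%:R * p = 4%:R * (y + a ^+ 2 * p) by ring.
  by rewrite half_quadruple // addrK.
reps.
Qed.

Lemma ev_z fB fv fg B v g z : gr c fB B -> gr c fv v -> gr c fg g ->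
  B = 2%:R * z + 2%:R * b ^+ 2 * v + 2%:R * a ^+ 2 * v - 6%:R * a * g - 8%:R * b * g + 34%:R * p * g ->
  gr c (fun q => 2^-1 * fB q - (fb q ^+ 2 * fv q + fa q ^+ 2 * fv q - 3%:R * fa q * fg q
     - 4%:R * fb q * fg q + 17%:R * fp q * fg q)) z.
Proof.
move=> r1 r2 r3 e.
have -> : z = half * B - (b ^+ 2 * v + a ^+ 2 * v - 3%:R * a * g - 4%:R * b * g + 17%:R * p * g).
  rewrite e.
  have -> : 2%:R * z + 2%:R * b ^+ 2 * v + 2%:R * a ^+ 2 * v - 6%:R * a * g - 8%:R * b * g + 34%:R * p * g
    = 2%:R * (z + (b ^+ 2 * v + a ^+ 2 * v - 3%:R * a * g - 4%:R * b * g + 17%:R * p * g)) by ring.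
  by rewrite half_double // addrK.
reps.
Qed.

Lemma ev_w fL fv fg fh L v g h w : gr c fL L -> gr c fv v -> gr c fg g -> gr c fh h ->
  L = 4%:R * w + 4%:R * (v + a * p) ^+ 2 + 4%:R * (h + (a - 3%:R * p) * g) + 2%:R * (k - p) * g ->
  gr c (fun q => 2^-1 * (2^-1 * (fL q - (4%:R * (fv q + fa q * fp q) ^+ 2
    + 4%:R * (fh q + (fa q - 3%:R * fp q) * fg q) + 2%:R * (fk q - fp q) * fg q)))) w.
Proof.
move=> r1 r2 r3 r4 e.
have -> : w = half * (half * (L - (4%:R * (v + a * p) ^+ 2 + 4%:R * (h + (a - 3%:R * p) * g) + 2%:R * (k - p) * g))).
  rewrite [X in half * (half * X)](_ : _ = 4%:R * w); first by rewrite half_quadruple.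
  by rewrite e; ring.
reps.
Qed.

Lemma ev_u fL fv fg fh fy fz fw L v g h y z w u :
  gr c fL L -> gr c fv v -> gr c fg g -> gr c fh h -> gr c fy y -> gr c fz z -> gr c fw w ->
  L = 2%:R * z + 2%:R * (b ^+ 2 * v - 4%:R * b * g + 8%:R * p * g)
     + 2%:R * (2%:R * b + 4%:R * (k - p)) * y - 20%:R * h + 20%:R * a * g - 18%:R * w + 2%:R * u ->
  gr c (fun q => 2^-1 * (fL q - (2%:R * fz q + 2%:R * (fb q ^+ 2 * fv q - 4%:R * fb q * fg q + 8%:R * fp q * fg q)
     + 2%:R * (2%:R * fb q + 4%:R * (fk q - fp q)) * fy q - 20%:R * fh q + 20%:R * fa q * fg q - 18%:R * fw q))) u.
Proof.
move=> r1 r2 r3 r4 r5 r6 r7 e.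
have -> : u = half * (L - (2%:R * z + 2%:R * (b ^+ 2 * v - 4%:R * b * g + 8%:R * p * g)
     + 2%:R * (2%:R * b + 4%:R * (k - p)) * y - 20%:R * h + 20%:R * a * g - 18%:R * w)).
  rewrite [X in half * X](_ : _ = 2%:R * u); first by rewrite half_double.
  by rewrite e; ring.
reps.
Qed.

Lemma ev_half fB B v : gr c fB B -> B = 2%:R * v -> gr c (fun q => 2^-1 * fB q) v.
Proof. by move=> r e; have -> : v = half * B by [rewrite e half_double]; reps. Qed.

Variable x : R * R.
Hypothesis Dx : cod c x.
Local Notation "! u" := (u (bwd c x)) (at level 2).

(** Bochner's formula becomes an inequality when the nonnegative |T|^2 is discarded. *)
Lemma ev_lq m fs fL fQ s L Q T : gr c fs s -> gr c fL L -> gr c fQ Q ->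
  L = 2%:R * (T * sconj T) + m%:R * (2%:R * k - s) * Q ->
  m%:R * (2%:R * !fk - !fs) * !fQ <= !fL.
Proof.
move=> r1 r2 r3 e.
have r4 : gr c (fun q => fL q - m%:R * (2%:R * fk q - fs q) * fQ q) (2%:R * (T * sconj T)).
  have -> : 2%:R * (T * sconj T) = L - m%:R * (2%:R * k - s) * Q by rewrite e addrK.
  reps.
have E : sre (2%:R * (T * sconj T)) x = !fL - m%:R * (2%:R * !fk - !fs) * !fQ := rep_re r4 Dx.
rewrite -subr_ge0 -E mulr_natl mulr2n sreD; apply: addr_ge0; exact: (nng_mul T x).1.
Qed.

Lemma ev_lp fL fv L v : gr c fL L -> gr c fv v -> L = 2%:R * (v + a * p) ->
  !fL = 2%:R * (!fv + (2%:R * (!fk - !fp) - !fp) * !fp).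
Proof.
move=> r1 r2 e.
have r4 : gr c (fun q => 2%:R * (fv q + fa q * fp q)) L by rewrite e; reps.
exact: (gr_eq r1 r4 Dx).
Qed.

Lemma ev_lv fL fB fB1 fs fg L B B1 s g : gr c fL L -> gr c fB B -> gr c fB1 B1 -> gr c fs s -> gr c fg g ->
  2%:R * L = 2%:R * B + (14%:R * k - 9%:R * s) * B1 - 7%:R * (2%:R * g) ->
  2%:R * !fL = 2%:R * !fB + (14%:R * !fk - 9%:R * !fs) * !fB1 - 7%:R * (2%:R * !fg).
Proof.
move=> r1 r2 r3 r4 r5 e.
have r6 : gr c (fun q => 2%:R * fL q) (2%:R * L) by reps.
have r7 : gr c (fun q => 2%:R * fB q + (14%:R * fk q - 9%:R * fs q) * fB1 q - 7%:R * (2%:R * fg q)) (2%:R * L).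
  by rewrite e; reps.
exact: (gr_eq r6 r7 Dx).
Qed.

(** One shape for all gradient products: the constant 1 fills missing factors and the coefficient 0
    covers products that vanish. *)
Lemma ev_mul m fG fu fg G u g : gr c fG G -> gr c fu u -> gr c fg g ->
  G = m%:R * u * g -> !fG = m%:R * !fu * !fg.
Proof.
move=> r1 r2 r3 e.
have r4 : gr c (fun q => m%:R * fu q * fg q) G by rewrite e; reps.
exact: (gr_eq r1 r4 Dx).
Qed.
End Evaluate.

(** * Vanishing of both differentials and the integral identities *)

Section Main.
Variables (R : realType) (n : nat) (M : closedSurface R).
Variable f : M -> 'rV[R]_n.+1.
Variable mu : {measure set (borel M) -> \bar R}.
Hypothesis fi : sphere_immersion f.
Hypothesis am : is_area_measure f mu.
Hypothesis par : parallel_mean_curvature f.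
Hypothesis gauss : forall p : M, 0 < surface_fun f (@gauss_curv R n) p.
Implicit Types (c d : chart R M) (u w : M -> R).
#[local] Opaque derive spd.

Let S := surface_fun f (@Stilde R n).
Let C := surface_fun f (@cconst R n).
Let B m := surface_fun f (fun X => Btilde X m).
Let gS : gsm S := gsm_S fi.
Let gC : gsm C := gsm_C fi.
Let gB m : gsm (B m) := gsm_B fi m.
Local Notation L := (Lap f).
Local Notation G := (Gam f).

Ltac gsms := repeat (match goal with
  | |- gsm (fun _ => ?a) => exact: gsm_cst
  | H : gsm ?u |- gsm ?u => exact H
  | H : gsm ?u |- gsm (fun q => ?u q) => exact H
  | H : forall m, gsm (?u m) |- gsm (fun q => ?u ?m q) => exact (H m)
  | |- gsm (fun q => GRing.mul (@?u q) (@?w q)) => apply: (gsmM (u := u) (w := w))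
  | |- gsm (fun q => GRing.add (@?u q) (@?w q)) => apply: (gsmD (u := u) (w := w))
  | |- gsm (fun q => GRing.opp (@?u q)) => apply: (gsmN (u := u))
  | |- gsm (fun q => Lap _ ?u q) => apply: (gsm_Lap fi (w := u))
  | |- gsm (fun q => Gam _ ?u ?w q) => apply: (gsm_Gam fi (u := u) (w := w))
  | |- gsm (Gam _ ?u ?w) => apply: (gsm_Gam fi (u := u) (w := w))
  end).

Section InChart.
Variable c : chart R M.
Hypothesis ac : atlas c.
Lemma ch_par x : os (codo c) x -> forall k,
  normal_deriv (f \o bwd c) k (mean_curv (f \o bwd c)) x = 0.
Proof. by move=> Dx k; exact: (par ac Dx). Qed.
Lemma gauss_val x : cod c x -> 2 * gauss_curv (f \o bwd c) x = 2 * cconst (f \o bwd c) x - Stilde (f \o bwd c) x.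
Proof. exact: (chart_gauss (ch_sm fi ac) (ch_1 fi (c := c)) (ch_rf fi ac)). Qed.

Lemma grad_sq_val x : cod c x ->
  grad_sq (f \o bwd c) (Stilde (f \o bwd c)) x = gradb (f \o bwd c) (S \o bwd c) (S \o bwd c) x.
Proof.
move=> Dx; apply: eq_bigr => i _; apply: eq_bigr => j _.
have e k : pd k (Stilde (f \o bwd c) : R * R -> R^o) x = pd k (S \o bwd c : R * R -> R^o) x.
  apply: (pd_congr k (@cod_open _ _ c) Dx) => y Dy.
  exact: (esym (val_S fi ac Dy)).
exact: (congr2 (fun s t => imetric (f \o bwd c) x i j * (s * t)) (e i) (e j)).
Qed.
Lemma laplacian_val x : cod c x ->
  laplacian (f \o bwd c) (Stilde (f \o bwd c)) x = laplacian (f \o bwd c) (S \o bwd c) x.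
Proof.
move=> Dx; apply: eq_bigr => i _; apply: eq_bigr => j _.
have e k y : cod c y -> pd k (Stilde (f \o bwd c) : R * R -> R^o) y = pd k (S \o bwd c : R * R -> R^o) y.
  move=> Dy; apply: (pd_congr k (@cod_open _ _ c) Dy) => z Dz.
  exact: (esym (val_S fi ac Dz)).
have e1 : pd i (pd j (Stilde (f \o bwd c) : R * R -> R^o)) x = pd i (pd j (S \o bwd c : R * R -> R^o)) x.
  by apply: (pd_congr i (@cod_open _ _ c) Dx) => y; exact: e.
have e2 : \sum_(k < 2) christoffel (f \o bwd c) k i j x * pd k (Stilde (f \o bwd c) : R * R -> R^o) x =
  \sum_(k < 2) christoffel (f \o bwd c) k i j x * pd k (S \o bwd c : R * R -> R^o) x.
  by apply: eq_bigr => k _; exact: (congr1 (fun t => _ * t) (e k x Dx)).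
exact: (congr2 (fun s t => imetric (f \o bwd c) x i j * (s - t)) e1 e2).
Qed.
End InChart.

Lemma gauss_pos p : 0 < 2%:R * C p - S p.
Proof.
have Dx := fwd_cod (chart_at_dom p).
have h := gauss_val (chart_at_atlas p) Dx.
have g := gauss p.
suff -> : 2%:R * C p - S p = 2 * surface_fun f (@gauss_curv R n) p by rewrite mulr_gt0.
exact: (esym h).
Qed.
Lemma grad_sqE p : surface_fun f (@Stilde_grad_sq R n) p = G S S p.
Proof. exact: (grad_sq_val (chart_at_atlas p) (fwd_cod (chart_at_dom p))). Qed.
Lemma laplacianE p : surface_fun f (@Stilde_laplacian R n) p = L S p.
Proof. exact: (laplacian_val (chart_at_atlas p) (fwd_cod (chart_at_dom p))). Qed.

(** |Q|^2, solved from the formula for the Laplacian of S. *)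
Let q4 q := 2^-1 * (2^-1 * (L S q - (2%:R * B 1 q + (4%:R * C q - 3%:R * S q) * S q))).
Let gq4 : gsm q4. Proof. rewrite /q4; gsms. Qed.

Let quart_chart c (ac : atlas c) := chart_quart (ch_sm fi ac) (ch_1 fi (c := c)) (ch_rf fi ac) (ch_par ac).

Lemma q4_chart c (ac : atlas c) : exists Q : sfun (codo c),
  [/\ gr c q4 (Q * sconj Q), Q = nquart (cY fi ac) (nD (ch_sm fi ac) (ch_rf fi ac) ord0) (nD (ch_sm fi ac) (ch_rf fi ac) ord_max)
   & forall x, cod c x -> 4%:R * (2%:R * C (bwd c x) - S (bwd c x)) * q4 (bwd c x) <= L q4 (bwd c x)].
Proof.
have [Q [T [e1 e2 e3]]] := quart_chart ac.
have rq : gr c q4 (Q * sconj Q).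
  exact: (ev_quart (gr_C fi ac) (gr_S fi ac) (gr_B fi ac 1) (gr_Lap fi ac gS (gr_S fi ac)) e1).
exists Q; split; [exact: rq|exact: e3|move=> x Dx].
exact: (ev_lq (gr_C fi ac) Dx (gr_S fi ac) (gr_Lap fi ac gq4 rq) rq e2).
Qed.

Lemma q4_zero p : q4 p = 0.
Proof.
apply: (vanish fi am (k := fun p => 4%:R * (2%:R * C p - S p)) gq4).
- apply: gr_pt => c ac x Dx; have [Q [rq _ _]] := q4_chart ac.
  exact: (gr_nng (nng_mul Q) rq Dx).
- by move=> q; rewrite mulr_gt0 // gauss_pos.
- by apply: gr_pt => c ac x Dx; have [Q [_ _ h]] := q4_chart ac; exact: h.
Qed.

Lemma quart_zero c (ac : atlas c) :
  nquart (cY fi ac) (nD (ch_sm fi ac) (ch_rf fi ac) ord0) (nD (ch_sm fi ac) (ch_rf fi ac) ord_max) = 0.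
Proof.
have [Q [rq <- _]] := q4_chart ac.
apply: sfun_ext => x Dx; have [_ _ h] := mul_conj_ge0 Q x.
  by rewrite sre0; apply: (h _).1; rewrite (rep_re rq Dx) /= q4_zero.
by rewrite sim0; apply: (h _).2; rewrite (rep_re rq Dx) /= q4_zero.
Qed.

(** In the following definitions [p], [v], [y], [z] are |phi_0|^2 to |phi_3|^2, [w] is the squared
    modulus of the second null derivative of [p], and [s6] is that of the sextic differential; each
    is solved from a chart identity. [g] is |grad p|^2 and [h] is <grad p, grad v>. *)
Let p q := 2^-1 * S q.
Let v q := 2^-1 * B 1 q.
Let g := G p p.
Let h := G p v.
Let K q := C q - p q.
Let a q := 2%:R * (C q - p q) - p q.
Let b q := 5%:R * (C q - p q) - p q.
Let y q := 2^-1 * B 2 q - a q ^+ 2 * p q.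
Let z q := 2^-1 * B 3 q - (b q ^+ 2 * v q + a q ^+ 2 * v q - 3%:R * a q * g q
     - 4%:R * b q * g q + 17%:R * p q * g q).
Let w q := 2^-1 * (2^-1 * (L g q - (4%:R * (v q + a q * p q) ^+ 2
    + 4%:R * (h q + (a q - 3%:R * p q) * g q) + 2%:R * (C q - p q) * g q))).
Let s6 q := 2^-1 * (L y q - (2%:R * z q + 2%:R * (b q ^+ 2 * v q - 4%:R * b q * g q + 8%:R * p q * g q)
     + 2%:R * (2%:R * b q + 4%:R * (C q - p q)) * y q - 20%:R * h q + 20%:R * a q * g q - 18%:R * w q)).

Let gp : gsm p. Proof. rewrite /p; gsms. Qed.
Let gv : gsm v. Proof. rewrite /v; gsms. Qed.
Let gg : gsm g. Proof. rewrite /g; gsms. Qed.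
Let gh : gsm h. Proof. rewrite /h; gsms. Qed.
Let ga : gsm a. Proof. rewrite /a; gsms. Qed.
Let gb : gsm b. Proof. rewrite /b; gsms. Qed.
Let gX u : gsm u -> gsm (fun q => u q ^+ 2). Proof. by move=> gu; exact: (gsmM gu gu). Qed.
Let gy : gsm y.
Proof. have h1 := gX ga; rewrite /y; gsms. Qed.
Let gz : gsm z.
Proof.
have h1 := gX ga; have h2 := gX gb; have h3 := gB 3.
rewrite /z; gsms.
Qed.
Let gw : gsm w.
Proof.
have h1 : gsm (fun q => (v q + a q * p q) ^+ 2) by apply: (gX (u := fun q => v q + a q * p q)); gsms.
rewrite /w; gsms.
Qed.
Let gs6 : gsm s6.
Proof. have h2 := gX gb; rewrite /s6; gsms. Qed.

(** Each of [y], [z], [w], [s6] is represented in the ring only after the functions occurring in its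
    definition, and [w] and [s6] need the Laplacians of [g] and [y], hence their smoothness. The
    signs are those of squared moduli in the chart. *)
Lemma chart_facts c (ac : atlas c) x (Dx : cod c x) : let q := bwd c x in
  [/\ [/\ L p q = 2%:R * (v q + (2%:R * (C q - p q) - p q) * p q),
       2%:R * L v q = 2%:R * B 2 q + (14%:R * C q - 9%:R * S q) * B 1 q - 7%:R * (2%:R * g q) &
       L S q = 2%:R * L p q],
   [/\ G S S q = 4%:R * 1 * g q, G (fun q => C q * C q) p q = 0%:R * 1 * 1,
       G C p q = 0%:R * 1 * 1, G (fun q => C q * p q) p q = 1%:R * C q * g q &
       G (fun q => p q * p q) p q = 2%:R * p q * g q] /\ G v p q = h q /\ G C v q = 0%:R * 1 * 1,
   [/\ 0 <= v q, 0 <= y q, 0 <= z q, 0 <= g q & 0 <= s6 q] &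
   6%:R * (2%:R * C q - S q) * s6 q <= L s6 q].
Proof.
have [P [V [Y [Z [W [U [T [[e1 e2 e3 e4] [e5 e6 e7 e8] e9 [n1 n2 n3 n4]]]]]]]]] :=
  chart_sext (ch_1 fi (c := c)) (ch_par ac) (quart_zero ac).
have fh := cfh fi ac.
have kC i : spd i (aC (shalf (codo c)) (cY fi ac) (@spd R (codo c)) (cgi fi ac)) = 0.
  exact: (@chart_der_C R n (codo c) _ (ch_sm fi ac) (ch_1 fi (c := c)) (ch_rf fi ac) (ch_par ac) i).
have rC := gr_C fi ac; have rS := gr_S fi ac.
have rB1 := gr_B fi ac 1; have rB2 := gr_B fi ac 2; have rB3 := gr_B fi ac 3.
have rp : gr c p P := ev_half rS e1.
have rv : gr c v V := ev_half rB1 e2.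
have rg := gr_Gam fi ac gp gp rp rp; rewrite -/g in rg.
have rh := gr_Gam fi ac gp gv rp rv; rewrite -/h in rh.
have rhv := gr_Gam fi ac gv gp rv rp.
have ry : gr c y Y := ev_y rp rC rB2 e3.
have rz : gr c z Z := ev_z rp rC rB3 rv rg e4.
have rLp := gr_Lap fi ac gp rp; have rLv := gr_Lap fi ac gv rv.
have rLg := gr_Lap fi ac gg rg; have rLy := gr_Lap fi ac gy ry.
have rLS := gr_Lap fi ac gS rS.
have rSS := gr_Gam fi ac gS gS rS rS.
have rCC := grM rC rC; have rCP := grM rC rp; have rPP := grM rp rp.
have rGCC := gr_Gam fi ac (gsmM gC gC) gp rCC rp.
have rGC := gr_Gam fi ac gC gp rC rp.
have rGCv := gr_Gam fi ac gC gv rC rv.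
have rGCP := gr_Gam fi ac (gsmM gC gp) gp rCP rp.
have rGPP := gr_Gam fi ac (gsmM gp gp) gp rPP rp.
rewrite (agrad_vap fh P V kC) in e7.
have rw : gr c w W := ev_w rp rC rLg rv rg rh e7.
have rs : gr c s6 (U * sconj U) := ev_u rp rC rLy rv rg rh ry rz rw e8.
have rLs := gr_Lap fi ac gs6 rs.
have one : gr c (fun=> 1) (1 : sfun (codo c)) := gr_nat 1.
split.
- split.
  + exact: (ev_lp rp rC Dx rLp rv e5).
  + have e6' := e6; rewrite e2 (alap2 fh) -e2 in e6'.
    exact: (ev_lv rC Dx rLv rB2 rB1 rS rg e6').
  + have E := alap2 fh P; rewrite -e1 in E.
    have := ev_mul Dx rLS one rLp (m := 2%N) (etrans E (congr1 (fun t => t * _) (esym (mulr1 _)))).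
    by rewrite mulr1.
- split; first split; last split.
  + have E := agrad22 fh P; rewrite -e1 in E.
    exact: (ev_mul Dx rSS one rg (m := 4%N) (etrans E (congr1 (fun t => t * _) (esym (mulr1 _))))).
  + apply: (ev_mul Dx rGCC one one (m := 0%N)).
    by rewrite (agradMl fh) (agrad_const _ _ kC) !mulr0 addr0 !mul0r.
  + apply: (ev_mul Dx rGC one one (m := 0%N)).
    by rewrite (agrad_const _ _ kC) !mul0r.
  + apply: (ev_mul Dx rGCP rC rg (m := 1%N)).
    by rewrite (agradMl fh) (agrad_const _ _ kC) mulr0 addr0 mul1r.
  + apply: (ev_mul Dx rGPP rp rg (m := 2%N)).
    by rewrite (agradMl fh) -mulr2n -mulrA mulr_natl.
  + rewrite (agradC fh) in rhv; exact: (gr_eq rhv rh Dx).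
  + apply: (ev_mul Dx rGCv one one (m := 0%N)).
    by rewrite (agrad_const _ _ kC) !mul0r.
- split.
  + exact: (gr_nng n1 rv Dx).
  + exact: (gr_nng n2 ry Dx).
  + exact: (gr_nng n3 rz Dx).
  + have sP : sconj P = P by apply: sconj_real => t Dt; exact: (rep_im rp Dt).
    have Eg : sre (agrad (@spd R (codo c)) (cgi fi ac) P P) x = g (bwd c x) := rep_re rg Dx.
    rewrite -Eg n4 sP mulr_natl mulr2n sreD; apply: addr_ge0; exact: (nng_mul _ x).1.
  + exact: (gr_nng (nng_mul U) rs Dx).
- exact: (ev_lq rC Dx rS rLs rs e9).
Qed.
Lemma facts q :
  [/\ [/\ L p q = 2%:R * (v q + (2%:R * (C q - p q) - p q) * p q),
       2%:R * L v q = 2%:R * B 2 q + (14%:R * C q - 9%:R * S q) * B 1 q - 7%:R * (2%:R * g q) &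
       L S q = 2%:R * L p q],
   [/\ G S S q = 4%:R * 1 * g q, G (fun q => C q * C q) p q = 0%:R * 1 * 1,
       G C p q = 0%:R * 1 * 1, G (fun q => C q * p q) p q = 1%:R * C q * g q &
       G (fun q => p q * p q) p q = 2%:R * p q * g q] /\ G v p q = h q /\ G C v q = 0%:R * 1 * 1,
   [/\ 0 <= v q, 0 <= y q, 0 <= z q, 0 <= g q & 0 <= s6 q] &
   6%:R * (2%:R * C q - S q) * s6 q <= L s6 q].
Proof. by move: q; apply: gr_pt => c ac x Dx; exact: chart_facts. Qed.

Lemma s6_zero q : s6 q = 0.
Proof.
apply: (vanish fi am (k := fun q => 6%:R * (2%:R * C q - S q)) gs6).
- by move=> t; have [_ _ [_ _ _ _]] := facts t.
- by move=> t; rewrite mulr_gt0 // gauss_pos.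
- by move=> t; have [_ _ _] := facts t.
Qed.

Let br u w0 q := u q * L w0 q + G u w0 q.
Let gbr u w0 : gsm u -> gsm w0 -> gsm (br u w0).
Proof. move=> h1 h2; rewrite /br; gsms. Qed.
Let br0 u w0 : gsm u -> gsm w0 -> \int[mu]_q br u w0 q = 0.
Proof. exact: (green fi am). Qed.

(* Integrals only see a function modulo linear combinations of the integrands of
   Green's formula. *)
Let null u := gsm u /\ \int[mu]_q u q = 0.
Let null_br u w0 : gsm u -> gsm w0 -> null (br u w0).
Proof. by move=> h1 h2; split; [exact: gbr|exact: br0]. Qed.
Let nullD u u' : null u -> null u' -> null (fun q => u q + u' q).
Proof.
move=> [g1 i1] [g2 i2]; split; first exact: gsmD.
by rewrite (RintD fi am g1 g2) i1 i2 addr0.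
Qed.
Let nullZ (k : R) u : null u -> null (fun q => k * u q).
Proof.
move=> [g1 i1]; split; first exact: (gsmM (gsm_cst _) g1).
by rewrite (RintZ fi am _ g1) i1 mulr0.
Qed.
Let int_mod u u' u0 : gsm u' -> null u0 -> (forall q, u q = u' q + u0 q) ->
  \int[mu]_q u q = \int[mu]_q u' q.
Proof.
move=> g1 [g2 i2] e; transitivity (\int[mu]_q (u' q + u0 q)).
  by apply: eq_Rintegral => q _; exact: e.
by rewrite (RintD fi am g1 g2) i2 addr0.
Qed.

Let one : gsm (fun _ : M => 1 : R) := gsm_cst 1.
Let null1 u : gsm u -> null (L u).
Proof.
move=> gu; have [h1 h2] := null_br one gu; split; first exact: (gsm_Lap fi).
rewrite -h2; apply: eq_Rintegral => q _.
by rewrite /br mul1r Gam_cst addr0.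
Qed.
Let CC q := C q * C q.
Let CP q := C q * p q.
Let PP q := p q * p q.
Let gCC : gsm CC := gsmM gC gC.
Let gCP : gsm CP := gsmM gC gp.
Let gPP : gsm PP := gsmM gp gp.

(** The definitions of [y], [z], [w] and, as it vanishes, of [s6] are read backwards. All integrands
    become polynomials in C, p, v, y, z, w, g, h, treated as independent variables, and the integral
    identities become linear algebra modulo null functions. *)
Lemma solved q :
  [/\ S q = 2 * p q, B 1 q = 2 * v q, B 2 q = 2 * y q + 2 * (2 * C q - 3 * p q) ^+ 2 * p q,
   B 3 q = 2 * z q + 2 * ((5 * C q - 6 * p q) ^+ 2 + (2 * C q - 3 * p q) ^+ 2) * v q
     - (6 * (2 * C q - 3 * p q) + 8 * (5 * C q - 6 * p q) - 34 * p q) * g q &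
   [/\ L p q = 2 * (v q + (2 * C q - 3 * p q) * p q),
    L v q = B 2 q + (14 * C q - 18 * p q) * v q - 7 * g q,
    L g q = 4 * w q + 4 * (v q + (2 * C q - 3 * p q) * p q) ^+ 2
      + 4 * (h q + (2 * C q - 6 * p q) * g q) + 2 * (C q - p q) * g q,
    L y q = 2 * z q + 2 * ((5 * C q - 6 * p q) ^+ 2 * v q - 4 * (5 * C q - 6 * p q) * g q + 8 * p q * g q)
     + 2 * (14 * C q - 16 * p q) * y q - 20 * h q + 20 * (2 * C q - 3 * p q) * g q - 18 * w q &
    L S q = 2 * L p q]].
Proof.
have [[e1 e2 e3] _ _ _] := facts q.
have s0 := s6_zero q.
have hS : S q = 2 * p q by rewrite /p mulrA divff ?mul1r // pnatr_eq0.
have hB : B 1 q = 2 * v q by rewrite /v mulrA divff ?mul1r // pnatr_eq0.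
have hy : y q = 2^-1 * B 2 q - a q ^+ 2 * p q by [].
have hz : z q = 2^-1 * B 3 q - (b q ^+ 2 * v q + a q ^+ 2 * v q - 3%:R * a q * g q
     - 4%:R * b q * g q + 17%:R * p q * g q) by [].
have hw : w q = 2^-1 * (2^-1 * (L g q - (4%:R * (v q + a q * p q) ^+ 2
    + 4%:R * (h q + (a q - 3%:R * p q) * g q) + 2%:R * (C q - p q) * g q))) by [].
have hs : s6 q = 2^-1 * (L y q - (2%:R * z q + 2%:R * (b q ^+ 2 * v q - 4%:R * b q * g q + 8%:R * p q * g q)
     + 2%:R * (2%:R * b q + 4%:R * (C q - p q)) * y q - 20%:R * h q + 20%:R * a q * g q - 18%:R * w q)) by [].
have ha : a q = 2%:R * (C q - p q) - p q by [].
have hb : b q = 5%:R * (C q - p q) - p q by [].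
rewrite s0 in hs; rewrite hS hB in e2; rewrite ha hb in hs; rewrite ha in hw hy; rewrite ha hb in hz.
move: hy hz hw hs e1 e2 e3 hS hB.
move: (S q) (C q) (p q) (v q) (B 1 q) (B 2 q) (B 3 q) (y q) (z q) (w q) (g q) (h q)
  (L p q) (L v q) (L g q) (L y q) (L S q).
move=> S0 C0 p0 v0 B1 B2 B3 y0 z0 w0 g0 h0 Lp Lv Lg Ly LS hy hz hw hs e1 e2 e3 hS hB.
have i2 : (2 : R) != 0 by rewrite pnatr_eq0.
split; [exact: hS|exact: hB| | |split].
- by rewrite hy; field.
- by rewrite hz; field.
- by rewrite e1; ring.
- by apply: (mulfI i2); rewrite e2; ring.
- by rewrite hw; field.
- have E : Ly = Ly - 2 * 0 by rewrite mulr0 subr0.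
  by rewrite E [in LHS]hs; field.
- exact: e3.
Qed.

Lemma theorem_on_surface :
  [/\ (\int[mu]_q (S q * (3 * S q - 4 * C q)) = 2 * \int[mu]_q B 1 q) /\
      (2 * \int[mu]_q B 1 q >= 0),
      (\int[mu]_q (S q * (3 * S q - 4 * C q) * (3 * S q - 5 * C q))
       = 2 * \int[mu]_q (B 2 q - 1 / 4 * S q * (3 * S q - 4 * C q) ^+ 2 + 1 / 2 * G S S q)) /\
      (2 * \int[mu]_q (B 2 q - 1 / 4 * S q * (3 * S q - 4 * C q) ^+ 2 + 1 / 2 * G S S q) >= 0)
    & (\int[mu]_q (S q * (3 * S q - 4 * C q) * (3 * S q - 5 * C q) * (5 * S q - 9 * C q))
       = 2 * \int[mu]_q (B 3 q - 1 / 8 * S q * (3 * S q - 4 * C q)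
              * (45 * S q ^+ 2 - 144 * C q * S q + 116 * C q ^+ 2)
            + 1 / 8 * (65 * S q - 166 * C q) * G S S q - 5 / 8 * L S q ^+ 2)) /\
      (2 * \int[mu]_q (B 3 q - 1 / 8 * S q * (3 * S q - 4 * C q)
              * (45 * S q ^+ 2 - 144 * C q * S q + 116 * C q ^+ 2)
            + 1 / 8 * (65 * S q - 166 * C q) * G S S q - 5 / 8 * L S q ^+ 2)
       >= \int[mu]_q (3 / 4 * (25 * S q - 42 * C q) * G S S q - 5 / 4 * L S q ^+ 2))].
Proof.
have gSS : gsm (G S S) by exact: (gsm_Gam fi).
have gLS : gsm (L S) by exact: (gsm_Lap fi).
have gLS2 := gX gLS; have gSX := gX gS; have gCX := gX gC.
have gs4 : gsm (fun q => (3 * S q - 4 * C q) ^+ 2).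
  by apply: (gX (u := fun q => 3 * S q - 4 * C q)); gsms.
have fE q : [/\ G S S q = 4 * g q, br C p q = C q * L p q, br CC p q = C q ^+ 2 * L p q,
    br CP p q = C q * (p q * L p q + g q) & br PP p q = p q ^+ 2 * L p q + 2 * p q * g q]
    /\ br v p q = v q * L p q + h q /\ br C v q = C q * L v q.
  have [_ [[f1 f2 f3 f4 f5] [f6 f7]] _ _] := facts q.
  split; [split|split].
  - by rewrite f1 mulr1.
  - by rewrite /br f3 !mul0r addr0.
  - by rewrite /br [G CC p q]f2 !mul0r addr0 expr2.
  - by rewrite /br [G CP p q]f4 mul1r /CP; ring.
  - by rewrite /br [G PP p q]f5 /PP; ring.
  - by rewrite /br f6.
  - by rewrite /br f7 !mul0r addr0.
have N1 := null1 gS; have Nv := null1 gv; have Ng := null1 gg; have Ny := null1 gy.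
have NCp := null_br gC gp; have Npp := null_br gp gp; have NCv := null_br gC gv.
have Npv := null_br gp gv; have NCC := null_br gCC gp; have NCP := null_br gCP gp.
have NPP := null_br gPP gp; have Nvp := null_br gv gp.
have gB1 := gB 1; have gB2 := gB 2; have gB3 := gB 3.
pose I2 q := B 2 q - 1 / 4 * S q * (3 * S q - 4 * C q) ^+ 2 + 1 / 2 * G S S q.
pose I3 q := B 3 q - 1 / 8 * S q * (3 * S q - 4 * C q)
              * (45 * S q ^+ 2 - 144 * C q * S q + 116 * C q ^+ 2)
            + 1 / 8 * (65 * S q - 166 * C q) * G S S q - 5 / 8 * L S q ^+ 2.
pose J3 q := 3 / 4 * (25 * S q - 42 * C q) * G S S q - 5 / 4 * L S q ^+ 2.
have gI2 : gsm I2 by rewrite /I2; gsms.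
have gI3 : gsm I3 by rewrite /I3; gsms.
have gJ3 : gsm J3 by rewrite /J3; gsms.
have dbl (u : M -> R) : gsm u -> gsm (fun q => 2 * u q) by move=> gu; gsms.
split; split.
- rewrite -(RintZ fi am 2 gB1); apply: (int_mod (dbl _ gB1) (nullZ (-1) N1)) => q.
  have [hS hB _ _ [h1 _ _ _ h5]] := solved q.
  by rewrite h5 h1 hB hS; ring.
- rewrite mulr_ge0 //; apply: Rintegral_ge0 => q _.
  have [_ hB _ _ _] := solved q; have [_ _ [v0 _ _ _ _] _] := facts q.
  by rewrite hB mulr_ge0.
- rewrite -[in RHS](RintZ fi am 2 gI2).
  (* The -2 removes |nabla^2 h|^2, which the left side lacks; 14 and -18 then remove the products C
     v and p v coming from the Laplacian of [v], and the terms in [g] cancel. *)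
  apply: (int_mod (dbl _ gI2)
    (nullD (nullZ (-2) Nv) (nullD (nullZ 14 NCp) (nullZ (-18) Npp)))) => q.
  have [[f1 f2 f3 f4 f5] _] := fE q; have [hS hB hB2 _ [h1 h2 _ _ h5]] := solved q.
  by rewrite /I2 f2 /br -/g f1 h2 h1 hB2 hS; field.
- rewrite mulr_ge0 //; apply: Rintegral_ge0 => q _.
  have [_ _ [_ y0 _ g0 _] _] := facts q.
  have [[f1 _ _ _ _] _] := fE q; have [hS hB hB2 _ _] := solved q.
  (* The integrand is nonnegative pointwise, being 2 |phi_2|^2 + 2 |grad p|^2. *)
  have -> : B 2 q - 1 / 4 * S q * (3 * S q - 4 * C q) ^+ 2 + 1 / 2 * G S S q = 2 * y q + 2 * g q.
    by rewrite f1 hB2 hS; field.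
  by rewrite addr_ge0 // mulr_ge0.
- rewrite -[in RHS](RintZ fi am 2 gI3).
  (* The coefficients come from elimination: -2 removes [z], -9 removes [w], 28 and -32 remove C y
     and p y, the final 28 removes [h] together with v^2, and -204, 556, -390 remove C^2 v, C p v
     and p^2 v. *)
  apply: (int_mod (dbl _ gI3)
    (nullD (nullZ (-2) Ny) (nullD (nullZ (-9) Ng) (nullD (nullZ 28 NCv) (nullD (nullZ (-32) Npv)
    (nullD (nullZ (-204) NCC) (nullD (nullZ 556 NCP) (nullD (nullZ (-390) NPP) (nullZ 28 Nvp))))))))) => q.
  have [[f1 f2 f3 f4 f5] [f6 f7]] := fE q; have [hS hB hB2 hB3 [h1 h2 h3 h4 h5]] := solved q.
  rewrite /I3 f3 f4 f5 f6 f7 /br -/h f1 h5 h4 h3 h2 h1 hB3 hB2 hS.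
  by field.
- rewrite -(RintZ fi am 2 gI3).
  (* In |nabla^3 h|^2 the function [v] is multiplied by 2 ((5C - 6p)^2 + (2C - 3p)^2) = 2 (29 C^2 -
     72 C p + 45 p^2); each null function carries 2 v, so 58, -144 and 90 remove these terms from
     [2 * I3]. Beyond [J3] only 4 |phi_3|^2 is left. *)
  have nN := nullD (nullZ 58 NCC) (nullD (nullZ (-144) NCP) (nullZ 90 NPP)).
  have E : \int[mu]_q (2 * I3 q) = \int[mu]_q (J3 q + 4 * z q).
    apply: (int_mod _ nN); first by gsms.
    move=> q.
    have [[f1 f2 f3 f4 f5] [f6 f7]] := fE q; have [hS hB hB2 hB3 [h1 h2 h3 h4 h5]] := solved q.
    rewrite /I3 /J3 f3 f4 f5 f1 h5 h1 hB3 hS.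
    by field.
  rewrite E; apply: le_Rintegral => //.
  + by apply: (gsm_integrable fi am).
  + by apply: (gsm_integrable fi am); gsms.
  + move=> q _; have [_ _ [_ _ z0 _ _] _] := facts q.
    by rewrite lerDl mulr_ge0.
Qed.
End Main.

Theorem theorem1p3 (R : realType) (N : nat) (M : closedSurface R)
  (f : M -> 'rV[R]_N.+1) (mu : {measure set (borel M) -> \bar R}) :
  sphere_immersion f ->
  is_area_measure f mu ->
  parallel_mean_curvature f ->
  (forall p : M, 0 < surface_fun f (@gauss_curv R N) p) ->
  let c := surface_fun f (@cconst R N) in
  let S := surface_fun f (@Stilde R N) in
  let B1 := surface_fun f (fun X => Btilde X 1) in
  let B2 := surface_fun f (fun X => Btilde X 2) in
  let B3 := surface_fun f (fun X => Btilde X 3) in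
  let gradS2 := surface_fun f (@Stilde_grad_sq R N) in
  let lapS := surface_fun f (@Stilde_laplacian R N) in
  [/\ (\int[mu]_p (S p * (3 * S p - 4 * c p)) = 2 * \int[mu]_p B1 p) /\
      (2 * \int[mu]_p B1 p >= 0),
      (\int[mu]_p (S p * (3 * S p - 4 * c p) * (3 * S p - 5 * c p))
       = 2 * \int[mu]_p (B2 p - 1 / 4 * S p * (3 * S p - 4 * c p) ^+ 2
                         + 1 / 2 * gradS2 p)) /\
      (2 * \int[mu]_p (B2 p - 1 / 4 * S p * (3 * S p - 4 * c p) ^+ 2
                       + 1 / 2 * gradS2 p) >= 0)
    & (\int[mu]_p (S p * (3 * S p - 4 * c p) * (3 * S p - 5 * c p)
                   * (5 * S p - 9 * c p))
       = 2 * \int[mu]_p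
           (B3 p
            - 1 / 8 * S p * (3 * S p - 4 * c p)
              * (45 * S p ^+ 2 - 144 * c p * S p + 116 * c p ^+ 2)
            + 1 / 8 * (65 * S p - 166 * c p) * gradS2 p
            - 5 / 8 * lapS p ^+ 2)) /\
      (2 * \int[mu]_p
           (B3 p
            - 1 / 8 * S p * (3 * S p - 4 * c p)
              * (45 * S p ^+ 2 - 144 * c p * S p + 116 * c p ^+ 2)
            + 1 / 8 * (65 * S p - 166 * c p) * gradS2 p
            - 5 / 8 * lapS p ^+ 2)
       >= \int[mu]_p (3 / 4 * (25 * S p - 42 * c p) * gradS2 p
                      - 5 / 4 * lapS p ^+ 2))].
Proof.
move=> fi am par gauss c S B1 B2 B3 gradS2 lapS.
have -> : gradS2 = Gam f S S by apply/funext => p; exact: grad_sqE.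
have -> : lapS = Lap f S by apply/funext => p; exact: laplacianE.
exact: (theorem_on_surface fi am par gauss).
Qed.
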